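(* Let $\phi=(f_0:f_1:f_2):\mathbb{P}^1\to\mathbb{P}^2$ be a generically $1$-to-$1$ parametrization of the rational plane curve $\mathcal{C}$ of degree $d\geq 3$ over $\mathbb{C}$. For a positive integer $q$ and $j=0,1,2$ let $\phi^j_q:\Omega^j(\mathbb{C}^3)_q\to\Omega^j(\mathbb{C}^2)_{qd}$ be the linear map induced by pull-back of $j$-forms under $(f_0,f_1,f_2)$. Then the following properties hold. \begin{itemize} \item[i)] $\dim\operatorname{coker}\phi^0_q=\delta(\mathcal{C})=(d-1)(d-2)/2$ for any $q\geq d-2$. \item[ii)] $\dim\operatorname{coker}\phi^1_q=\tau(\mathcal{C})$, the global Tjurina number of $\mathcal{C}$, for any $q\geq d$, and for any $q\geq d-2$ when $\mathcal{C}$ is in addition free. \item[iii)] $\dim\operatorname{coker}\phi^2_q=\tau(\mathcal{C})-\delta(\mathcal{C})$ for any $q\geq d$. If $\mathcal{C}$ is in addition free (resp. nearly free) with exponents $(d_1,d_2)$, then the equality holds for any $q\geq d-d_1-1$ (resp. $q\geq d-d_1+1$). \end{itemize}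
   Context: Here $f_0,f_1,f_2\in R=\mathbb{C}[s,t]$ are homogeneous of the same degree $d$ with $\gcd(f_0,f_1,f_2)=1$, $\mathcal{C}$ is the image of $\phi$, and generically $1$-to-$1$ means that the fiber over a generic point of $\mathcal{C}$ is a single point (so $\deg\mathcal{C}=d$). Let $S=\mathbb{C}[x,y,z]$ and let $F\in S_d$ be a defining equation of $\mathcal{C}$. Forms: $\Omega^j(\mathbb{C}^2)$ and $\Omega^j(\mathbb{C}^3)$ are the graded modules of global differential $j$-forms with polynomial coefficients on $\mathbb{C}^2$ (coordinates $s,t$) and $\mathbb{C}^3$ (coordinates $x,y,z$), with grading $\deg s=\deg t=\deg \mathrm{d}s=\deg \mathrm{d}t=1$ and $\deg x=\deg y=\deg z=\deg \mathrm{d}x=\deg \mathrm{d}y=\deg \mathrm{d}z=1$; a subscript denotes the homogeneous component of that degree. The pull-back substitutes $x=f_0,y=f_1,z=f_2$ (and $\mathrm{d}x=\mathrm{d}f_0$, etc.). Invariants: $\delta(\mathcal{C})=\sum_P\delta_P$ is the sum of the delta invariants of the singular points of $\mathcal{C}$, equal to $(d-1)(d-2)/2$ as $\mathcal{C}$ is rational. With $J=(F_x,F_y,F_z)$ the Jacobian ideal, $\tau(\mathcal{C})=\dim_{\mathbb{C}}(S/J)_k$ for $k$ large (equivalently the sum of the Tjurina numbers of the singular points). Freeness: let $AR(F)=\{(a,b,c)\in S^3: aF_x+bF_y+cF_z=0\}$, a graded $S$-module in which $(a,b,c)$ has degree $k$ if $a,b,c\in S_k$. $\mathcal{C}$ is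 free with exponents $d_1\leq d_2$ if $AR(F)$ is a free graded $S$-module of rank two with a homogeneous basis $r_1,r_2$ of degrees $d_1,d_2$. $\mathcal{C}$ is nearly free with exponents $d_1\leq d_2$ if $AR(F)$ is generated by three homogeneous syzygies $r_1,r_2,r_3$ of degrees $d_1,d_2,d_3$ with $d_3=d_2$, and the syzygies among $r_1,r_2,r_3$ are generated by a single relation $hr_1+\ell r_2+\ell' r_3=0$ with $\ell,\ell'$ independent linear forms and $h\in S_{d_2+1-d_1}$. *)

(* Defs.v *)
From HB Require Import structures.
From mathcomp Require Import all_boot all_order all_algebra.
From mathcomp Require Import fraction complex reals mpoly.

Set Implicit Arguments.
Unset Strict Implicit.
Unset Printing Implicit Defensive.

Import GRing.Theory.
Local Open Scope ring_scope.

(** [has_dim_quot scale A B n]: the quotient vector space [A / B] has dimension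
    [n], where [A] is a [K]-subspace of [V] (for the action [scale]) and [B] is
    a subspace of [A]: there are [n] vectors of [A] modulo which every element
    of [A] has unique coordinates. *)
Definition has_dim_quot (K : fieldType) (V : zmodType) (scale : K -> V -> V)
    (A B : V -> Prop) (n : nat) : Prop :=
  exists e : 'I_n -> V, (forall i, A (e i)) /\
    forall v, A v ->
      exists! c : {ffun 'I_n -> K}, B (v - \sum_i scale (c i) (e i)).

Definition mp_dvd (K : fieldType) (n : nat) (p q : {mpoly K[n]}) : Prop :=
  exists r, q = r * p.

Section Forms.
Variable K : fieldType.

(** Strictly increasing [j]-tuples [i_1 < ... < i_j] of indices, labelling the
    basis [dx_{i_1} /\ ... /\ dx_{i_j}] of the [j]-forms on affine [n]-space. *)
Definition incr (n j : nat) :=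
  {t : j.-tuple 'I_n | sorted ltn [seq val i | i <- t]}.

Definition form (n j : nat) := {ffun incr n j -> {mpoly K[n]}}.

(** As each [dx_i] has degree 1, a [j]-form is homogeneous of degree [q] when
    its coefficients have degree [q - j]; there are none but 0 if [q < j]. *)
Definition homog_form (n j q : nat) (w : form n j) : Prop :=
  forall I, if (j <= q)%N then w I \is (q - j).-homog else w I == 0.

(** The coefficient of [ds_J] in [df_{I_1} /\ ... /\ df_{I_j}] is the minor of
    the Jacobian matrix of [f] with rows [I] and columns [J]. *)
Definition pullback (n m j : nat) (f : n.-tuple {mpoly K[m]}) (w : form n j) :
    form m j :=
  [ffun J : incr m j => \sum_(I : incr n j)
     (w I \mPo f) *
     \det (\matrix_(a < j, b < j)
             (tnth f (tnth (val I) a))^`M(tnth (val J) b))].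

(** [dim coker (f^* : Omega^j(K^3)_q -> Omega^j(K^2)_{qd}) = n]. *)
Definition has_dim_coker (f : 3.-tuple {mpoly K[2]}) (d j q n : nat) : Prop :=
  has_dim_quot (fun (c : K) (w : form 2 j) => c *: w)
    (fun w => homog_form (q * d) w)
    (fun w => exists2 v : form 3 j, homog_form q v & w = pullback f v)
    n.

End Forms.

Section Curves.
Variable K : fieldType.
Local Notation R := {mpoly K[2]}.
Local Notation S := {mpoly K[3]}.

(** Points of projective spaces are represented by nonzero vectors, up to
    [proj_eq]. *)
Definition proj_eq (n : nat) (u v : 'rV[K]_n) : Prop :=
  exists2 c : K, c != 0 & u = c *: v.

Definition gcd_one (f : 3.-tuple R) : Prop :=
  forall g : R, (forall i, mp_dvd g (tnth f i)) -> g \is a GRing.unit.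

Definition param (f : 3.-tuple R) (u : 'rV[K]_2) : 'rV[K]_3 :=
  \row_i (tnth f i).@[u 0].

Definition on_image (f : 3.-tuple R) (P : 'rV[K]_3) : Prop :=
  exists2 u : 'rV[K]_2, u != 0 & proj_eq P (param f u).

(** There is a nonempty open subset [{G <> 0}] of the image over which all the
    fibres are single points. *)
Definition generically_one_to_one (f : 3.-tuple R) : Prop :=
  exists (k : nat) (G : S),
    [/\ G \is k.-homog,
        exists2 P, on_image f P & G.@[P 0] != 0
      & forall u v : 'rV[K]_2, u != 0 -> v != 0 ->
          proj_eq (param f u) (param f v) ->
          G.@[param f u 0] != 0 -> proj_eq u v].

(** [F] generates the ideal of the polynomials vanishing on the image of [f]. *)
Definition defining_equation (f : 3.-tuple R) (F : S) : Prop :=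
  forall G : S, mp_dvd F G <-> (forall P, on_image f P -> G.@[P 0] = 0).

Definition singular_point (F : S) (P : 'rV[K]_3) : Prop :=
  [/\ P != 0, F.@[P 0] = 0 & forall i, (F^`M(i)).@[P 0] = 0].

Local Notation rat3 := {fraction {mpoly K[3]}}.

(** The local rings of the irreducible curve [C : F = 0] are described inside
    the field [K(x,y,z)]. The degree 0 fractions with denominator prime to [F]
    form the local ring of the plane at the generic point of [C]; those whose
    numerator is divisible by [F] form its maximal ideal, and the quotient is
    the function field [K(C)]. The local ring of [C] at [P] is the image in
    [K(C)] of the local ring of the plane at [P]. *)
Definition local_ring_plane (P : 'rV[K]_3) (x : rat3) : Prop :=
  exists (k : nat) (G H : S),
    [/\ G \is k.-homog, H \is k.-homog, H.@[P 0] != 0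
      & x = tofrac G / tofrac H].

Definition local_ring_generic (F : S) (x : rat3) : Prop :=
  exists (k : nat) (G H : S),
    [/\ G \is k.-homog, H \is k.-homog, ~ mp_dvd F H
      & x = tofrac G / tofrac H].

Definition max_ideal_generic (F : S) (x : rat3) : Prop :=
  exists (k : nat) (G H : S),
    [/\ G \is k.-homog, H \is k.-homog, ~ mp_dvd F H, mp_dvd F G
      & x = tofrac G / tofrac H].

(** Representatives of the functions in [K(C)] that lie in the local ring of
    [C] at [P], respectively in its integral closure. *)
Definition in_local_ring (F : S) (P : 'rV[K]_3) (x : rat3) : Prop :=
  exists y z, [/\ local_ring_plane P y, max_ideal_generic F z & x = y + z].

Definition in_normalization (F : S) (P : 'rV[K]_3) (x : rat3) : Prop :=
  local_ring_generic F x /\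
  exists p : {poly rat3},
    [/\ p \is monic, forall i, local_ring_plane P p`_i
      & max_ideal_generic F p.[x]].

Definition has_local_delta (F : S) (P : 'rV[K]_3) (n : nat) : Prop :=
  has_dim_quot (fun (c : K) (x : rat3) => tofrac (c%:MP : S) * x)
    (in_normalization F P) (in_local_ring F P) n.

(** The sum of the local delta invariants, over an enumeration [P] without
    repetition of the singular points of [F = 0]. *)
Definition has_delta (F : S) (delta : nat) : Prop :=
  exists (k : nat) (P : 'I_k -> 'rV[K]_3) (m : 'I_k -> nat),
    [/\ forall i, singular_point F (P i),
        forall i j, proj_eq (P i) (P j) -> i = j,
        forall Q, singular_point F Q -> exists i, proj_eq Q (P i),
        forall i, has_local_delta F (P i) (m i)
      & delta = \sum_i m i]%N.

Definition in_jacobian_ideal (F G : S) : Prop :=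
  exists a : 'I_3 -> S, G = \sum_i a i * F^`M(i).

Definition has_tjurina (F : S) (tau : nat) : Prop :=
  exists k0 : nat, forall k, (k0 <= k)%N ->
    has_dim_quot (fun (c : K) (G : S) => c *: G)
      (fun G => G \is k.-homog)
      (fun G => G \is k.-homog /\ in_jacobian_ideal F G)
      tau.

Definition AR (F : S) (r : 'rV[S]_3) : Prop :=
  \sum_i r 0 i * F^`M(i) = 0.

Definition homog_AR (F : S) (k : nat) (r : 'rV[S]_3) : Prop :=
  AR F r /\ forall i, r 0 i \is k.-homog.

Definition free_curve (F : S) (d1 d2 : nat) : Prop :=
  (d1 <= d2)%N /\
  exists r1 r2 : 'rV[S]_3,
    [/\ homog_AR F d1 r1, homog_AR F d2 r2
      & forall r, AR F r ->
          exists! ab : S * S, r = ab.1 *: r1 + ab.2 *: r2].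

Definition independent_linear_forms (l l' : S) : Prop :=
  [/\ l \is 1.-homog, l' \is 1.-homog
    & forall a b : K, a *: l + b *: l' = 0 -> a = 0 /\ b = 0].

Definition nearly_free_curve (F : S) (d1 d2 : nat) : Prop :=
  (d1 <= d2)%N /\
  exists r1 r2 r3 : 'rV[S]_3,
    [/\ homog_AR F d1 r1, homog_AR F d2 r2, homog_AR F d2 r3,
        forall r, AR F r ->
          exists a b c : S, r = a *: r1 + b *: r2 + c *: r3
      & exists h l l' : S,
        [/\ h \is (d2 + 1 - d1).-homog, independent_linear_forms l l',
            h *: r1 + l *: r2 + l' *: r3 = 0
          & forall a b c : S, a *: r1 + b *: r2 + c *: r3 = 0 ->
              exists g : S, [/\ a = g * h, b = g * l & c = g * l']]].

End Curves.

(* Main.v *)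
(* A binary form of degree n is identified with a polynomial of degree at most n,
   and the coordinate ring of the curve with the subring A of the polynomials
   G(f), graded by deg G.

   Functions. Let m = f x f' and let c be the common value of F_i(f) / m_i. A
   partial fraction computation (Lagrange interpolation on the fibres of a
   projection from a point off the curve) shows that c is a polynomial of degree
   (d - 1)(d - 2) and that c g lies in A for every g of degree
   kd - (d - 1)(d - 2) with k >= d - 1. A general line meets the curve in d
   points at which the forms of degree k take at least min(k + 1, d) independent
   values; hence multiplication by its equation is injective on the cokernel of
   phi^0, surjective from degree d - 2 on, and the dimensions follow.

   2-forms. The cokernel of phi^2 in degree q is that of the ideal of A generated
   by m, and multiplication by the equation of a general line is bijective on it
   from degree d on. Multiplying by c identifies A_(q-2) m with the Jacobian
   ideal, which gives the Tjurina number; counting the relations between the m_i,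
   that is the syzygies in AR(F), gives the sharper ranges for free and nearly
   free curves.

   1-forms. Contraction with the Euler field splits the cokernel of phi^1 into
   those of phi^2 and phi^0.

   Delta invariants. The forms in x, y, z act on the stable cokernel of phi^0, a
   space of dimension delta, and the action is triangularizable with common
   eigenvectors given by singular points, since c annihilates it. It is therefore
   the direct sum of its localizations at the singular points. A function is
   integral over the local ring at P iff it is p / H(f) with H(P) <> 0 and p
   a polynomial of the same degree, so each localization is the quotient of the
   normalization by the local ring. *)

(* All dimensions are codimensions in spaces of binary forms of degree k d, which have dimension k d
   + 1. Let n be the stable dimension of the cokernel of phi^2 and k = q + d - 3. The product of c
   with the forms of degree q d - 2 has codimension (d - 1)(d - 2) = 2 delta in the forms of degree
   k d, while A_k has codimension delta there. Hence S/J has dimension n + 2 delta - delta in degree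
   k, that is tau = delta + n. The delicate point is that n does not depend on q: if l v lies in the
   ideal of m, for a general line l, then v does. Over the d points of l the coefficients can be
   changed by relations between the m_i, and the conductor makes these relations available in A. For
   free and nearly free curves the value of d1 + d2 is not an assumption: it is forced by the
   constancy of n, and it then extends this constancy to lower degrees. The affine parameter hides
   the point at infinity. It survives in the nominal degree of each polynomial: the coefficient in
   that degree is the value at infinity. *)
Require Import Defs.
From HB Require Import structures.
From mathcomp Require Import all_boot all_order all_algebra.
From mathcomp Require Import perm separable boolp fraction complex reals mpoly ring zify.

Set Implicit Arguments.
Unset Strict Implicit.
Unset Printing Implicit Defensive.

Import GRing.Theory Num.Theory.
Local Open Scope ring_scope.

(** * Dimensions of quotients *)

Section QuotientDimension.
Variable K : fieldType.

Definition subspace (V : lmodType K) (A : V -> Prop) : Prop :=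
  A 0 /\ forall (c : K) u v, A u -> A v -> A (c *: u + v).

Definition lin (V : lmodType K) n (e : 'I_n -> V) (c : 'rV[K]_n) : V :=
  \sum_i c 0 i *: e i.

(** Spanning and independence are kept apart, unlike in [has_dim_quot], because each transports
    along linear maps. Predicates avoid forming the quotient A / B; [qdim_has] goes back to unique
    coordinates. *)
Definition qdim (V : lmodType K) (A B : V -> Prop) (n : nat) : Prop :=
  exists e : 'I_n -> V,
    [/\ forall i, A (e i),
        forall v, A v -> exists c, B (v - lin e c)
      & forall c, B (lin e c) -> c = 0].

Section Subspace.
Variables (V : lmodType K) (A : V -> Prop).
Hypothesis sA : subspace A.

Lemma subspace0 : A 0. Proof. by case: sA. Qed.
Lemma subspaceD u v : A u -> A v -> A (u + v).
Proof. by case: sA => _ h hu hv; rewrite -[u]scale1r; apply: h. Qed.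
Lemma subspaceZ c u : A u -> A (c *: u).
Proof. by case: sA => h0 h hu; rewrite -[_ *: _]addr0; apply: h. Qed.
Lemma subspaceN u : A u -> A (- u).
Proof. by move=> hu; rewrite -scaleN1r; apply: subspaceZ. Qed.
Lemma subspaceB u v : A u -> A v -> A (u - v).
Proof. by move=> hu hv; apply: subspaceD => //; apply: subspaceN. Qed.
Lemma subspace_sum (I : Type) (r : seq I) (P : pred I) (F : I -> V) :
  (forall i, P i -> A (F i)) -> A (\sum_(i <- r | P i) F i).
Proof. by move=> h; elim/big_ind: _ => //; [apply: subspace0 | apply: subspaceD]. Qed.
Lemma subspace_lin n (e : 'I_n -> V) c : (forall i, A (e i)) -> A (lin e c).
Proof. by move=> h; apply: subspace_sum => i _; apply: subspaceZ. Qed.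

End Subspace.

Lemma linD (V : lmodType K) n (e : 'I_n -> V) c c' :
  lin e (c + c') = lin e c + lin e c'.
Proof. by rewrite /lin -big_split; apply: eq_bigr => i _; rewrite mxE scalerDl. Qed.

Lemma linZ (V : lmodType K) n (e : 'I_n -> V) a c : lin e (a *: c) = a *: lin e c.
Proof. by rewrite /lin scaler_sumr; apply: eq_bigr => i _; rewrite mxE scalerA. Qed.

Lemma linB (V : lmodType K) n (e : 'I_n -> V) c c' :
  lin e (c - c') = lin e c - lin e c'.
Proof. by rewrite linD -[- c']scaleN1r linZ scaleN1r. Qed.

Lemma lin0 (V : lmodType K) n (e : 'I_n -> V) : lin e 0 = 0.
Proof. by rewrite /lin big1 // => i _; rewrite mxE scale0r. Qed.

Lemma lin_mul (V : lmodType K) n m (e : 'I_n -> V) (c : 'rV_m) (M : 'M_(m, n)) :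
  lin e (c *m M) = lin (fun i => lin e (row i M)) c.
Proof.
rewrite /lin; under eq_bigr do rewrite mxE scaler_suml.
rewrite exchange_big; apply: eq_bigr => i _; rewrite scaler_sumr.
by apply: eq_bigr => j _; rewrite scalerA mxE.
Qed.

Lemma lin_map (V W : lmodType K) (f : {linear V -> W}) n (e : 'I_n -> V) c :
  f (lin e c) = lin (fun i => f (e i)) c.
Proof. by rewrite /lin linear_sum; apply: eq_bigr => i _; rewrite linearZ. Qed.

Lemma qdim_has (V : lmodType K) (A B : V -> Prop) n :
  subspace B -> qdim A B n -> has_dim_quot (fun (c : K) (v : V) => c *: v) A B n.
Proof.
move=> sB [e [eA eg ei]]; exists e; split=> // v Av.
have [c hc] := eg v Av; exists [ffun i => c 0 i]; split.
  by rewrite /lin (eq_bigr (fun i => c 0 i *: e i)) // => i _; rewrite ffunE.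
move=> c' hc'; have /ei : B (lin e (c - \row_i c' i)).
  rewrite linB; have -> : lin e c - lin e (\row_i c' i) =
     (v - lin e (\row_i c' i)) - (v - lin e c) by rewrite opprB [RHS]addrC addrA subrK.
  apply: subspaceB => //; rewrite /lin (eq_bigr (fun i => c' i *: e i)) // => i _.
  by rewrite mxE.
by move=> /eqP; rewrite subr_eq0 => /eqP ->; apply/ffunP => i; rewrite ffunE mxE.
Qed.

Section Transport.
Variables (V W : lmodType K) (f : {linear V -> W}).
Variables (A B : V -> Prop) (A' B' : W -> Prop).
Hypotheses (sA : subspace A) (sB' : subspace B').
Hypothesis fA : forall v, A v -> A' (f v).
Hypothesis f_onto : forall w, A' w -> exists2 v, A v & B' (w - f v).
Hypothesis f_inj : forall v, A v -> (B v <-> B' (f v)).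

(** The hypotheses of the section say that f induces an isomorphism from A / B onto A' / B'. *)
Lemma qdim_map n : qdim A B n -> qdim A' B' n.
Proof.
move=> [e [eA eg ei]]; exists (fun i => f (e i)); split.
- by move=> i; apply: fA.
- move=> w /f_onto[v Av wv]; have [c hc] := eg v Av; exists c.
  rewrite -lin_map; have -> : w - f (lin e c) = (w - f v) + f (v - lin e c).
    by rewrite linearB /= addrA subrK.
  apply: subspaceD => //; apply/f_inj => //; apply: subspaceB => //.
  exact: subspace_lin.
- move=> c; rewrite -lin_map => h; apply: ei; apply/f_inj => //.
  exact: subspace_lin.
Qed.

Lemma qdim_comap n : qdim A' B' n -> qdim A B n.
Proof.
move=> [e [eA eg ei]].
have /fin_all_exists2[e' e'A ee'] : forall i, exists2 v, A v & B' (e i - f v).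
  by move=> i; apply: f_onto.
have lin_ee' c : B' (lin e c - f (lin e' c)).
  rewrite lin_map /lin -sumrB; apply: subspace_sum => // i _.
  by rewrite -scalerBr; apply: subspaceZ.
exists e'; split=> // [v Av|c].
- have [c hc] := eg (f v) (fA Av); exists c; apply/f_inj.
    by apply: subspaceB => //; apply: subspace_lin.
  rewrite linearB /=; have -> : f v - f (lin e' c) =
     (f v - lin e c) + (lin e c - f (lin e' c)) by rewrite addrA subrK.
  exact: subspaceD.
- move=> /f_inj -/(_ (subspace_lin sA _ e'A)) h; apply: ei.
  by rewrite -[lin e c](subrK (f (lin e' c))); apply: subspaceD.
Qed.

End Transport.

Section Calculus.
Variable V : lmodType K.
Implicit Types A B C : V -> Prop.

Lemma qdim_trans A B C n m :
  (forall v, B v -> A v) -> subspace C -> (forall v, C v -> B v) -> subspace B ->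
  qdim A B n -> qdim B C m -> qdim A C (n + m).
Proof.
move=> BA sC CB sB [e [eA eg ei]] [e' [e'B eg' ei']].
pose u i := match split i with inl j => e j | inr j => e' j end.
have linu c c' : lin u (row_mx c c') = lin e c + lin e' c'.
  rewrite /lin big_split_ord; congr (_ + _); apply: eq_bigr => i _.
    by rewrite row_mxEl /u; case: splitP => j /=; [move/ord_inj=> -> | have := ltn_ord i; lia].
  rewrite row_mxEr /u; case: splitP => j /=; first by have := ltn_ord j; lia.
  by move/addnI/ord_inj ->.
exists u; split.
- by move=> i; rewrite /u; case: split => j //; apply/BA.
- move=> v /eg[c hc]; have [c' hc'] := eg' _ hc; exists (row_mx c c').
  by rewrite linu opprD addrA.
- move=> c; rewrite -[c]hsubmxK linu => hc.
  have c0 : lsubmx c = 0.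
    apply: ei; rewrite -[lin e _](addrK (lin e' (rsubmx c))).
    by apply: subspaceB => //; [apply: CB | apply: subspace_lin].
  by move: hc; rewrite c0 lin0 add0r => /ei' ->; rewrite row_mx0.
Qed.

Lemma qdim_indep A B n m (u : 'I_n -> V) :
  subspace B -> (forall i, A (u i)) -> (forall c, B (lin u c) -> c = 0) ->
  qdim A B m -> (n <= m)%N.
Proof.
move=> sB uA ui [e [eA eg ei]].
have /fin_all_exists[M hM] : forall i, exists c, B (u i - lin e c) by move=> i; apply: eg.
pose N := \matrix_i M i.
suff /eqP rN : row_free N by rewrite -rN rank_leq_col.
rewrite -kermx_eq0; apply/eqP/row_matrixP => i; rewrite row0; apply: ui.
have rowN0 : row i (kermx N) *m N = 0.
  by apply/sub_kermxP; apply: row_sub.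
rewrite -[lin u _]subr0 -[X in _ - X](lin0 e) -rowN0 lin_mul /lin -sumrB.
by apply: subspace_sum => // j _; rewrite -scalerBr rowK; apply: subspaceZ.
Qed.

Lemma qdim_leq A B n m : subspace B -> qdim A B n -> qdim A B m -> (n <= m)%N.
Proof. by move=> sB [e [eA eg ei]]; apply: (qdim_indep sB eA ei). Qed.

Lemma qdim_uniq A B n m : subspace B -> qdim A B n -> qdim A B m -> n = m.
Proof. by move=> sB h h'; apply/eqP; rewrite eqn_leq !(qdim_leq sB (A := A)). Qed.

(** Since X is only a predicate, take a matrix of maximal rank among those whose row space lies in
    X: adjoining a vector of X cannot raise the rank, so the row space is all of X. *)
Lemma rowspace n (X : 'rV[K]_n -> Prop) :
  subspace X -> exists M : 'M[K]_n, forall v, X v <-> (v <= M)%MS.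
Proof.
move=> sX.
pose P r := `[< exists2 M : 'M[K]_n, (forall v, (v <= M)%MS -> X v) & \rank M = r >].
have P0 : exists r, P r.
  exists 0%N; apply/asboolP; exists 0; last by rewrite mxrank0.
  by move=> v; rewrite submx0 => /eqP ->; apply: subspace0.
have Pn r : P r -> (r <= n)%N by move=> /asboolP[M _ <-]; apply: rank_leq_col.
case: (ex_maxnP P0 Pn) => r /asboolP[M MX rM] maxr; exists M => v; split; last exact: MX.
move=> Xv; have : P (\rank (M + v)%MS).
  apply/asboolP; exists (M + v)%MS => // w /sub_addsmxP[[a b] /= ->].
  apply: subspaceD => //; first by apply: MX; apply: submxMl.
  by rewrite [b]mx11_scalar mul_scalar_mx; apply: subspaceZ.
move/maxr; rewrite -rM => h; apply: submx_trans (addsmxSr M v) _.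
by rewrite -(geq_leqif (mxrank_leqif_sup (addsmxSl M v))).
Qed.

(** Coordinates modulo C turn B into the row space of a matrix: a basis of it serves for B / C, a
    basis of a complement for A / B. The bound on m keeps the subtraction exact. *)
Lemma qdim_split A B C n :
  subspace A -> subspace B -> subspace C -> (forall v, B v -> A v) ->
  (forall v, C v -> B v) -> qdim A C n ->
  exists2 m, (m <= n)%N & qdim A B (n - m) /\ qdim B C m.
Proof.
move=> sA sB sC BA CB [e [eA eg ei]].
have [M hM] : exists M : 'M[K]_n, forall c, B (lin e c) <-> (c <= M)%MS.
  apply: rowspace; split; first by rewrite lin0; apply: subspace0.
  by move=> a c c' hc hc'; rewrite linD linZ; apply: subspaceD => //; apply: subspaceZ.
exists (\rank M); first exact: rank_leq_col.
have row_free_lin p (N : 'M[K]_(p, n)) c :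
  row_free N -> c *m N = 0 -> c = 0.
  by move=> fN h; apply: (row_free_inj fN); rewrite h mul0mx.
split.
  rewrite -(mxrank_compl M); exists (fun i => lin e (row i (row_base M^C%MS))).
  split=> [i|v /eg[c hc]|c]; first exact: subspace_lin.
    have : (c <= M + row_base M^C%MS)%MS.
      rewrite (adds_eqmx (eqmx_refl M) (eq_row_base _)).
      by apply: submx_full; rewrite addsmx_compl_full.
    move=> /sub_addsmxP[[a b] /= ec]; exists b; rewrite -lin_mul.
    have -> : v - lin e (b *m row_base M^C%MS) = (v - lin e c) + lin e (a *m M).
      by rewrite ec linD opprD addrA addrAC [_ - lin e (a *m M) + _]subrK.
    by apply: subspaceD => //; [apply: CB | apply/hM; apply: submxMl].
  rewrite -lin_mul => /hM h; apply: row_free_lin (row_base_free _) _.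
  apply/eqP; rewrite -submx0 -(capmx_compl M) sub_capmx h /=.
  by apply: submx_trans (submxMl _ _) _; rewrite eq_row_base.
exists (fun i => lin e (row i (row_base M))); split=> [i|v Bv|c].
- by apply/hM; rewrite (submx_trans (row_sub _ _)) // eq_row_base.
- have [c hc] := eg v (BA _ Bv).
  have : (c <= row_base M)%MS.
    rewrite eq_row_base; apply/hM; rewrite -[lin e c](subKr v).
    by apply: subspaceB => //; apply: CB.
  by move=> /submxP[b ec]; exists b; rewrite -lin_mul -ec.
- by rewrite -lin_mul => /ei; apply: row_free_lin; apply: row_base_free.
Qed.

Lemma qdim0_sub A B : subspace B -> qdim A B 0 -> forall v, A v -> B v.
Proof.
move=> sB [e [_ eg _]] v /eg[c]; rewrite [c]thinmx0 lin0 subr0 //.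
Qed.

Lemma qdim_eq A B C n :
  subspace A -> subspace B -> subspace C -> (forall v, B v -> A v) ->
  (forall v, C v -> B v) -> qdim A C n -> qdim B C n -> forall v, A v -> B v.
Proof.
move=> sA sB sC BA CB hA hB; have [m _ [h1 h2]] := qdim_split sA sB sC BA CB hA.
by apply: qdim0_sub => //; rewrite (qdim_uniq sC hB h2) subnn in h1.
Qed.

Lemma qdim_ext A B A' B' n :
  (forall v, A v <-> A' v) -> (forall v, B v <-> B' v) -> qdim A B n -> qdim A' B' n.
Proof.
move=> hA hB [e [eA eg ei]]; exists e; split.
- by move=> i; apply/hA.
- by move=> v /hA/eg[c hc]; exists c; apply/hB.
- by move=> c /hB; apply: ei.
Qed.

End Calculus.
End QuotientDimension.

(** * Binary forms as polynomials of bounded degree *)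

Section Univariate.
Variable K : numClosedFieldType.
Implicit Types p q a b u v : {poly K}.

Definition deg_le n (p : {poly K}) : Prop := (size p <= n.+1)%N.

Lemma deg_le_subspace n : subspace (deg_le n).
Proof.
split; first by rewrite /deg_le size_poly0.
move=> c u v hu hv; apply: leq_trans (size_polyD _ _) _.
by rewrite geq_max hv (leq_trans (size_scale_leq _ _)).
Qed.

Lemma deg_le_mul m n p q : deg_le m p -> deg_le n q -> deg_le (m + n) (p * q).
Proof. by rewrite /deg_le => hp hq; have := size_polyMleq p q; lia. Qed.

Lemma deg_leW m n p : (m <= n)%N -> deg_le m p -> deg_le n p.
Proof. by rewrite /deg_le; lia. Qed.

Lemma deg_le_exp n k p : deg_le n p -> deg_le (k * n) (p ^+ k).
Proof.
move=> hp; elim: k => [|k IH]; first by rewrite expr0 /deg_le size_poly1.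
by rewrite exprS mulSn; apply: deg_le_mul.
Qed.

Lemma deg_le_coef n p : deg_le n p <-> forall i, (n < i)%N -> p`_i = 0.
Proof.
split=> [hp i ni|h]; first by apply: nth_default; apply: leq_trans hp _.
by apply/leq_sizeP => i ni; apply: h.
Qed.

Lemma deg_le_deriv n p : deg_le n p -> deg_le n.-1 p^`().
Proof.
move=> /deg_le_coef hp; apply/deg_le_coef => i ni.
by rewrite coef_deriv hp ?mul0rn //; lia.
Qed.

Lemma qdim_deg_le n : qdim (deg_le n) (fun p => p = 0) n.+1.
Proof.
exists (fun i => 'X^i); split.
- by move=> i; rewrite /deg_le size_polyXn ltnS -ltnS.
- move=> p hp; exists (\row_i p`_i); apply/eqP; rewrite subr_eq0; apply/eqP.
  rewrite -[LHS]coefK (poly_def) /lin.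
  rewrite (big_ord_widen n.+1 (fun i => p`_i *: 'X^i) hp) big_mkcond /=.
  apply: eq_bigr => i _; rewrite mxE; case: ltnP => // /(nth_default 0) ->.
  by rewrite scale0r.
- move=> c /polyP hc; apply/rowP => i; have := hc i; rewrite /lin coef_sum coef0 mxE.
  rewrite (bigD1 i) //= big1 => [|j ji]; rewrite coefZ coefXn ?eqxx ?mulr1 ?addr0 //.
  have -> : (i == j :> nat) = false by apply: contraNF ji => /eqP/ord_inj ->.
  by rewrite mulr0.
Qed.

(** The last clause excludes a common zero at infinity, so that this is coprimality of binary forms
    of degrees m and n and not only of polynomials. *)
Definition coprime_forms m n (a b : {poly K}) :=
  [/\ deg_le m a, deg_le n b, coprimep a b
    & (size a == m.+1) || (size b == n.+1)].

Lemma coprime_formsC m n a b : coprime_forms m n a b -> coprime_forms n m b a.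
Proof. by case=> ? ? ? ?; split; rewrite 1?orbC // coprimep_sym. Qed.

(** By symmetry a has full degree. Reducing the coefficient of b modulo a makes it small, and the
    degree of the other coefficient is then controlled by that of p. *)
Lemma bezout_forms m n N a b p :
  coprime_forms m n a b -> (m + n <= N.+1)%N -> deg_le N p ->
  exists u v, [/\ deg_le (N - m) u, deg_le (N - n) v & p = u * a + v * b].
Proof.
move=> cab mnN hp.
wlog sa : m n a b cab mnN / size a = m.+1.
  move=> W; have [_ _ _ /orP[/eqP sa|/eqP sb]] := cab; first exact: (W m n).
  have [|u [v [hu hv ->]]] := W n m b a (coprime_formsC cab) _ sb.
    by rewrite addnC.
  by exists v, u; split; rewrite // addrC.
case: cab => ha hb cab _.
have a0 : a != 0 by rewrite -size_poly_gt0 sa.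
have /Bezout_eq1_coprimepP[[x y] /= xy] := cab.
have ep : p = p * x * a + p * y * b by rewrite -!mulrA -mulrDr xy mulr1.
pose v : {poly K} := (p * y) %% a; pose u : {poly K} := p * x + (p * y) %/ a * b.
have ep' : p = u * a + v * b.
  rewrite {1}ep /u {1}(divp_eq (p * y) a) -/v; ring.
have sv : (size v <= m)%N by rewrite -ltnS -sa ltn_modp.
exists u, v; split; [|apply: leq_trans sv _; lia|exact: ep']; rewrite /deg_le.
have [->|u0] := eqVneq u 0; first by rewrite size_poly0.
have : (size (u * a)%R <= N.+1)%N.
  have -> : u * a = p - v * b by rewrite ep' addrK.
  apply: leq_trans (size_polyD _ _) _; rewrite size_polyN geq_max hp /=.
  by apply: leq_trans (size_polyMleq v b) _; rewrite /deg_le in hb; lia.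
have u_gt0 := u0; rewrite -size_poly_gt0 in u_gt0.
by rewrite size_mul // sa; move: (size u) u_gt0 => s; lia.
Qed.

Lemma deriv_eq0 p : p^`() = 0 -> (size p <= 1)%N.
Proof.
move=> /polyP hp; apply/leq_sizeP => -[//|i] _.
by have /eqP := hp i; rewrite coef_deriv coef0 mulrn_eq0 /= => /eqP.
Qed.

Lemma dvdp_deriv p : p %| p^`() -> (size p <= 1)%N.
Proof.
move=> pp'; have [/deriv_eq0//|p'0] := eqVneq p^`() 0.
have p0 : p != 0 by apply: contraNneq p'0 => ->; rewrite deriv0.
by have := leq_trans (lt_size_deriv p0) (dvdp_leq p'0 pp'); rewrite ltnn.
Qed.

(** After division by the gcd, each of the coprime cofactors divides its own derivative, hence is
    constant in characteristic 0. *)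
Lemma wronskian_eq0 p q : p != 0 -> p * q^`() = p^`() * q -> exists c, q = c *: p.
Proof.
move=> p0 hpq; pose g := gcdp p q.
have g0 : g != 0 by rewrite gcdp_eq0 (negPf p0).
have /dvdpP[p1 ep] := dvdp_gcdl p q; have /dvdpP[q1 eq] := dvdp_gcdr p q.
rewrite -/g in ep eq.
have cop : coprimep p1 q1.
  have : gcdp p q %= g by apply: eqpxx.
  rewrite {1}ep {1}eq (eqp_ltrans (gcdp_mul2r _ _ _)) -{2}[g]mul1r eqp_mul2r //.
  by rewrite /coprimep => /eqp_size ->; rewrite size_poly1.
have p10 : p1 != 0 by apply: contraNneq p0 => h; rewrite ep h mul0r.
have hpq1 : p1 * q1^`() = p1^`() * q1.
  apply: (mulfI (expf_neq0 2 g0)); move: hpq; rewrite ep eq !derivM => h.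
  transitivity (p1 * g * (q1^`() * g + q1 * g^`()) - p1 * g * q1 * g^`()); first by ring.
  by rewrite h; ring.
have /size1_polyC e1 : (size p1 <= 1)%N.
  apply: dvdp_deriv; rewrite -(Gauss_dvdpl _ cop) -hpq1; exact: dvdp_mulr.
have /size1_polyC e2 : (size q1 <= 1)%N.
  apply: dvdp_deriv; rewrite coprimep_sym in cop.
  by rewrite -(Gauss_dvdpr _ cop) hpq1; apply: dvdp_mull.
have c0 : p1`_0 != 0 by apply: contraNneq p10 => h; rewrite e1 h.
exists (q1`_0 / p1`_0); rewrite eq ep e1 e2 !mul_polyC !coefC /= scalerA.
by rewrite divfK.
Qed.

(* The Lagrange interpolation polynomial of p at the roots of P is p itself,
   and the sum is its coefficient of degree [size P - 2] up to a constant. *)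
Lemma lagrange_sum (P p : {poly K}) (rs : seq K) :
  uniq rs -> size P = (size rs).+1 -> all (root P) rs -> (size p < size rs)%N ->
  \sum_(r <- rs) p.[r] / P^`().[r] = 0.
Proof.
move=> rs_uniq sP rsP sp.
have P0 : P != 0 by rewrite -size_poly_gt0 sP.
pose Q r := P %/ ('X - r%:P).
have PQ r : r \in rs -> P = Q r * ('X - r%:P).
  by move=> /(allP rsP); rewrite -dvdp_XsubCl => /divpK ->.
have P'Q r : r \in rs -> P^`().[r] = (Q r).[r].
  move=> hr; rewrite {1}(PQ r hr) derivM derivXsubC mulr1 hornerD hornerM.
  by rewrite hornerXsubC subrr mulr0 add0r.
have Q0 r r' : r \in rs -> r' \in rs -> r' != r -> (Q r).[r'] = 0.
  move=> hr hr' ne; have := allP rsP _ hr'; rewrite {1}(PQ r hr) rootM root_XsubC.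
  by rewrite (negPf ne) orbF => /eqP.
have sQ r : r \in rs -> size (Q r) = size rs.
  by move=> hr; rewrite size_divp ?polyXsubC_eq0 // size_XsubC sP /= subn1.
have P'0 r : r \in rs -> P^`().[r] != 0.
  move=> hr; apply/negP; rewrite (P'Q r hr) => Qr.
  have : Q r = 0.
    apply: (roots_geq_poly_eq0 (rs := rs)); rewrite ?sQ //.
    apply/allP => r' hr'; have [->//|ne] := eqVneq r' r.
    by apply/eqP/Q0.
  by move=> h; have := PQ r hr; rewrite h mul0r => e; rewrite e eqxx in P0.
have lQ r : r \in rs -> (Q r)`_(size rs).-1 = lead_coef P.
  move=> hr; rewrite (PQ r hr) lead_coef_Mmonic ?monicXsubC // /lead_coef.
  by rewrite sQ.
pose L := \sum_(r <- rs) (p.[r] / P^`().[r]) *: Q r.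
have Lp : L = p.
  apply/eqP; rewrite -subr_eq0; apply/eqP.
  apply: (roots_geq_poly_eq0 (rs := rs)) => //.
    apply/allP => r hr; rewrite /root !hornerE horner_sum (big_rem r) //=.
    rewrite big_seq big1 => [|r' ]; last first.
      rewrite mem_rem_uniq // inE => /andP[ne hr'].
      by rewrite hornerZ (Q0 r' r) ?mulr0 // eq_sym.
    by rewrite addr0 hornerZ -P'Q // divfK ?subrr // P'0.
  apply: leq_trans (size_polyD _ _) _; rewrite size_polyN geq_max (ltnW sp) andbT.
  apply: (leq_trans (size_sum _ _ _)); apply/bigmax_leqP_seq => r hr _.
  by apply: leq_trans (size_scale_leq _ _) _; rewrite sQ.
have : lead_coef P * \sum_(r <- rs) p.[r] / P^`().[r] = p`_(size rs).-1.
  rewrite -[in RHS]Lp coef_sum mulr_sumr !big_seq; apply: eq_bigr => r hr.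
  by rewrite coefZ lQ // mulrC.
rewrite nth_default; last by rewrite -ltnS prednK //; apply: leq_ltn_trans sp.
by move=> /eqP; rewrite mulf_eq0 lead_coef_eq0 (negPf P0) => /eqP.
Qed.

End Univariate.

(** * Forms in several variables *)

Section Homogeneous.
Variables (K : numClosedFieldType) (n : nat).
Local Notation S := {mpoly K[n]}.
Implicit Types p q G : S.

Lemma homog_ind k (P : S -> Prop) :
  P 0 -> (forall c m p, mdeg m = k -> P p -> P (c *: 'X_[m] + p)) ->
  forall p, p \is k.-homog -> P p.
Proof.
move=> P0 PS p /dhomogP hp; rewrite [p]mpolyE big_seq.
rewrite -big_seq big_seq; elim: (msupp p) hp => [|m s IH] hs.
  by rewrite big_nil.
rewrite -big_seq big_cons; apply: PS; first by apply: hs; rewrite mem_head.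
by rewrite big_seq; apply: IH => m' hm'; apply: hs; rewrite inE hm' orbT.
Qed.

Lemma mpoly_gen_ind (P : S -> Prop) :
  (forall c, P c%:MP) -> (forall i, P 'X_i) ->
  (forall p q, P p -> P q -> P (p + q)) ->
  (forall p q, P p -> P q -> P (p * q)) -> forall p, P p.
Proof.
move=> PC PX PD PM; have PX' m : P 'X_[m].
  rewrite mpolyXE_id; elim/big_ind: _ => //; first by rewrite -mpolyC1.
  move=> i _; elim: (m i) => [|k IH]; first by rewrite expr0 -mpolyC1.
  by rewrite exprS; apply: PM.
elim/mpolyind => [|c m p _ _ IH]; first by rewrite -mpolyC0.
by apply: PD => //; rewrite -mul_mpolyC; apply: PM.
Qed.

Lemma homog_subspace k : subspace (fun p : S => p \is k.-homog).
Proof.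
split; first exact: dhomog0.
by move=> c u v hu hv; apply: dhomogD => //; apply: dhomogZ.
Qed.

Lemma mderiv_homog k i p : p \is k.-homog -> p^`M(i) \is k.-1.-homog.
Proof.
elim/homog_ind => [|c m q mk hq]; first by rewrite mderiv0 dhomog0.
rewrite mderivD mderivZ mderivX; apply: dhomogD; last exact: hq.
apply: dhomogZ; have [->|mi] := eqVneq (m i) 0%N; first by rewrite scale0r dhomog0.
apply: dhomogZ; rewrite dhomogX -mk -{2}(submK (m:=U_(i)%MM) (m':=m)) ?mdegD ?mdeg1 ?addn1 //.
by apply/mnm_lepP => j; rewrite mnm1E; case: eqP => // <-; rewrite lt0n.
Qed.

Lemma euler k p : p \is k.-homog -> \sum_i 'X_i * p^`M(i) = k%:R *: p.
Proof.
elim/homog_ind => [|c m q mk hq].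
  by rewrite scaler0 big1 // => i _; rewrite mderiv0 mulr0.
rewrite scalerDr -hq; under eq_bigr do rewrite mderivD mulrDr.
rewrite big_split /=; congr (_ + _).
rewrite -mk mdegE natr_sum scaler_suml; apply: eq_bigr => i _.
rewrite mderivZ mderivX -!scalerAr scalerA [RHS]scalerA mulrC.
have [->|mi] := eqVneq (m i) 0%N; first by rewrite !mul0r !scale0r.
congr (_ *: _); rewrite -mpolyXD; congr 'X_[_].
rewrite addmC submK //; apply/mnm_lepP => j; rewrite mnm1E.
by case: eqP => // <-; rewrite lt0n.
Qed.

Lemma meval_homog k (c : K) (v : 'I_n -> K) p : p \is k.-homog ->
  p.@[fun i => c * v i] = c ^+ k * p.@[v].
Proof.
elim/homog_ind => [|a m q mk hq]; first by rewrite !meval0 mulr0.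
rewrite !mevalD !mevalZ hq !mevalX -mk mdegE expr_sum mulrDr; congr (_ + _).
by rewrite mulrCA -big_split; congr (_ * _); apply: eq_bigr => i _; rewrite exprMn.
Qed.

Lemma pihomogM k j p q : q \is j.-homog ->
  pihomog mdeg k (p * q) = if (j <= k)%N then pihomog mdeg (k - j) p * q else 0.
Proof.
move=> hq; have [b hb] : exists b, (mmeasure mdeg p <= b)%N by eexists.
rewrite {1}(pihomog_partitionE hb) mulr_suml linear_sum /=.
have hM (i : 'I_b) : pihomog mdeg k (pihomog mdeg i p * q) =
    if (i + j == k)%N then pihomog mdeg i p * q else 0.
  have h : pihomog mdeg i p * q \is (i + j).-homog by rewrite dhomogM ?pihomogP.
  case: eqP => [<-|/eqP ne]; first by rewrite pihomog_dE.
  by rewrite (pihomog_ne0 ne h).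
under eq_bigr do rewrite hM.
case: leqP => jk; last first.
  by rewrite big1 // => i _; case: eqP => // e; move: jk; rewrite -e; lia.
rewrite -big_mkcond /=; case: (ltnP (k - j) b) => kb.
  rewrite (big_pred1 (Ordinal kb)) // => i /=.
  by apply/eqP/eqP => [e|-> /=]; [apply: val_inj => /=; lia | rewrite subnK].
rewrite big_pred0; last by move=> i; have := ltn_ord i; lia.
rewrite pihomogE big_seq_cond big_pred0 ?mul0r // => m.
apply/negP => /andP[/(mmeasure_mnm_lt mdeg)/leq_trans/(_ hb) h /eqP e].
by move: h; rewrite e ltnNge kb.
Qed.

End Homogeneous.

(** The coefficient in the nominal degree is the value of a form at infinity, hence multiplicative
    even when it is not the leading coefficient. *)
Lemma coefM_top (K : numClosedFieldType) m n (p q : {poly K}) :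
  deg_le m p -> deg_le n q -> (p * q)`_(m + n) = p`_m * q`_n.
Proof.
move=> /deg_le_coef hp /deg_le_coef hq; have lt_m : (m < (m + n).+1)%N by lia.
rewrite coefM (bigD1 (Ordinal lt_m)) //= addKn big1 ?addr0 // => i.
rewrite -val_eqE /= => im; case: (ltnP m i) => mi; first by rewrite hp ?mul0r.
by rewrite hq ?mulr0 //; lia.
Qed.

Lemma coefX_top (K : numClosedFieldType) n k (p : {poly K}) :
  deg_le n p -> (p ^+ k)`_(k * n) = p`_n ^+ k.
Proof.
move=> hp; elim: k => [|k IH]; first by rewrite !expr0 coef1.
by rewrite !exprS mulSn coefM_top ?IH //; apply: deg_le_exp.
Qed.

Section Evaluation.
Variables (K : numClosedFieldType) (n : nat) (f : 'I_n -> {poly K}).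
Local Notation S := {mpoly K[n]}.
Implicit Types p q G : S.

Definition ev : S -> {poly K} := mmap (@polyC K) f.

HB.instance Definition _ := GRing.RMorphism.copy ev (mmap (@polyC K) f).
Lemma ev_scalable : scalable ev.
Proof. by move=> c p; rewrite /ev mmapZ mul_polyC. Qed.
HB.instance Definition _ := GRing.isScalable.Build K S {poly K} *:%R ev ev_scalable.

Lemma evZ c p : ev (c *: p) = c *: ev p. Proof. exact: linearZ. Qed.
Lemma evC c : ev c%:MP = c%:P. Proof. exact: mmapC. Qed.
Lemma evX i : ev 'X_i = f i. Proof. by rewrite /ev mmapX mmap1U. Qed.
Lemma evXm m : ev 'X_[m] = \prod_i f i ^+ m i. Proof. by rewrite /ev mmapX. Qed.

Lemma deriv_ev G : (ev G)^`() = \sum_i ev G^`M(i) * (f i)^`().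
Proof.
elim/mpoly_gen_ind: G => [c|i|p q hp hq|p q hp hq].
- by rewrite evC derivC big1 // => i _; rewrite mderivC rmorph0 mul0r.
- rewrite evX (bigD1 i) //= big1 => [|j ji].
    by rewrite mderivX mnm1E eqxx scale1r -{1}[U_(i)%MM]add0m addmK mpolyX0 rmorph1 mul1r addr0.
  by rewrite mderivX mnm1E eq_sym (negPf ji) scale0r rmorph0 mul0r.
- rewrite rmorphD derivD hp hq -big_split; apply: eq_bigr => i _ /=.
  by rewrite mderivD rmorphD mulrDl.
- rewrite rmorphM derivM hp hq mulr_suml mulr_sumr -big_split; apply: eq_bigr => i _ /=.
  by rewrite mderivM rmorphD !rmorphM mulrDl mulrAC mulrA.
Qed.

Lemma horner_ev a G : (ev G).[a] = G.@[fun i => (f i).[a]].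
Proof.
elim/mpoly_gen_ind: G => [c|i|p q hp hq|p q hp hq].
- by rewrite evC hornerC mevalC.
- by rewrite evX mevalXU.
- by rewrite rmorphD hornerD mevalD hp hq.
- by rewrite rmorphM hornerM mevalM hp hq.
Qed.

Variable d : nat.
Hypothesis fd : forall i, deg_le d (f i).

Lemma deg_le_prod (I : Type) (r : seq I) (e : I -> nat) (F : I -> {poly K}) :
  (forall i, deg_le (e i) (F i)) ->
  deg_le (\sum_(i <- r) e i)%N (\prod_(i <- r) F i) /\
  (\prod_(i <- r) F i)`_(\sum_(i <- r) e i)%N = \prod_(i <- r) (F i)`_(e i).
Proof.
move=> h; elim: r => [|i r [IH1 IH2]].
  by rewrite !big_nil coef1 /deg_le size_poly1.
rewrite !big_cons; split; first exact: deg_le_mul.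
by rewrite -IH2 coefM_top.
Qed.

Lemma ev_deg_le_top k G : G \is k.-homog ->
  deg_le (k * d) (ev G) /\ (ev G)`_(k * d) = G.@[fun i => (f i)`_d].
Proof.
elim/homog_ind => [|c m p mk [hp1 hp2]].
  by rewrite rmorph0 meval0 coef0; rewrite /deg_le size_poly0.
have [h1 h2] := deg_le_prod (index_enum 'I_n) (fun i => deg_le_exp (m i) (fd i)).
rewrite -big_distrl -mdegE mk /= in h1 h2.
rewrite linearP /= evXm mevalD mevalZ mevalX coefD coefZ hp2 h2; split.
  by have [_ ] := deg_le_subspace K (k * d); apply.
by congr (_ * _ + _); apply: eq_bigr => i _; rewrite coefX_top.
Qed.

Lemma ev_deg_le k G : G \is k.-homog -> deg_le (k * d) (ev G).
Proof. by case/ev_deg_le_top. Qed.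

Lemma ev_top k G : G \is k.-homog -> (ev G)`_(k * d) = G.@[fun i => (f i)`_d].
Proof. by case/ev_deg_le_top. Qed.

End Evaluation.

Section TernaryForms.
Variable K : numClosedFieldType.
Local Notation S := {mpoly K[3]}.

Lemma qdim_homog k :
  qdim (fun p : S => p \is k.-homog) (fun p => p = 0) 'C(k.+2, 2).
Proof.
pose W := dhomog 3 K k.
have -> : 'C(k.+2, 2) = \dim {:W}.
  rewrite dimvf /dim /=; transitivity 'C(k + 2, k + 2 - 2); last by rewrite addnK.
  by rewrite bin_sub ?leq_addl // addn2.
pose b := vbasis {:W}.
exists (fun i => (b`_i : S)); split.
- by move=> i; apply: dhomog_is_dhomog.
- move=> p hp; exists (\row_i coord b i (DHomog hp)).
  apply/eqP; rewrite subr_eq0; apply/eqP.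
  rewrite -[LHS]/(mpoly_of_dhomog (DHomog hp)).
  rewrite {1}(coord_vbasis (memvf (DHomog hp))) linear_sum; apply: eq_bigr => i _.
  by rewrite mxE linearZ.
- move=> c hc; apply/rowP => i; rewrite mxE.
  have /freeP fb : free b by apply: basis_free (vbasisP _).
  apply: (fb (fun i => c 0 i)).
  apply: val_inj; rewrite /= -[RHS]hc linear_sum; apply: eq_bigr => j _.
  by rewrite linearZ.
Qed.

End TernaryForms.

(** * Pencils of binary forms and the trace *)

Definition pair2 (T : Type) (x y : T) (i : 'I_2) : T := if i == 0 then x else y.

Section Pencil.
Variables (K : numClosedFieldType) (d : nat) (a b : {poly K}).
Hypothesis d_gt1 : (1 < d)%N.
Hypothesis cab : coprime_forms d d a b.
Let W := a * b^`() - a^`() * b.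
Hypothesis W0 : W != 0.
Local Notation T := {mpoly K[2]}.
Local Notation ev2 := (ev (pair2 a b)).

Lemma pencil_base r : (a.[r] != 0) || (b.[r] != 0).
Proof.
have [_ _ cop _] := cab; rewrite -negb_and; apply/negP => /andP[ar br].
by have := coprimep_root cop ar; rewrite br.
Qed.

Lemma pencil_base_inf : (a`_d != 0) || (b`_d != 0).
Proof.
have [ha hb _] := cab; case/orP => /eqP e; [rewrite -[a`_d]/(a`_(d.+1.-1)) | rewrite -[b`_d]/(b`_(d.+1.-1)) orbC];
  by rewrite -e -/(lead_coef _) lead_coef_eq0 -size_poly_gt0 e.
Qed.

(** The fibre of (a : b) over (x : y) when it consists of d distinct finite points. The scalars
    [k r] record the representatives of the projective point, which the homogeneity of traces
    needs. *)
Definition fibre (x y : K) (rs : seq K) (k : K -> K) : Prop :=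
  [/\ uniq rs, size rs = d, size (y *: a - x *: b) = d.+1 &
    forall r, r \in rs -> [/\ a.[r] = k r * x, b.[r] = k r * y, k r != 0 & W.[r] != 0]].

(** This replaces W by the derivative of a member of the pencil at its roots, so that sums of p / W
    over a fibre fall under [lagrange_sum]. *)
Lemma pencil_deriv_root (x y : K) k r : a.[r] = k * x -> b.[r] = k * y ->
  k * (y *: a - x *: b)^`().[r] = - W.[r].
Proof.
move=> ha hb; rewrite /W derivB !derivZ !hornerE ha hb; ring.
Qed.

Lemma pencil_comb0 x y : (x != 0) || (y != 0) -> y *: a - x *: b != 0.
Proof.
move=> xy; apply: contra W0 => /eqP; rewrite -!mul_polyC => h.
have hd : x%:P * b^`() = y%:P * a^`().
  have := congr1 (@deriv _) h; rewrite derivB !mul_polyC !derivZ deriv0 -!mul_polyC => /eqP.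
  by rewrite subr_eq0 => /eqP ->.
have {}h : x%:P * b = y%:P * a by apply/esym/eqP; rewrite -subr_eq0 h.
have [x0|y0] := orP xy.
  have : x%:P * W = 0.
    transitivity (a * (x%:P * b^`()) - a^`() * (x%:P * b)); first by rewrite /W; ring.
    by rewrite h hd; ring.
  by move/eqP; rewrite mulf_eq0 polyC_eq0 (negPf x0).
have : y%:P * W = 0.
  transitivity ((y%:P * a) * b^`() - (y%:P * a^`()) * b); first by rewrite /W; ring.
  by rewrite -h -hd; ring.
by move/eqP; rewrite mulf_eq0 polyC_eq0 (negPf y0).
Qed.

(* The members of the pencil through a root of [Psi0 * W] or through the point
   at infinity are excluded; a multiple root of a member is a root of [W]. *)
Lemma generic_fibre (Psi0 : {poly K}) : Psi0 != 0 ->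
  exists2 Psi : {poly K}, Psi != 0 & forall q, Psi.[q] != 0 ->
    exists rs k, [/\ fibre a.[q] b.[q] rs k,
      forall r, root (b.[q] *: a - a.[q] *: b) r = (r \in rs) &
      forall r, r \in rs -> Psi0.[r] != 0].
Proof.
move=> Psi0_neq0; have [bad Dbad] := closed_field_poly_normal (Psi0 * W).
have badP r : root (Psi0 * W) r = (r \in bad).
  rewrite Dbad rootZ ?root_prod_XsubC // lead_coef_eq0 mulf_neq0 //.
exists ((a`_d *: b - b`_d *: a) * \prod_(r <- bad) (a.[r] *: b - b.[r] *: a)).
  rewrite mulf_neq0 //.
    by rewrite -oppr_eq0 opprB pencil_comb0 // pencil_base_inf.
  rewrite prodf_seq_neq0; apply/allP => r _ /=.
  by rewrite -oppr_eq0 opprB pencil_comb0 // pencil_base.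
move=> q; rewrite hornerM mulf_eq0 negb_or => /andP[qinf qbad].
set x := a.[q]; set y := b.[q]; set P := y *: a - x *: b.
have P0 : P != 0 by rewrite pencil_comb0 // pencil_base.
have sP : size P = d.+1.
  apply/eqP; rewrite eqn_leq; apply/andP; split.
    have [ha hb _ _] := cab; have [_ h] := deg_le_subspace K d.
    rewrite -/(deg_le d P) /P addrC -scaleNr; apply: h => //.
    by apply: subspaceZ => //; apply: deg_le_subspace.
  rewrite ltnNge; apply: contra qinf => /(nth_default 0).
  rewrite /P coefB !coefZ => h; apply/eqP; rewrite -[RHS]h !hornerE -/x -/y.
  ring.
have [rs Drs] := closed_field_poly_normal P.
have rsP r : root P r = (r \in rs).
  by rewrite Drs rootZ ?root_prod_XsubC // lead_coef_eq0.
have Pr r : r \in rs -> y * a.[r] = x * b.[r].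
  by rewrite -rsP /root /P !hornerE subr_eq0 => /eqP.
have rs_bad r : r \in rs -> r \notin bad.
  move=> hr; apply: contra qbad => rb.
  rewrite horner_prod prodf_seq_eq0; apply/hasP; exists r => //=.
  by rewrite !hornerE -/x -/y subr_eq0 mulrC (mulrC b.[r]) Pr.
have good r : r \in rs -> Psi0.[r] != 0 /\ W.[r] != 0.
  move=> /rs_bad; rewrite -badP /root hornerM mulf_eq0 negb_or => /andP[-> ->] //.
pose k r := if x == 0 then b.[r] / y else a.[r] / x.
have kP r : r \in rs -> a.[r] = k r * x /\ b.[r] = k r * y.
  move=> hr; have := Pr r hr; rewrite /k; case: eqVneq => [x0|x0] h.
    have y0 : y != 0 by have := pencil_base q; rewrite -/x -/y x0 eqxx.
    rewrite divfK //; split=> //; move: h; rewrite x0 mul0r mulr0 => /eqP.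
    by rewrite mulf_eq0 (negPf y0) => /eqP.
  rewrite divfK //; split=> //; apply: (mulfI x0).
  by rewrite -h mulrCA mulrA divfK // mulrC.
have kn0 r : r \in rs -> k r != 0.
  move=> hr; have [e1 e2] := kP r hr; have := pencil_base r.
  by apply: contraTneq => k0; rewrite e1 e2 k0 !mul0r eqxx.
exists rs, k; split; last 1 first.
- by move=> r /good[].
- split.
  + rewrite -separable_prod_XsubC.
    have lP : lead_coef P != 0 by rewrite lead_coef_eq0.
    rewrite -(eqp_separable (eqp_scale _ lP)) -Drs unlock.
    apply/Pdiv.ClosedField.coprimepP => r.
    rewrite rsP => hr; have [e1 e2] := kP r hr; have [_ Wr] := good r hr.
    apply: contra Wr => /eqP P'r; rewrite -oppr_eq0 -(pencil_deriv_root e1 e2) -/P.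
    by rewrite P'r mulr0.
  + have := sP; rewrite Drs size_scale ?lead_coef_eq0 // size_prod_XsubC => -[].
    by [].
  + exact: sP.
  + move=> r hr; have [e1 e2] := kP r hr; have [_ h] := good r hr; split=> //.
    exact: kn0.
- exact: rsP.
Qed.

(** Each application of Bezout lowers the degree by d; the bound on N is what the last application
    needs. So the monomials of degree N generate these forms over the forms in a and b. *)
Lemma pencil_decomp k N p : (d <= N.+1)%N -> deg_le (k * d + N) p ->
  exists2 t : 'I_N.+1 -> T, (forall l, t l \is k.-homog)
    & p = \sum_l ev2 (t l) * 'X^l.
Proof.
clear W0 => dN; elim: k p => [|k IH] p hp.
  exists (fun l => (p`_l)%:MP) => [l|].
    by rewrite -[_%:MP]mulr1 mul_mpolyC dhomogZ ?dhomog1.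
  rewrite -[LHS]coefK poly_def (big_ord_widen N.+1 (fun i => p`_i *: 'X^i) hp).
  rewrite big_mkcond; apply: eq_bigr => i _; rewrite evC mul_polyC.
  by case: ltnP => // /(nth_default 0) ->; rewrite scale0r.
have [|u [v [hu hv ->]]] := bezout_forms cab _ hp; first by lia.
have e : (k.+1 * d + N - d = k * d + N)%N by lia.
rewrite e in hu hv; have [tu tuh Du] := IH u hu; have [tv tvh Dv] := IH v hv.
exists (fun l => 'X_0 * tu l + 'X_1 * tv l) => [l|].
  have hX (i : 'I_2) : 'X_i \is [in K[2], 1.-homog] by rewrite dhomogX /= mdeg1.
  by apply: dhomogD; rewrite -[k.+1]add1n; apply: dhomogM.
rewrite {1}Du {1}Dv !mulr_suml -big_split; apply: eq_bigr => l _ /=.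
by rewrite rmorphD !rmorphM /= !evX /pair2 /=; ring.
Qed.

(** In degree 2d - 2 the quotient by (a, b) is a line spanned by W. Bezout applies one degree
    higher; since the coefficient of p there is 0, the top coefficients of u and v are proportional
    to those of b and -a. Subtracting a multiple of (b', -a') removes them and costs a multiple of
    W. *)
Lemma jacobian_decomp p : deg_le (2 * d - 2) p ->
  exists (c : K) u v, [/\ deg_le (d - 2) u, deg_le (d - 2) v & p = u * a + v * b + c *: W].
Proof.
move=> hp; have hp' : deg_le (2 * d - 1) p by apply: deg_leW hp; lia.
have [|u [v [hu hv ep]]] := bezout_forms cab _ hp'; first by lia.
have ed : (2 * d - 1 - d = d.-1)%N by lia.
have ed' : (2 * d - 1 = d.-1 + d)%N by lia.
rewrite ed in hu hv; have [ha hb _ _] := cab.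
have top : u`_d.-1 * a`_d + v`_d.-1 * b`_d = 0.
  rewrite -(coefM_top hu ha) -(coefM_top hv hb) -coefD -ep -ed'.
  by move/deg_le_coef: hp; apply; lia.
have d0 : d%:R != 0 :> K by rewrite pnatr_eq0; lia.
have [g [gu gv]] : exists g, u`_d.-1 = g * b`_d /\ v`_d.-1 = - (g * a`_d).
  have [b0|b0] := eqVneq b`_d 0; last first.
    exists (u`_d.-1 / b`_d); rewrite divfK //; split=> //; apply: (mulIf b0).
    by rewrite mulNr mulrAC divfK //; apply/eqP; rewrite -addr_eq0 addrC top.
  have a0 : a`_d != 0 by have := pencil_base_inf; rewrite b0 eqxx orbF.
  exists (- (v`_d.-1 / a`_d)); rewrite b0 mulr0 mulNr divfK // opprK; split=> //.
  by move/eqP: top; rewrite b0 mulr0 addr0 mulf_eq0 (negPf a0) orbF => /eqP.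
have deg2 w : deg_le d.-1 w -> w`_d.-1 = 0 -> deg_le (d - 2) w.
  move=> /deg_le_coef hw w0; apply/deg_le_coef => i hi.
  by have [->//|ne] := eqVneq i d.-1; apply: hw; lia.
have der w : deg_le d w -> w^`()`_d.-1 = d%:R * w`_d.
  by move=> _; rewrite coef_deriv prednK ?mulr_natl //; lia.
exists (g / d%:R), (u - (g / d%:R) *: b^`()), (v + (g / d%:R) *: a^`()); split.
- apply: deg2.
    apply: (subspaceB (deg_le_subspace K _)) => //.
    by apply: (subspaceZ (deg_le_subspace K _)); apply: deg_le_deriv.
  by rewrite coefB coefZ der // gu mulrA divfK ?subrr.
- apply: deg2.
    apply: (subspaceD (deg_le_subspace K _)) => //.
    by apply: (subspaceZ (deg_le_subspace K _)); apply: deg_le_deriv.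
  by rewrite coefD coefZ der // gv mulrA divfK ?addNr.
- rewrite ep /W -!mul_polyC; ring.
Qed.

(* Up to the factor [d], the trace of [p / W] from the function field of the
   line to that of the pencil: [p] is congruent to [t * W] modulo multiples of
   [a] and [b] whose trace vanishes by Lagrange interpolation. *)
Lemma trace_form k p : deg_le (k * d + (2 * d - 2)) p ->
  exists2 t : T, t \is k.-homog & forall x y rs kp, fibre x y rs kp ->
    \sum_(r <- rs) p.[r] / (W.[r] * kp r ^+ k) = d%:R * t.@[pair2 x y].
Proof.
move=> /pencil_decomp[|t th ->]; first by lia.
have /fin_all_exists[c hc] : forall l : 'I_(2 * d - 2).+1, exists c, exists u v,
    [/\ deg_le (d - 2) u, deg_le (d - 2) v & 'X^l = u * a + v * b + c *: W].
  by move=> l; apply: jacobian_decomp; rewrite /deg_le size_polyXn; have := ltn_ord l; lia.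
exists (\sum_l c l *: t l).
  by apply: (subspace_sum (homog_subspace K 2 k)) => l _; apply: dhomogZ.
move=> x y rs kp [rs_uniq srs sP hrs].
have tE l r : r \in rs -> (ev2 (t l)).[r] = kp r ^+ k * (t l).@[pair2 x y].
  move=> /hrs[ar br _ _]; rewrite horner_ev -(meval_homog _ _ (th l)).
  by apply: meval_eq => i; rewrite /pair2; case: ifP.
have -> : \sum_(r <- rs) (\sum_l ev2 (t l) * 'X^l).[r] / (W.[r] * kp r ^+ k) =
   \sum_(r <- rs) \sum_l (t l).@[pair2 x y] * (r ^+ l / W.[r]).
  apply: eq_big_seq => r hr /=.
  rewrite horner_sum mulr_suml; apply: eq_bigr => l _.
  have [_ _ k0 w0] := hrs r hr.
  rewrite hornerM tE // hornerXn; field.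
  by rewrite w0 expf_neq0.
rewrite exchange_big raddf_sum mulr_sumr; apply: eq_bigr => l _.
rewrite -mulr_sumr /= mevalZ mulrA mulrC; congr (_ * _).
have [u [v [hu hv eX]]] := hc l.
have E r : r \in rs -> r ^+ l / W.[r] =
    c l - (u * x%:P + v * y%:P).[r] / (y *: a - x *: b)^`().[r].
  move=> hr; have [ar br k0 w0] := hrs r hr.
  have P'r := pencil_deriv_root ar br.
  have P'0 : (y *: a - x *: b)^`().[r] != 0.
    by apply: contraNneq w0 => h; rewrite -oppr_eq0 -P'r h mulr0.
  have eW : W.[r] = - (kp r * (y *: a - x *: b)^`().[r]) by rewrite P'r opprK.
  have -> : r ^+ l = u.[r] * (kp r * x) + v.[r] * (kp r * y) + c l * W.[r].
    by rewrite -ar -br -hornerM -hornerM -hornerZ -!hornerD -eX hornerXn.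
  have -> : (u * x%:P + v * y%:P).[r] = u.[r] * x + v.[r] * y by rewrite !hornerE.
  rewrite eW; move: P'0 k0; move: (_^`().[r]) (kp r) => P' k'; move=> P'0 k0; field.
  by rewrite k0 P'0.
rewrite big_seq (eq_bigr _ E) -big_seq sumrB lagrange_sum ?subr0 //.
- by rewrite big_const_seq count_predT srs iter_addr_0 mulr_natl.
- by rewrite sP srs.
- apply/allP => r hr; have [ar br _ _] := hrs r hr.
  by rewrite /root !hornerE ar br; apply/eqP; ring.
- rewrite srs; have h : deg_le (d - 2) (u * x%:P + v * y%:P).
    rewrite ![_ * _%:P]mulrC !mul_polyC; apply: (subspaceD (deg_le_subspace K _)).
      exact: (subspaceZ (deg_le_subspace K _)).
    exact: (subspaceZ (deg_le_subspace K _)).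
  by apply: leq_ltn_trans h _; lia.
Qed.

End Pencil.

(** * Rational curves *)

Definition o0 : 'I_3 := @Ordinal 3 0 isT.
Definition o1 : 'I_3 := @Ordinal 3 1 isT.
Definition o2 : 'I_3 := @Ordinal 3 2 isT.

Lemma ord3P (P : 'I_3 -> Prop) : P o0 -> P o1 -> P o2 -> forall i, P i.
Proof.
move=> h0 h1 h2 [[|[|[|//]]] hi].
- by rewrite (_ : Ordinal hi = o0) //; apply: val_inj.
- by rewrite (_ : Ordinal hi = o1) //; apply: val_inj.
- by rewrite (_ : Ordinal hi = o2) //; apply: val_inj.
Qed.

Lemma big_ord3 (R : Type) (idx : R) (op : Monoid.law idx) (G : 'I_3 -> R) :
  \big[op/idx]_(i < 3) G i = op (G o0) (op (G o1) (G o2)).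
Proof.
rewrite !big_ord_recl big_ord0 Monoid.mulm1.
by congr (op (G _) (op (G _) (G _))); apply: val_inj.
Qed.

Lemma sum3 (V : nmodType) (G : 'I_3 -> V) :
  \sum_i G i = G o0 + (G o1 + G o2).
Proof. exact: big_ord3. Qed.

Definition triple (T : Type) (x y z : T) (i : 'I_3) : T :=
  if val i == 0%N then x else if val i == 1%N then y else z.

Lemma tripleE (T : Type) (x y z : T) :
  ((triple x y z o0 = x) * (triple x y z o1 = y) * (triple x y z o2 = z))%type.
Proof. by []. Qed.

Section PolynomialFacts.
Variable K : numClosedFieldType.

Lemma mderiv_comp n m (t : n.-tuple {mpoly K[m]}) (G : {mpoly K[n]}) j :
  (G \mPo t)^`M(j) = \sum_i (G^`M(i) \mPo t) * (tnth t i)^`M(j).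
Proof.
elim/mpoly_gen_ind: G => [c|i|p q hp hq|p q hp hq].
- rewrite comp_mpolyC mderivC big1 // => i _.
  by rewrite mderivC comp_mpoly0 mul0r.
- rewrite comp_mpolyXU (bigD1 i) //= big1 => [|k ki].
    by rewrite mderivX mnm1E eqxx scale1r -{1}[U_(i)%MM]add0m addmK mpolyX0
      comp_mpoly1 mul1r addr0 -tnth_nth.
  by rewrite mderivX mnm1E eq_sym (negPf ki) scale0r comp_mpoly0 mul0r.
- rewrite comp_mpolyD mderivD hp hq -big_split; apply: eq_bigr => i _ /=.
  by rewrite mderivD comp_mpolyD mulrDl.
- rewrite rmorphM mderivM hp hq mulr_suml mulr_sumr -big_split.
  apply: eq_bigr => i _ /=.
  by rewrite mderivM comp_mpolyD !rmorphM /=; ring.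
Qed.

Lemma ev_comp n m (h : 'I_m -> {poly K}) (t : n.-tuple {mpoly K[m]}) (G : {mpoly K[n]}) :
  ev h (G \mPo t) = ev (fun i => ev h (tnth t i)) G.
Proof.
elim/mpoly_gen_ind: G => [c|i|p q hp hq|p q hp hq].
- by rewrite comp_mpolyC !evC.
- by rewrite comp_mpolyXU evX -tnth_nth.
- by rewrite comp_mpolyD !rmorphD /= hp hq.
- by rewrite rmorphM !rmorphM /= hp hq.
Qed.

Lemma eq_ev n (g h : 'I_n -> {poly K}) G : g =1 h -> ev g G = ev h G.
Proof. by move=> gh; congr (ev _ G); apply/funext. Qed.

Lemma comp_homogM n m b k (t : n.-tuple {mpoly K[m]}) (G : {mpoly K[n]}) :
  (forall i, tnth t i \is b.-homog) -> G \is k.-homog -> G \mPo t \is (k * b).-homog.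
Proof.
move=> ht; elim/homog_ind => [|c e p ek hp]; first by rewrite comp_mpoly0 dhomog0.
rewrite comp_mpolyD comp_mpolyZ comp_mpolyX; apply: dhomogD => //; apply: dhomogZ.
rewrite -ek mdegE big_distrl /=.
elim/big_ind2: _ => [|x x' y y' hx hy|i _]; [exact: dhomog1 | exact: dhomogM |].
by rewrite mulnC; apply: dhomogMn.
Qed.

Lemma comp_homog n m k (t : n.-tuple {mpoly K[m]}) (G : {mpoly K[n]}) :
  (forall i, tnth t i \is 1.-homog) -> G \is k.-homog -> G \mPo t \is k.-homog.
Proof. by move=> ht hG; have := comp_homogM ht hG; rewrite muln1. Qed.

Lemma mp_dvd_homog n d k (F G : {mpoly K[n]}) :
  F \is d.-homog -> G \is k.-homog -> mp_dvd F G ->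
  if (d <= k)%N then exists2 U, U \is (k - d).-homog & G = U * F else G = 0.
Proof.
move=> hF hG [U eG]; have := pihomogM k U hF.
rewrite -eG (pihomog_dE hG); case: ifP => // _ e.
by exists (pihomog mdeg (k - d) U) => //; apply: pihomogP.
Qed.

(* Kronecker's substitution (x, y) = (t, t^(d+1)) separates the monomials of
   degree [d]. *)
Lemma homog_nonzero_affine d (F : {mpoly K[3]}) :
  F \is d.-homog -> F != 0 -> exists x y, F.@[triple x y 1] != 0.
Proof.
move=> hF F0; pose h := triple 'X ('X^(d.+1) : {poly K}) 1.
have h1 (m : 'X_{1..3}) : mmap1 h m = 'X^(m o0 + d.+1 * m o1).
  by rewrite /mmap1 big_ord3 /h /triple /= expr1n mulr1 -exprM -exprD.
have /closed_nonrootP[t ht] : ev h F != 0.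
  have [m hm] : exists m, m \in msupp F.
    by move: F0; rewrite -msupp_eq0; case: (msupp F) => // m s _; exists m; rewrite mem_head.
  apply/eqP => /polyP/(_ (m o0 + d.+1 * m o1)%N)/eqP; apply/negP.
  rewrite coef0 /ev /mmap coef_sum (bigD1_seq m) ?msupp_uniq //= big_seq_cond big1.
    by rewrite h1 addr0 coefCM coefXn eqxx mulr1 -mcoeff_msupp.
  move=> m' /andP[hm' m'm]; rewrite h1 coefCM coefXn.
  case: eqP => [e|_]; last by rewrite mulr0.
  have := dhomogP _ _ _ hF _ hm; have := dhomogP _ _ _ hF _ hm'; rewrite /= !mdegE !sum3 => e1 e2.
  have [h0 h1'] : (m o0 = m' o0 /\ m o1 = m' o1)%N.
    have lt0 : (m o0 < d.+1)%N by lia.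
    have lt0' : (m' o0 < d.+1)%N by lia.
    have h0 : (m o0 = m' o0)%N.
      by rewrite -(modn_small lt0) -(modn_small lt0') -(modnMDl (m o1)) -[in RHS](modnMDl (m' o1))
        addnC mulnC e addnC mulnC.
    by split=> //; move: e; rewrite h0 => /addnI/eqP; rewrite eqn_pmul2l // => /eqP.
  case/negP: m'm; apply/eqP/mnmP; apply: ord3P => //; lia.
exists t, (t ^+ d.+1); move: ht; rewrite /root horner_ev; apply: contra.
move=> /eqP <-; apply/eqP/meval_eq => i; rewrite /h /triple.
by case: ifP => _; [|case: ifP => _]; rewrite ?hornerX ?hornerXn ?hornerC.
Qed.

End PolynomialFacts.

(** What the proof uses of the parametrization, read in the affine parameter. Infinity needs its own
    clause for base points, whereas generic injectivity may discard it. The last field describes the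
    graded kernel of [ev f], which replaces the geometric definition of F. *)
Record rational_curve (K : numClosedFieldType) (d : nat) (f : 'I_3 -> {poly K})
    (F : {mpoly K[3]}) : Prop := RationalCurve {
  rc_d : (3 <= d)%N;
  rc_deg : forall i, deg_le d (f i);
  rc_base : forall a, exists i, (f i).[a] != 0;
  rc_base_inf : exists i, (f i)`_d != 0;
  rc_generic : exists2 Psi : {poly K}, Psi != 0 & forall a b c, Psi.[a] != 0 ->
    (forall i, (f i).[a] = c * (f i).[b]) -> a = b;
  rc_homog : F \is d.-homog;
  rc_eq : forall k G, G \is k.-homog -> (ev f G = 0 <-> mp_dvd F G) }.

Section Curve.
Variables (K : numClosedFieldType) (d : nat) (f : 'I_3 -> {poly K}) (F : {mpoly K[3]}).
Hypothesis rc : rational_curve d f F.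
Local Notation S := {mpoly K[3]}.

Let d3 : (3 <= d)%N := rc_d rc.
Let fd : forall i, deg_le d (f i) := rc_deg rc.
Let hF : F \is d.-homog := rc_homog rc.

Lemma ev_F : ev f F = 0.
Proof. by apply/(rc_eq rc hF); exists 1; rewrite mul1r. Qed.

Lemma ev_eq0_low k G : (k < d)%N -> G \is k.-homog -> ev f G = 0 -> G = 0.
Proof.
move=> kd hG /(rc_eq rc hG)/(mp_dvd_homog hF hG).
by rewrite leqNgt kd.
Qed.

Lemma ev_eq0_high k G : (d <= k)%N -> G \is k.-homog -> ev f G = 0 ->
  exists2 U, U \is (k - d).-homog & G = U * F.
Proof.
move=> kd hG /(rc_eq rc hG)/(mp_dvd_homog hF hG).
by rewrite kd.
Qed.

(** Otherwise forms of degree 2d would restrict injectively to binary forms of degree 2 d^2, but (d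
    + 1)(2d + 1) > 2 d^2 + 1. *)
Lemma F_neq0 : F != 0.
Proof.
apply/eqP => F0.
have inj k G : G \is k.-homog -> ev f G = 0 -> G = 0.
  by move=> hG /(rc_eq rc hG)[U ->]; rewrite F0 mulr0.
pose k := (2 * d)%N; pose A p := exists2 G : S, G \is k.-homog & p = ev f G.
have sA : subspace A.
  split; first by exists 0; rewrite ?rmorph0 // dhomog0.
  move=> c u v [G hG ->] [G' hG' ->]; exists (c *: G + G'); last by rewrite linearP.
  by have [_ h] := homog_subspace K 3 k; apply: h.
have s0 (V : lmodType K) : subspace (fun v : V => v = 0).
  by split=> // c u v -> ->; rewrite scaler0 addr0.
have [m mle [_ hA]] := qdim_split (deg_le_subspace K (k * d)) sA (s0 _)
  (fun p hp => let: ex_intro2 G hG e := hp in eq_rect_r _ (ev_deg_le fd hG) e)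
  (fun p e => eq_rect_r A (subspace0 sA) e) (qdim_deg_le K (k * d)).
have h : qdim A (fun p => p = 0) 'C(k.+2, 2).
  apply: (qdim_map (f := ev f) (homog_subspace K 3 k) (s0 _) _ _ _ (qdim_homog K k)).
  - by move=> G hG; exists G.
  - by move=> p [G hG ->]; exists G => //; rewrite subrr.
  - by move=> G hG; split=> [->|]; [rewrite rmorph0 | apply: inj hG].
move: mle; rewrite -(qdim_uniq (s0 _) h hA) leqNgt; case/negP.
rewrite -(ltn_pmul2l (ltn0Sn 1)) -mul_bin_diag /= bin1; nia.
Qed.

(** The curve lies on no line: a linear form vanishing on it would be a multiple of F, of degree at
    least 3. *)
Lemma lin_indep c : \sum_i c i *: f i = 0 -> forall i, c i = 0.
Proof.
move=> h; have : \sum_i c i *: 'X_i = 0 :> S.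
  apply: (ev_eq0_low (k := 1)); first by lia.
    apply: (subspace_sum (homog_subspace K 3 1)) => i _.
    by apply: dhomogZ; rewrite dhomogX /= mdeg1.
  by rewrite linear_sum -[RHS]h; apply: eq_bigr => i _; rewrite linearZ /= evX.
move=> e i; have := congr1 (fun p : S => p@_U_(i)) e.
rewrite mcoeff0 raddf_sum (bigD1 i) //= big1 => [|j ji].
  by rewrite addr0 mcoeffZ mcoeffXU eqxx mulr1.
by rewrite mcoeffZ mcoeffXU (negPf ji) mulr0.
Qed.

End Curve.

(** * Interpolation along the lines through a point *)

Section DividedDifference.
Variables (K : numClosedFieldType) (F : {mpoly K[3]}) (x y : K).

(** The quotient of F(x, y, z) - F(x, y, u) by z - u, written monomial by monomial: it makes sense
    for z = u, and its expansion in powers of u is what the traces can be substituted into. *)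
Definition divided_diff (z u : K) : K :=
  \sum_(m <- msupp F) F@_m * (x ^+ m o0 * y ^+ m o1 *
     \sum_(l < m o2) u ^+ l * z ^+ ((m o2).-1 - l)).

Lemma meval3 (p : {mpoly K[3]}) z :
  p.@[triple x y z] = \sum_(m <- msupp p) p@_m * (x ^+ m o0 * y ^+ m o1 * z ^+ m o2).
Proof. by rewrite mevalE; apply: eq_bigr => m _; rewrite big_ord3 /= !tripleE !mulrA. Qed.

Lemma divided_diffE z u :
  (z - u) * divided_diff z u = F.@[triple x y z] - F.@[triple x y u].
Proof.
rewrite !meval3 mulr_sumr -sumrB; apply: eq_bigr => m _.
have -> : \sum_(l < m o2) u ^+ l * z ^+ ((m o2).-1 - l) =
          \sum_(l < m o2) z ^+ ((m o2).-1 - l) * u ^+ l.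
  by apply: eq_bigr => l _; rewrite mulrC.
have := subrXX z u (m o2); rewrite (eq_bigr (fun l : 'I_(m o2) => z ^+ ((m o2).-1 - l) * u ^+ l)).
  by move=> e; rewrite -mulrBr -mulrBr e; ring.
by move=> l _; rewrite -subn1 -subnDA add1n.
Qed.

Lemma divided_diff_diag z : divided_diff z z = F^`M(o2).@[triple x y z].
Proof.
have -> : F^`M(o2) = \sum_(m <- msupp F) F@_m *: 'X_[m]^`M(o2).
  by rewrite {1}[F]mpolyE raddf_sum; apply: eq_bigr => m _; rewrite /= mderivZ.
rewrite /divided_diff raddf_sum; apply: eq_bigr => m _ /=.
rewrite mderivX !mevalZ; congr (_ * _).
rewrite mevalX big_ord3 /triple /= !mnmBE !mnm1E /= !subn0 subn1.
rewrite (eq_bigr (fun=> z ^+ (m o2).-1)) => [|l _].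
  by rewrite sumr_const card_ord -mulr_natl; ring.
by rewrite -exprD subnKC // -ltnS prednK // (leq_ltn_trans _ (ltn_ord l)).
Qed.

End DividedDifference.

Section Curve.
Variables (K : numClosedFieldType) (d : nat) (f : 'I_3 -> {poly K}) (F : {mpoly K[3]}).
Hypothesis rc : rational_curve d f F.
Local Notation S := {mpoly K[3]}.

Let d3 : (3 <= d)%N := rc_d rc.
Let fd : forall i, deg_le d (f i) := rc_deg rc.
Let hF : F \is d.-homog := rc_homog rc.

Definition cross (u v : 'I_3 -> {poly K}) : 'I_3 -> {poly K} :=
  triple (u o1 * v o2 - u o2 * v o1) (u o2 * v o0 - u o0 * v o2)
         (u o0 * v o1 - u o1 * v o0).

(** The vector m. Up to the factors -d, d, -d its entries are the 2 x 2 minors of the Jacobian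
    matrix of the homogeneous parametrization, each labelled by the omitted row. *)
Definition jac : 'I_3 -> {poly K} := cross f (fun i => (f i)^`()).
Definition grad i := ev f F^`M(i).

Lemma grad_f : \sum_i grad i * f i = 0.
Proof.
transitivity (ev f (\sum_i 'X_i * F^`M(i))).
  by rewrite rmorph_sum; apply: eq_bigr => i _; rewrite rmorphM /= evX mulrC.
by rewrite (euler hF) linearZ /= (ev_F rc) scaler0.
Qed.

Lemma grad_df : \sum_i grad i * (f i)^`() = 0.
Proof. by rewrite -deriv_ev (ev_F rc) deriv0. Qed.

(** Both vectors are orthogonal to f and to its derivative, hence proportional: each difference is a
    combination of [grad_f] and [grad_df]. *)
Lemma grad_jac i j : grad i * jac j = grad j * jac i.
Proof.
have := grad_f; have := grad_df; rewrite !sum3.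
set s := _ + _; set s' := _ + (_ + _) => h h'.
have vec x y z : x - y = f z * s - (f z)^`() * s' -> x = y.
  by rewrite h h' !mulr0 subrr => /eqP; rewrite subr_eq0 => /eqP.
have h01 : grad o0 * jac o1 = grad o1 * jac o0.
  by apply: (vec _ _ o2); rewrite /s /s' /jac /cross !tripleE; ring.
have h20 : grad o2 * jac o0 = grad o0 * jac o2.
  by apply: (vec _ _ o1); rewrite /s /s' /jac /cross !tripleE; ring.
have h12 : grad o1 * jac o2 = grad o2 * jac o1.
  by apply: (vec _ _ o0); rewrite /s /s' /jac /cross !tripleE; ring.
by move: i j; apply: ord3P; apply: ord3P.
Qed.

Lemma grad_neq0 : exists i, grad i != 0.
Proof.
apply/not_existsP => h; have F_i i : F^`M(i) = 0.
  apply: (ev_eq0_low rc (k := d.-1)); [by lia | exact: mderiv_homog|].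
  by apply/eqP/negPn/negP/h.
have /eqP := euler hF; rewrite big1 => [|i _]; last by rewrite F_i mulr0.
by rewrite eq_sym scaler_eq0 (negPf (F_neq0 rc)) pnatr_eq0 orbF; lia.
Qed.

(** * Projection from a point (al : be : 1) off the curve *)

Section Shear.
Variables al be : K.
Hypothesis F_albe : F.@[triple al be 1] != 0.

Let a : {poly K} := f o0 - al *: f o2.
Let b : {poly K} := f o1 - be *: f o2.

(** A common zero of a and b, finite or at infinity, would be mapped to the centre of projection,
    which is not on the curve. *)
Lemma shear_coprime : coprime_forms d d a b.
Proof.
have [ha hb] : deg_le d a /\ deg_le d b.
  by split; apply: (subspaceB (deg_le_subspace K d)) => //;
    apply: (subspaceZ (deg_le_subspace K d)).
have key (h : 'I_3 -> K) : F.@[h] = 0 -> h o0 = al * h o2 -> h o1 = be * h o2 ->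
    h o2 != 0 -> False.
  move=> Fh e0 e1 h2; case/negP: F_albe.
  have := meval_homog (h o2) (triple al be 1) hF.
  rewrite (meval_eq (v2 := h)) => [|i]; last first.
    by move: i; apply: ord3P; rewrite /triple /= ?mulr1 // mulrC.
  by rewrite Fh => /esym/eqP; rewrite mulf_eq0 expf_eq0 (negPf h2) andbF.
split=> //.
  apply/Pdiv.ClosedField.coprimepP => r; rewrite -/(root b r) => ar; apply/negP => br.
  have e0 : (f o0).[r] = al * (f o2).[r].
    by move/eqP: ar; rewrite !hornerE => /eqP; rewrite subr_eq0 => /eqP.
  have e1 : (f o1).[r] = be * (f o2).[r].
    by move/eqP: br; rewrite !hornerE => /eqP; rewrite subr_eq0 => /eqP.
  apply: (key (fun i => (f i).[r])) => //.
    by rewrite -horner_ev (ev_F rc) horner0.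
  case: (rc_base rc r) => i; apply: contra; move=> /eqP z2.
  by move: i; apply: ord3P; rewrite ?e0 ?e1 z2 ?mulr0.
have big (w : {poly K}) : deg_le d w -> w`_d != 0 -> size w == d.+1.
  move=> hw wd; rewrite eqn_leq hw /= ltnNge; apply: contra wd.
  by move/(nth_default 0) ->.
have [/(big _ ha)->//|/negPn/eqP a0] := boolP (a`_d != 0).
have [/(big _ hb)->|/negPn/eqP b0] := boolP (b`_d != 0); first by rewrite orbT.
case: (key (fun i => (f i)`_d)).
- by rewrite -(ev_top fd hF) (ev_F rc) coef0.
- by apply/eqP; rewrite -subr_eq0 -coefZ -coefB -/a a0.
- by apply/eqP; rewrite -subr_eq0 -coefZ -coefB -/b b0.
case: (rc_base_inf rc) => i; apply: contra; move=> /eqP z2.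
move/eqP: a0; move/eqP: b0; rewrite !coefB !coefZ z2 !mulr0 !subr0 => b0 a0.
by move: i; apply: ord3P => //; apply/eqP.
Qed.

Lemma shear_wronskian : a * b^`() - a^`() * b = al *: jac o0 + be *: jac o1 + jac o2.
Proof.
rewrite /a /b /jac /cross /triple /= !derivB !derivZ -!mul_polyC; ring.
Qed.

Lemma shear_wronskian_neq0 : a * b^`() - a^`() * b != 0.
Proof.
rewrite subr_eq0; apply/eqP => h.
have [a0|a0] := eqVneq a 0.
  have := lin_indep rc (c := triple 1 0 (- al)); rewrite sum3 !tripleE.
  rewrite scale1r scale0r add0r scaleNr => /(_ a0 o0) /eqP.
  by rewrite tripleE oner_eq0.
have [c eb] := wronskian_eq0 a0 h.
have := lin_indep rc (c := triple (- c) 1 (c * al - be)); rewrite sum3 !tripleE.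
move=> L; suff /L/(_ o1)/eqP : - c *: f o0 + (1 *: f o1 + (c * al - be) *: f o2) = 0.
  by rewrite tripleE oner_eq0.
transitivity (b - c *: a); last by rewrite eb subrr.
rewrite /a /b -!mul_polyC !(polyCB, polyCM, polyCN) polyC1; ring.
Qed.

Let W := a * b^`() - a^`() * b.
Let L0 : S := 'X_o0 - al *: 'X_o2.
Let L1 : S := 'X_o1 - be *: 'X_o2.

Lemma ev_shear0 : ev f L0 = a.
Proof. by rewrite rmorphB /= evZ !evX. Qed.

Lemma ev_shear1 : ev f L1 = b.
Proof. by rewrite rmorphB /= evZ !evX. Qed.

Lemma X_homog n (i : 'I_n) : ('X_i : {mpoly K[n]}) \is 1.-homog.
Proof. by rewrite dhomogX /= mdeg1. Qed.

Lemma shear_homog : L0 \is 1.-homog /\ L1 \is 1.-homog.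
Proof.
by split; apply: (subspaceB (homog_subspace K 3 1)); rewrite ?X_homog // dhomogZ ?X_homog.
Qed.

(** In the new coordinates the centre is (0 : 0 : 1), so that along a line through it only the third
    coordinate varies, as in [divided_diff]. *)
Let sh : 3.-tuple S := [tuple 'X_o0 + al *: 'X_o2; 'X_o1 + be *: 'X_o2; 'X_o2].
Let F' := F \mPo sh.
Let f' := triple a b (f o2).

Lemma ev_unshear G : ev f' (G \mPo sh) = ev f G.
Proof.
rewrite ev_comp; apply: eq_ev; apply: ord3P; rewrite (tnth_nth 0) /= ?rmorphD /= ?evZ !evX //.
- by rewrite /f' !tripleE /a subrK.
- by rewrite /f' !tripleE /b subrK.
Qed.

Lemma unshear_homog : F' \is d.-homog.
Proof.
apply: comp_homog hF; apply: ord3P; rewrite (tnth_nth 0) /= ?X_homog //.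
all: by apply: (subspaceD (homog_subspace K 3 1)); rewrite ?X_homog // dhomogZ ?X_homog.
Qed.

Let D := al *: grad o0 + be *: grad o1 + grad o2.

Lemma ev_unshear_deriv : ev f' F'^`M(o2) = D.
Proof.
have dX i : ('X_i : S)^`M(o2) = (i == o2)%:R.
  rewrite mderivX mnm1E; case: eqP => [->|_]; last by rewrite scale0r.
  by rewrite scale1r -{1}[U_(o2)%MM]add0m addmK mpolyX0.
rewrite /F' mderiv_comp sum3 !(tnth_nth 0) /= !mderivD !mderivZ !dX /=.
rewrite !add0r mulr1 !rmorphD !rmorphM /= !evZ !rmorph1 !ev_unshear /D /grad -!mul_polyC; ring.
Qed.

(* [G] is the form interpolating [g * D / W], i.e. [g] times the conductor, on
   the lines through the centre [(al : be : 1)]: by Lagrange interpolation its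
   value at [(x, y, z)] is the trace of [g / W] times the divided difference
   of the equation of the curve along the line. *)
Lemma interpolate k g : (d.-1 <= k)%N -> deg_le (k * d - d.-1 * d.-2) g ->
  exists2 G : S, G \is k.-homog & W * ev f G = D * g.
Proof.
move=> dk hg.
have cab := shear_coprime; have W0 := shear_wronskian_neq0.
have d_gt1 : (1 < d)%N by lia.
have /choice[t ht] : forall l : nat, exists t : {mpoly K[2]},
    t \is (k - d.-1 + l).-homog /\ forall x y rs kp, fibre d a b x y rs kp ->
    \sum_(r <- rs) (g * f o2 ^+ l).[r] / (W.[r] * kp r ^+ (k - d.-1 + l)) =
    t.@[pair2 x y].
  (* Equality of degrees: (k - d + 1) d + 2d - 2 = k d - (d - 1)(d - 2). This is where the degree of
     the conductor comes from. *)
  move=> l; have hgl : deg_le ((k - d.-1 + l) * d + (2 * d - 2)) (g * f o2 ^+ l).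
    apply: deg_leW (deg_le_mul hg (deg_le_exp l (fd o2))).
    rewrite -(subnK dk); move: (k - d.-1)%N => e; case: d d3 => [|[|D']] //= _; nia.
  have [t th tE] := trace_form d_gt1 cab W0 hgl.
  exists (d%:R *: t); split; first exact: dhomogZ.
  by move=> x y rs kp /tE ->; rewrite mevalZ.
pose LL : 2.-tuple S := [tuple L0; L1].
have [hL0 hL1] := shear_homog.
(* The contribution of the monomial m to the divided difference, with the power l of the third
   coordinate of a fibre point replaced by the trace form of g times that power. *)
pose H (m : 'X_{1..3}) : S := L0 ^+ m o0 * L1 ^+ m o1 *
  \sum_(l < m o2) (t l \mPo LL) * 'X_o2 ^+ ((m o2).-1 - l).
exists (\sum_(m <- msupp F') F'@_m *: H m).
  rewrite big_seq; apply: (subspace_sum (homog_subspace K 3 k)) => m hm; apply: dhomogZ.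
  have := dhomogP _ _ _ unshear_homog _ hm; rewrite /= mdegE sum3 => em.
  rewrite /H mulr_sumr; apply: (subspace_sum (homog_subspace K 3 k)) => l _.
  have [htl _] := ht l.
  have -> : k = ((1 * m o0 + 1 * m o1) + ((k - d.-1 + l) + 1 * ((m o2).-1 - l)))%N.
    by have := ltn_ord l; lia.
  apply: dhomogM; first by apply: dhomogM; apply: dhomogMn.
  apply: dhomogM; last by apply: dhomogMn; apply: X_homog.
  apply: comp_homog htl => i; rewrite (tnth_nth 0).
  by case: i => [[|[|//]]] /= _.
have [Psi1 Psi1_neq0 inj] := rc_generic rc.
have [Psi2 Psi2_neq0 gen] := generic_fibre cab W0 Psi1_neq0.
apply/eqP; rewrite -subr_eq0; apply/contraT => ne.
have [q] := closed_nonrootP _ (mulf_neq0 (mulf_neq0 Psi1_neq0 Psi2_neq0) ne).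
rewrite /root !hornerM !mulf_eq0 !negb_or => /andP[/andP[P1q P2q]] /negP[].
have [rs [kp [fib rootE _]]] := gen q P2q; move: (fib) => [rs_uniq _ _ hrs].
set x := a.[q] in fib hrs rootE; set y := b.[q] in fib hrs rootE; pose z := (f o2).[q].
have q_rs : q \in rs by rewrite -rootE /root hornerD hornerN !hornerZ -/x -/y mulrC subrr.
have [kx ky k0 Wq] := hrs q q_rs.
have kp1 : kp q = 1.
  have := pencil_base cab q; rewrite -/x -/y => /orP[x0|y0].
    by apply: (mulIf x0); rewrite -kx mul1r.
  by apply: (mulIf y0); rewrite -ky mul1r.
pose zr r := (f o2).[r] / kp r; pose w r := g.[r] / (W.[r] * kp r ^+ (k - d.-1)).
have tE (l : nat) : (t l).@[pair2 x y] = \sum_(r <- rs) w r * zr r ^+ l.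
  have [_ h] := ht l; rewrite -(h _ _ _ _ fib); apply: eq_big_seq => r hr /=.
  have [_ _ kr0 Wr0] := hrs r hr.
  rewrite /w /zr hornerM horner_exp expr_div_n exprD; field.
  by rewrite Wr0 !expf_neq0.
have GE : (ev f (\sum_(m <- msupp F') F'@_m *: H m)).[q] =
    \sum_(r <- rs) w r * divided_diff F' x y z (zr r).
  rewrite rmorph_sum horner_sum /divided_diff.
  under [RHS]eq_bigr do rewrite mulr_sumr.
  rewrite exchange_big; apply: eq_bigr => m _ /=.
  rewrite evZ hornerZ /H !rmorphM !rmorphXn /= ev_shear0 ev_shear1 !hornerM !horner_exp.
  rewrite -/x -/y rmorph_sum horner_sum.
  have tl (l : 'I_(m o2)) : (ev f ((t l \mPo LL) * 'X_o2 ^+ ((m o2).-1 - l))).[q] =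
      \sum_(r <- rs) w r * zr r ^+ l * z ^+ ((m o2).-1 - l).
    rewrite rmorphM rmorphXn /= evX hornerM horner_exp -/z ev_comp horner_ev.
    rewrite (meval_eq (v2 := pair2 x y)) => [|i]; first by rewrite tE mulr_suml.
    by rewrite (tnth_nth 0) /pair2 -val_eqE; case: i => -[|[|//]] hi /=;
      rewrite ?ev_shear0 ?ev_shear1.
  rewrite (eq_bigr _ (fun l _ => tl l)).
  rewrite exchange_big /= !mulr_sumr; apply: eq_bigr => r _.
  rewrite !mulr_sumr; apply: eq_bigr => l _; ring.
have f'E r : (fun i => (f' i).[r]) =1 triple a.[r] b.[r] (f o2).[r].
  by apply: ord3P.
have zrq : zr q = z by rewrite /zr kp1 divr1.
have F'0 r : r \in rs -> F'.@[triple x y (zr r)] = 0.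
  move=> hr; have [rx ry kr0 _] := hrs r hr.
  apply: (mulfI (expf_neq0 d kr0)); rewrite mulr0 -(meval_homog _ _ unshear_homog).
  rewrite -(horner0 r) -(ev_F rc) -ev_unshear horner_ev; apply: meval_eq => i.
  rewrite f'E; move: i; apply: ord3P; rewrite !tripleE //.
  by rewrite /zr mulrC divfK.
(* Generic injectivity gives the other points of the fibre a third coordinate different from z, and
   F' vanishes at both ends; only the term of q remains in the trace. *)
have rest r : r \in rs -> r != q -> divided_diff F' x y z (zr r) = 0.
  move=> hr rq; have [rx ry kr0 _] := hrs r hr.
  have zrz : z - zr r != 0.
    rewrite subr_eq0; apply: contra rq => /eqP ez; apply/eqP/esym.
    have fz : (f o2).[r] = kp r * z by rewrite ez /zr mulrC divfK.
    have fa : (f o0).[r] = kp r * (f o0).[q].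
      by move: rx; rewrite /x /a !hornerD !hornerN !hornerZ fz -/z => h; rewrite -[LHS](subrK (al * (kp r * z))) h; ring.
    have fb : (f o1).[r] = kp r * (f o1).[q].
      by move: ry; rewrite /y /b !hornerD !hornerN !hornerZ fz -/z => h; rewrite -[LHS](subrK (be * (kp r * z))) h; ring.
    apply: (inj q r (kp r)^-1 P1q); apply: ord3P; rewrite ?fa ?fb ?fz mulKf //.
  by apply: (mulfI zrz); rewrite mulr0 divided_diffE -zrq !F'0 ?subrr.
rewrite hornerD hornerN !hornerM GE (big_rem q) //= big_seq big1 => [|r]; last first.
  by rewrite mem_rem_uniq // inE => /andP[rq hr]; rewrite rest ?mulr0.
have -> : D.[q] = F'^`M(o2).@[triple x y z].
  by rewrite -ev_unshear_deriv horner_ev; apply: meval_eq => i; exact: f'E.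
rewrite addr0 zrq divided_diff_diag /w kp1 expr1n mulr1.
by rewrite mulrA [W.[q] * _]mulrC divfK // mulrC subrr.
Qed.

End Shear.
End Curve.

(** * The conductor and the cokernel on functions *)

Section MulBy.
Variables (K : fieldType) (V : comAlgType K).
Definition mulby (a x : V) := a * x.
Lemma mulby_linear a : linear (mulby a).
Proof. by move=> c x y; rewrite /mulby mulrDr -scalerAr. Qed.
HB.instance Definition _ a := GRing.isLinear.Build K V V *:%R (mulby a) (mulby_linear a).
End MulBy.

Lemma zero_subspace (K : fieldType) (V : lmodType K) : subspace (fun v : V => v = 0).
Proof. by split=> // c u v -> ->; rewrite scaler0 addr0. Qed.

Lemma bin2_double n : ('C(n, 2) * 2 = n * n.-1)%N.
Proof. by elim: n => // -[//|n] IH; rewrite binS bin1 mulnDl IH /=; lia. Qed.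

Section Curve.
Variables (K : numClosedFieldType) (d : nat) (f : 'I_3 -> {poly K}) (F : {mpoly K[3]}).
Hypothesis rc : rational_curve d f F.
Local Notation S := {mpoly K[3]}.
Local Notation grad := (grad f F).
Local Notation jac := (jac f).

Let d3 : (3 <= d)%N := rc_d rc.
Let fd : forall i, deg_le d (f i) := rc_deg rc.
Let hF : F \is d.-homog := rc_homog rc.

(** The polynomial c is the output of [interpolate] for g = 1 in the lowest degree d - 1. Its
    proportionality property holds because W and D are the same combination of the entries of [jac]
    and of [grad], which are proportional. *)
Theorem conductor : exists c : {poly K},
  [/\ c != 0, deg_le (d.-1 * d.-2) c, forall i, grad i = c * jac i
    & forall k g, (d.-1 <= k)%N -> deg_le (k * d - d.-1 * d.-2) g ->
      exists2 G : S, G \is k.-homog & ev f G = c * g].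
Proof.
have [al [be F_albe]] := homog_nonzero_affine hF (F_neq0 rc).
have W0 := shear_wronskian_neq0 rc al be.
have key := interpolate rc F_albe.
move: W0 key; set W := _ - _; set D := _ + _ + _ => W0 key.
have eW : W = al *: jac o0 + be *: jac o1 + jac o2 by apply: shear_wronskian.
have [|G hG] := key d.-1 1 (leqnn _); first by rewrite /deg_le size_poly1; lia.
rewrite mulr1; set c := ev f G => Wc.
have dist (u v w p : {poly K}) :
    (al *: u + be *: v + w) * p = al *: (u * p) + be *: (v * p) + w * p.
  by rewrite !mulrDl -!scalerAl.
have gradE i : grad i = c * jac i.
  apply: (mulfI W0); rewrite mulrA Wc eW /D.
  by rewrite !dist (grad_jac rc o0) (grad_jac rc o1) (grad_jac rc o2) ![jac _ * grad i]mulrC.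
have mulc k g : (d.-1 <= k)%N -> deg_le (k * d - d.-1 * d.-2) g ->
    exists2 G : S, G \is k.-homog & ev f G = c * g.
  move=> hk hg; have [G' hG' e] := key k g hk hg; exists G' => //.
  by apply: (mulfI W0); rewrite e -Wc mulrA.
have c0 : c != 0.
  case: (grad_neq0 rc) => i; apply: contraNneq => c0.
  by rewrite gradE c0 mul0r.
exists c; split=> //.
(* The largest degree allowed for g when k = d - 1: that c X^N has degree at most (d - 1) d bounds
   the degree of c. *)
pose N := (d.-1 * d - d.-1 * d.-2)%N.
have [|G' hG' e] := mulc d.-1 'X^N (leqnn _); first by rewrite /deg_le size_polyXn.
have := ev_deg_le fd hG'; rewrite e /deg_le size_mulXn //.
have : (d.-1 * d.-2 <= d.-1 * d)%N by rewrite leq_mul2l; lia.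
by move: (size c) => s; rewrite /N; lia.
Qed.

(** A general line l: it meets the curve at d distinct finite parameters, avoids the zeros of [Psi],
    and N / M is a coordinate on it that separates the d points. *)
Definition good_line (Psi : {poly K}) (l M N : S) (rs : seq K) : Prop :=
  [/\ [/\ l \is 1.-homog, M \is 1.-homog & N \is 1.-homog],
      [/\ size (ev f l) = d.+1, uniq rs & size rs = d],
      forall r, root (ev f l) r = (r \in rs),
      forall r, r \in rs -> Psi.[r] != 0 /\ (ev f M).[r] != 0
    & {in rs &, injective (fun r => (ev f N).[r] / (ev f M).[r])}].

(** The line joins the centre of projection to the image of a general parameter q, so that its
    intersection with the curve is a fibre of the pencil. *)
Lemma good_line_exists (Psi : {poly K}) : Psi != 0 -> exists l M N rs, good_line Psi l M N rs.
Proof.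
move=> Psi0; have [al [be F_albe]] := homog_nonzero_affine hF (F_neq0 rc).
pose a : {poly K} := f o0 - al *: f o2; pose b : {poly K} := f o1 - be *: f o2.
have W0 : a * b^`() - a^`() * b != 0 := shear_wronskian_neq0 rc al be.
have cab : coprime_forms d d a b := shear_coprime rc F_albe.
have [Psi1 Psi1_neq0 inj] := rc_generic rc.
have [Psi2 Psi2_neq0 gen] := generic_fibre cab W0 (mulf_neq0 Psi1_neq0 Psi0).
have [q] := closed_nonrootP _ Psi2_neq0.
rewrite /root => /gen[rs [kp [[rs_uniq srs sP hrs] rootE rsPsi]]].
have [hL0 hL1] := shear_homog al be.
pose L0 : S := 'X_o0 - al *: 'X_o2; pose L1 : S := 'X_o1 - be *: 'X_o2.
have eL0 : ev f L0 = a by apply: ev_shear0.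
have eL1 : ev f L1 = b by apply: ev_shear1.
set x := a.[q] in hrs sP rootE; set y := b.[q] in hrs sP rootE.
have linM (u v : K) : u *: L0 + v *: L1 \is 1.-homog.
  by apply: dhomogD; apply: dhomogZ.
(* This normalization gives the linear form u L0 + v L1 the value [kp r] at each r, so dividing by
   it normalizes the representatives of the points. *)
have [[u v] huv] : exists uv : K * K, uv.1 * x + uv.2 * y = 1.
  have /orP[x0|y0] := pencil_base cab q.
    by exists (x^-1, 0) => /=; rewrite mulVf // mul0r addr0.
  by exists (0, y^-1) => /=; rewrite mulVf // mul0r add0r.
rewrite /= in huv.
have eM r : r \in rs -> (ev f (u *: L0 + v *: L1)).[r] = kp r.
  move=> /hrs[ar br _ _]; rewrite rmorphD /= !evZ eL0 eL1 hornerD !hornerZ ar br.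
  by rewrite -[RHS]mulr1 -huv; ring.
exists (y *: L0 - x *: L1), (u *: L0 + v *: L1), 'X_o2, rs; split.
- split=> //; last exact: X_homog.
  by rewrite -scaleNr; apply: linM.
- by rewrite rmorphB /= !evZ eL0 eL1.
- by move=> r; rewrite rmorphB /= !evZ eL0 eL1.
- move=> r hr; have [_ _ k0 _] := hrs r hr; split; last by rewrite eM.
  by have := rsPsi r hr; rewrite hornerM mulf_eq0 negb_or => /andP[].
- move=> r r' hr hr'; rewrite !eM // evX => e.
  have [ar br k0 _] := hrs r hr; have [ar' br' k0' _] := hrs r' hr'.
  apply: (inj r r' (kp r / kp r')).
    by have := rsPsi r hr; rewrite hornerM mulf_eq0 negb_or => /andP[].
  have f2 : (f o2).[r] = kp r / kp r' * (f o2).[r'].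
    by rewrite -[LHS](divfK k0) e mulrC mulrA mulrAC.
  have f0 : (f o0).[r] = a.[r] + al * (f o2).[r] by rewrite /a !hornerE subrK.
  have f0' : (f o0).[r'] = a.[r'] + al * (f o2).[r'] by rewrite /a !hornerE subrK.
  have f1 : (f o1).[r] = b.[r] + be * (f o2).[r] by rewrite /b !hornerE subrK.
  have f1' : (f o1).[r'] = b.[r'] + be * (f o2).[r'] by rewrite /b !hornerE subrK.
  by apply: ord3P => //; rewrite ?f0 ?f0' ?f1 ?f1' f2 ?ar ?ar' ?br ?br'; field.
Qed.

(** The degree k part A_k of the coordinate ring, inside the binary forms of degree k d. *)
Definition section k (p : {poly K}) : Prop := exists2 G : S, G \is k.-homog & p = ev f G.

Lemma section_subspace k : subspace (section k).
Proof.
split; first by exists 0; rewrite ?rmorph0 // dhomog0.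
move=> c u v [G hG ->] [G' hG' ->]; exists (c *: G + G'); last by rewrite linearP.
by have [_ h] := homog_subspace K 3 k; apply: h.
Qed.

Lemma section_deg k p : section k p -> deg_le (k * d) p.
Proof. by case=> G hG ->; apply: ev_deg_le. Qed.

Lemma sectionM j k p q : section j p -> section k q -> section (j + k) (p * q).
Proof.
case=> G hG -> [H hH ->]; exists (G * H); last by rewrite rmorphM.
exact: dhomogM.
Qed.

Lemma qdim_section k : qdim (section k) (fun p => p = 0) ('C(k.+2, 2) - 'C(k.+2 - d, 2)).
Proof.
pose Ker (G : S) := G \is k.-homog /\ ev f G = 0.
have sKer : subspace Ker.
  split; first by split; [apply: dhomog0 | apply: rmorph0].
  move=> c u v [hu u0] [hv v0]; split; last by rewrite linearP /= u0 v0 scaler0 addr0.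
  by have [_ h] := homog_subspace K 3 k; apply: h.
have dKer : qdim Ker (fun G => G = 0) 'C(k.+2 - d, 2).
  have [dk|kd] := leqP d k.
    have -> : (k.+2 - d = (k - d).+2)%N by lia.
    apply: (qdim_map (f := mulby F) (homog_subspace K 3 (k - d)) (zero_subspace _) _ _ _ (qdim_homog K _)).
    - move=> U hU; split; last by rewrite /mulby rmorphM /= (ev_F rc) mul0r.
      by rewrite /mulby -(subnKC dk); apply: dhomogM.
    - move=> G [hG /(ev_eq0_high rc dk hG)[U hU ->]]; exists U => //.
      by rewrite /mulby mulrC subrr.
    - move=> U hU; rewrite /= /mulby; split=> [->|]; first by rewrite mulr0.
      by move/eqP; rewrite mulf_eq0 (negPf (F_neq0 rc)) => /eqP.
  have -> : 'C(k.+2 - d, 2) = 0%N by rewrite bin_small //; lia.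
  exists (fun=> 0); split=> [[]//|G [hG /(ev_eq0_low rc kd hG) ->]|c _].
    by exists 0; rewrite lin0 subr0.
  by apply/rowP => -[].
have [m mle [h1 h2]] := qdim_split (homog_subspace K 3 k) sKer (zero_subspace _)
  (fun G (h : Ker G) => h.1) (fun G (e : G = 0) => eq_rect_r Ker (subspace0 sKer) e) (qdim_homog K k).
rewrite -(qdim_uniq (zero_subspace _) h2 dKer).
apply: (qdim_map (f := ev f) (homog_subspace K 3 k) (zero_subspace _) _ _ _ h1).
- by move=> G hG; exists G.
- by move=> p [G hG ->]; exists G => //; rewrite subrr.
- by move=> G hG; split=> [[]|].
Qed.

(** The sections of degree k + 1 vanishing on the line ([B1]) contain the multiples of l by sections
    ([B2]). The latter have codimension min(k + 2, d) by the Hilbert function, the former at least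
    that much, so they agree; and l g is in [B1]. *)
Lemma saturation Psi l M N rs k g : good_line Psi l M N rs ->
  deg_le (k * d) g -> section k.+1 (ev f l * g) -> section k g.
Proof.
case=> -[hl hM hN] [sl rs_uniq srs] rootE rsP injr hg hlg.
have l0 : ev f l != 0 by rewrite -size_poly_gt0 sl.
pose B1 p := section k.+1 p /\ forall r, r \in rs -> p.[r] = 0.
pose B2 p := exists2 q, section k q & p = ev f l * q.
have sA := section_subspace k.+1.
have sB1 : subspace B1.
  split; first by split; [apply: subspace0 | move=> r _; apply: horner0].
  move=> c u v [hu u0] [hv v0]; split; first by have [_ h] := sA; apply: h.
  by move=> r hr; rewrite hornerD hornerZ u0 // v0 // mulr0 addr0.
have sB2 : subspace B2.
  split; first by exists 0; rewrite ?mulr0 //; apply: subspace0; apply: section_subspace.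
  move=> c u v [u' hu ->] [v' hv ->]; exists (c *: u' + v'); last by rewrite mulrDr -scalerAr.
  by have [_ h] := section_subspace k; apply: h.
have sl1 : section 1 (ev f l) by exists l.
have B2A p : B2 p -> section k.+1 p.
  by case=> q hq ->; rewrite -add1n; apply: sectionM.
have B21 p : B2 p -> B1 p.
  move=> hp; split; first exact: B2A.
  by case: hp => q _ -> r hr; rewrite hornerM; move: hr; rewrite -rootE => /eqP ->; rewrite mul0r.
have dB2 : qdim B2 (fun p => p = 0) ('C(k.+2, 2) - 'C(k.+2 - d, 2)).
  apply: (qdim_map (f := mulby (ev f l)) (section_subspace k) (zero_subspace _) _ _ _ (qdim_section k)).
  - by move=> q hq; exists q.
  - by move=> p [q hq ->]; exists q => //; rewrite /mulby subrr.
  - move=> q _; rewrite /= /mulby; split=> [->|]; first by rewrite mulr0.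
    by move/eqP; rewrite mulf_eq0 (negPf l0) => /eqP.
have z2 p : p = 0 -> B2 p by move=> ->; apply: subspace0.
have [m mle [h1 h2]] := qdim_split sA sB2 (zero_subspace _) B2A z2 (qdim_section k.+1).
have em := qdim_uniq (zero_subspace _) h2 dB2.
have [m' m'le [h1' h2']] := qdim_split sA sB1 sB2 (fun p (h : B1 p) => h.1) B21 h1.
(* Independence on the line of monomials in M and N: a relation is a polynomial of degree less than
   d in N / M, which takes d distinct values. *)
have le : (minn k.+2 d <= 'C(k.+3, 2) - 'C(k.+3 - d, 2) - m - m')%N.
  pose u (i : 'I_(minn k.+2 d)) := ev f (N ^+ i * M ^+ (k.+1 - i)).
  apply: (qdim_indep sB1 (u := u)) h1'.
    move=> i; exists (N ^+ i * M ^+ (k.+1 - i)) => //.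
    have e : (1 * i + 1 * (k.+1 - i) = k.+1)%N by have := ltn_ord i; lia.
    have h : N ^+ i * M ^+ (k.+1 - i) \is (1 * i + 1 * (k.+1 - i)).-homog.
      by apply: dhomogM; apply: dhomogMn.
    by rewrite e in h.
  move=> c [_ c0]; pose z r := (ev f N).[r] / (ev f M).[r].
  pose p := \poly_(i < minn k.+2 d) (if insub i is Some j then c 0 j else 0).
  suff p0 : p = 0.
    apply/rowP => i; rewrite mxE; have := congr1 (fun q : {poly K} => q`_i) p0.
    by rewrite coef_poly coef0 ltn_ord valK.
  apply: (roots_geq_poly_eq0 (rs := map z rs)).
  - apply/allP => _ /mapP[r hr ->]; have [_ Mr] := rsP r hr.
    have := c0 r hr; rewrite /lin horner_sum => e.
    rewrite /root horner_poly; apply/eqP/(mulfI (expf_neq0 k.+1 Mr)).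
    rewrite mulr0 -[RHS]e mulr_sumr; apply: eq_bigr => i _.
    rewrite valK hornerZ /u rmorphM !rmorphXn /= hornerM !horner_exp /z expr_div_n.
    have ik : (i <= k.+1)%N by have := ltn_ord i; lia.
    rewrite -{1}(subnK ik) exprD; field.
    by rewrite expf_neq0.
  - by rewrite map_inj_in_uniq.
  - by rewrite size_map srs; apply: leq_trans (size_poly _ _) _; rewrite geq_minr.
have m'0 : m' = 0%N.
  have := bin2_double k.+2; have := bin2_double k.+3.
  have := bin2_double (k.+2 - d); have := bin2_double (k.+3 - d).
  move: le m'le; rewrite em; case: (leqP d k.+2) => dk.
    have -> : (k.+3 - d = (k.+2 - d).+1)%N by lia.
    rewrite /=; move: 'C(_, _) 'C(_, _) 'C(_, _) 'C(_, _) => x1 x2 x3 x4; nia.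
  have -> : (k.+2 - d = 0)%N by lia.
  have -> : (k.+3 - d = 0)%N by lia.
  move: 'C(_, _) 'C(_, _) 'C(_, _) => x1 x2 x3; nia.
rewrite m'0 in h2'.
have [q hq] : B2 (ev f l * g).
  apply: (qdim0_sub sB2 h2'); split=> // r hr.
  by rewrite hornerM; move: hr; rewrite -rootE => /eqP ->; rewrite mul0r.
by move/(mulfI l0) ->.
Qed.

Definition delta := ((d - 1) * (d - 2) %/ 2)%N.

Lemma delta_double : (delta * 2 = d.-1 * d.-2)%N.
Proof.
rewrite /delta subn1 subn2 divnK // dvdn2 oddM; move: d3.
by case: d => [|[|D]] //= _; case: odd.
Qed.

(** From k = d - 2 on the truncated binomial coefficient of [qdim_section] equals its polynomial
    value, and the codimension becomes constant. *)
Lemma qdim_coker0 k : (d <= k.+2)%N -> qdim (deg_le (k * d)) (section k) delta.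
Proof.
move=> dk.
have [m mle [h1 h2]] := qdim_split (deg_le_subspace K (k * d)) (section_subspace k)
  (zero_subspace _) (@section_deg k) (fun p e => eq_rect_r (section k) (subspace0 (section_subspace k)) e)
  (qdim_deg_le K (k * d)).
have em := qdim_uniq (zero_subspace _) h2 (qdim_section k).
suff <- : ((k * d).+1 - m = delta)%N by [].
have := delta_double; have := bin2_double k.+2; have := bin2_double (k.+2 - d).
rewrite em; have [e ek] : exists e, k.+2 = (d + e)%N by exists (k.+2 - d)%N; lia.
have -> : (k.+2 - d = e)%N by lia.
have -> : k = (d + e - 2)%N by lia.
have -> : (d + e - 2).+2 = (d + e)%N by lia.
move: delta 'C(_, _) 'C(_, _) => D x y; case: d d3 => [|[|[|d']]] // _.
have -> : (d'.+3 + e - 2 = d'.+1 + e)%N by lia.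
by case: e {ek} => [|e] /=; nia.
Qed.

(** Multiplication by l is injective by [saturation] between cokernels of the same dimension, hence
    onto. *)
Lemma section_onto Psi l M N rs k p : good_line Psi l M N rs -> (d <= k.+2)%N ->
  deg_le (k.+1 * d) p -> exists2 g, deg_le (k * d) g & section k.+1 (p - ev f l * g).
Proof.
move=> gl dk hp; have [[hl _ _] [sl _ _] _ _ _] := gl.
have sA := section_subspace k.+1.
pose B q := exists2 g, deg_le (k * d) g & section k.+1 (q - ev f l * g).
have sB : subspace B.
  split.
    by exists 0; [exact: subspace0 (deg_le_subspace K _) | rewrite mulr0 subr0; exact: subspace0 sA].
  move=> c u v [g hg hu] [g' hg' hv]; exists (c *: g + g').
    by have [_ h] := deg_le_subspace K (k * d); apply: h.
  have -> : c *: u + v - ev f l * (c *: g + g') =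
            c *: (u - ev f l * g) + (v - ev f l * g') by rewrite -!mul_polyC; ring.
  by have [_ h] := sA; apply: h.
have fl : deg_le d (ev f l) by rewrite /deg_le sl.
have BP q : B q -> deg_le (k.+1 * d) q.
  case=> g hg /section_deg hq; rewrite -[q](subrK (ev f l * g)).
  apply: (subspaceD (deg_le_subspace K _)) hq _.
  by rewrite mulSn; apply: deg_le_mul.
have AB q : section k.+1 q -> B q.
  by move=> hq; exists 0; [exact: subspace0 (deg_le_subspace K _) | rewrite mulr0 subr0].
have dB : qdim B (section k.+1) delta.
  apply: (qdim_map (f := mulby (ev f l)) (deg_le_subspace K (k * d)) sA _ _ _ (qdim_coker0 dk)).
  - move=> g hg; exists g => //; rewrite /= /mulby subrr; exact: subspace0 sA.
  - by move=> w [g hg hw]; exists g.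
  - move=> g hg; rewrite /= /mulby; split=> [hs|]; last exact: saturation gl hg.
    by rewrite -add1n; apply: sectionM => //; exists l.
have dk' : (d <= k.+3)%N by lia.
exact: (qdim_eq (deg_le_subspace K _) sB sA BP AB (qdim_coker0 dk') dB).
Qed.

End Curve.

(** * The cokernel on 2-forms and the Jacobian ideal *)

Lemma interpolation (K : fieldType) (rs : seq K) (g : K -> K) : uniq rs ->
  exists2 p : {poly K}, (size p <= size rs)%N & forall r, r \in rs -> p.[r] = g r.
Proof.
elim: rs => [|r rs IH] /=; first by exists 0; rewrite ?size_poly0.
move=> /andP[r_rs /IH[p sp pg]]; pose P := \prod_(x <- rs) ('X - x%:P).
have Pr : P.[r] != 0 by rewrite -[_ == 0]/(root P r) root_prod_XsubC.
exists (p + ((g r - p.[r]) / P.[r]) *: P).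
  apply: leq_trans (size_polyD _ _) _; rewrite geq_max (leq_trans sp) //=.
  by apply: leq_trans (size_scale_leq _ _) _; rewrite size_prod_XsubC.
move=> x; rewrite inE hornerD hornerZ => /orP[/eqP->|hx].
  by rewrite divfK // addrC subrK.
have /eqP -> : root P x by rewrite root_prod_XsubC.
by rewrite mulr0 addr0 pg.
Qed.

Section Shifted.
Variables (K : numClosedFieldType) (n : nat).

(** The graded piece S(-j)_q. With truncated subtraction alone, constants would slip in when q <
    j. *)
Definition shom j q (G : {mpoly K[n]}) : bool :=
  if (j <= q)%N then G \is (q - j).-homog else G == 0.

Lemma shom_subspace j q : subspace (fun G => shom j q G).
Proof.
rewrite /shom; case: (j <= q)%N; first exact: homog_subspace.
by split=> // c u v /eqP -> /eqP ->; rewrite scaler0 addr0.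
Qed.

Lemma shomM i j q (G H : {mpoly K[n]}) :
  G \is i.-homog -> shom j q H -> shom j (q + i) (G * H).
Proof.
rewrite /shom => hG; case: ifP => jq hH.
  have -> : (j <= q + i)%N by lia.
  have -> : (q + i - j = i + (q - j))%N by lia.
  exact: dhomogM.
rewrite (eqP hH) mulr0; case: ifP => _; [exact: dhomog0 | exact: eqxx].
Qed.

End Shifted.

Section Curve.
Variables (K : numClosedFieldType) (d : nat) (f : 'I_3 -> {poly K}) (F : {mpoly K[3]}).
Hypothesis rc : rational_curve d f F.
Local Notation S := {mpoly K[3]}.
Local Notation grad := (grad f F).
Local Notation jac := (jac f).
Local Notation section := (section f).

Let d3 : (3 <= d)%N := rc_d rc.
Let fd : forall i, deg_le d (f i) := rc_deg rc.
Let hF : F \is d.-homog := rc_homog rc.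

(** The naive bound is 2d - 1; the two contributions to the coefficient in that degree cancel. *)
Lemma jac_deg i : deg_le (2 * d - 2) (jac i).
Proof.
have key (u v : {poly K}) : deg_le d u -> deg_le d v -> deg_le (2 * d - 2) (u * v^`() - v * u^`()).
  move=> hu hv; have hu' := deg_le_deriv hu; have hv' := deg_le_deriv hv.
  have h : deg_le (d + d.-1) (u * v^`() - v * u^`()).
    by apply: (subspaceB (deg_le_subspace K _)); apply: deg_le_mul.
  apply/deg_le_coef => k hk; have [e|ne] := eqVneq k (d + d.-1)%N; last first.
    by move/deg_le_coef: h; apply; lia.
  rewrite e coefB !coefM_top // !coef_deriv prednK; last by lia.
  by rewrite !mulrnAr [v`_d * _]mulrC subrr.
by move: i; apply: ord3P; rewrite /jac /cross !tripleE; apply: key.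
Qed.

Lemma jac_f : \sum_i jac i * f i = 0.
Proof. by rewrite sum3 /jac /cross !tripleE; ring. Qed.

Lemma jac_df : \sum_i jac i * (f i)^`() = 0.
Proof. by rewrite sum3 /jac /cross !tripleE; ring. Qed.

Definition jac_image q (p : {poly K}) : Prop :=
  exists2 a : 'I_3 -> S, (forall i, shom 2 q (a i)) & p = \sum_i ev f (a i) * jac i.

Lemma jac_image_subspace q : subspace (jac_image q).
Proof.
split.
  exists (fun=> 0); first by move=> i; apply: subspace0 (shom_subspace _ _ _ _).
  by rewrite big1 // => i _; rewrite rmorph0 mul0r.
move=> c u v [a ha ->] [a' ha' ->]; exists (fun i => c *: a i + a' i).
  by move=> i; have [_ h] := shom_subspace K 3 2 q; apply: h.
rewrite scaler_sumr -big_split; apply: eq_bigr => i _ /=.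
by rewrite linearP /= mulrDl -scalerAl.
Qed.

Lemma jac_image_deg q p : jac_image q p -> deg_le (q * d - 2) p.
Proof.
case=> a ha ->; apply: (subspace_sum (deg_le_subspace K _)) => i _.
have := ha i; rewrite /shom; case: ifP => q2; last first.
  by move/eqP ->; rewrite rmorph0 mul0r; apply: subspace0 (deg_le_subspace K _).
move/(ev_deg_le fd) => h; apply: deg_leW (deg_le_mul h (jac_deg i)).
by rewrite mulnBl; nia.
Qed.

Lemma jac_image_intro q (b : 'I_3 -> {poly K}) : (2 <= q)%N ->
  (forall i, section (q - 2) (b i)) -> jac_image q (\sum_i b i * jac i).
Proof.
move=> q2 hb; have /fin_all_exists2[a ah ab] : forall i, exists2 G : S,
  G \is (q - 2).-homog & b i = ev f G by [].
exists a; first by move=> i; rewrite /shom q2.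
by apply: eq_bigr => i _; rewrite ab.
Qed.

(** Where the cross product of f and its derivative is nonzero, its orthogonal is spanned by these
    two vectors; Cramer's rule with the nonzero minor gives the coefficients. *)
Lemma jac_span (i : 'I_3) (x : 'I_3 -> K) r : (jac i).[r] != 0 ->
  \sum_j x j * (jac j).[r] = 0 ->
  exists u v, forall j, x j = u * (f j).[r] + v * (f j)^`().[r].
Proof.
rewrite sum3; have jE j : (jac j).[r] =
    triple ((f o1).[r] * (f o2)^`().[r] - (f o2).[r] * (f o1)^`().[r])
           ((f o2).[r] * (f o0)^`().[r] - (f o0).[r] * (f o2)^`().[r])
           ((f o0).[r] * (f o1)^`().[r] - (f o1).[r] * (f o0)^`().[r]) j.
  by move: j; apply: ord3P; rewrite /jac /cross !tripleE hornerD hornerN !hornerM.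
rewrite !jE !tripleE.
have eqsub (p q s : K) : s = 0 -> p - q = s -> p = q.
  by move=> -> /eqP; rewrite subr_eq0 => /eqP.
have red (u v a b m : K) : m != 0 -> (u / m * a + v / m * b) * m = u * a + v * b.
  by move=> m0; field.
set a0 := (f o0).[r]; set a1 := (f o1).[r]; set a2 := (f o2).[r].
set b0 := (f o0)^`().[r]; set b1 := (f o1)^`().[r]; set b2 := (f o2)^`().[r].
move: i; apply: ord3P; rewrite !tripleE => m0 h.
- exists ((x o1 * b2 - x o2 * b1) / (a1 * b2 - a2 * b1)),
    ((a1 * x o2 - a2 * x o1) / (a1 * b2 - a2 * b1)).
  by apply: ord3P; apply: (mulIf m0); rewrite red // -?/a0 -?/a1 -?/a2 -?/b0 -?/b1 -?/b2; [apply: (eqsub _ _ _ h) | |]; ring.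
- exists ((x o2 * b0 - x o0 * b2) / (a2 * b0 - a0 * b2)),
    ((a2 * x o0 - a0 * x o2) / (a2 * b0 - a0 * b2)).
  by apply: ord3P; apply: (mulIf m0); rewrite red // -?/a0 -?/a1 -?/a2 -?/b0 -?/b1 -?/b2; [|apply: (eqsub _ _ _ h)|]; ring.
- exists ((x o0 * b1 - x o1 * b0) / (a0 * b1 - a1 * b0)),
    ((a0 * x o1 - a1 * x o0) / (a0 * b1 - a1 * b0)).
  by apply: ord3P; apply: (mulIf m0); rewrite red // -?/a0 -?/a1 -?/a2 -?/b0 -?/b1 -?/b2; [| |apply: (eqsub _ _ _ h)]; ring.
Qed.

(** * Multiplication by a general line on the cokernel of 2-forms *)

Section Step.
Variable c : {poly K}.
Hypotheses (c0 : c != 0) (cdeg : deg_le (d.-1 * d.-2) c).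
Hypothesis gradE : forall i, grad i = c * jac i.
Hypothesis condc : forall k g, (d.-1 <= k)%N -> deg_le (k * d - d.-1 * d.-2) g ->
  exists2 G : S, G \is k.-homog & ev f G = c * g.

Lemma jac_neq0 : exists i, jac i != 0.
Proof.
case: (grad_neq0 rc) => i hi; exists i; apply: contraNneq hi => h.
by rewrite gradE h mulr0.
Qed.

Variables (j0 : 'I_3) (l M N : S) (rs : seq K).
Hypothesis j0P : jac j0 != 0.
Hypothesis gl : good_line d f (c * jac j0) l M N rs.

Lemma line_factor p n : deg_le (n + d) p -> (forall r, r \in rs -> p.[r] = 0) ->
  exists2 q, deg_le n q & p = ev f l * q.
Proof.
move=> hp p0; have [_ [sl rs_uniq srs] rootE _ _] := gl.
have l0 : ev f l != 0 by rewrite -size_poly_gt0 sl.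
have /dvdpP[q eq] : ev f l %| p.
  apply: (dvdp_trans (y := \prod_(r <- rs) ('X - r%:P))).
    have e : ev f l = lead_coef (ev f l) *: \prod_(r <- rs) ('X - r%:P).
      apply: all_roots_prod_XsubC; rewrite ?sl ?srs //; last by rewrite uniq_rootsE.
      by apply/allP => r; rewrite rootE.
    by rewrite {1}e dvdpZl ?dvdpp // lead_coef_eq0.
  by apply: uniq_roots_dvdp; [apply/allP => r /p0/eqP | rewrite uniq_rootsE].
exists q; last by rewrite mulrC.
have [->|q0] := eqVneq q 0; first by rewrite /deg_le size_poly0.
move: hp; rewrite eq /deg_le size_mul // sl; move: q0; rewrite -size_poly_gt0.
move: (size q) => s; lia.
Qed.

(* Where [ev f l] vanishes, [a] is a combination of the two partial derivatives
   of the parametrization.  Dividing the values of the coefficients by those of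
   [c] one may take them divisible by [c], and then they lie in the coordinate
   ring; the difference is divisible by [l]. *)
Lemma jac_image_saturated q v : (d <= q)%N -> deg_le (q * d - 2) v ->
  jac_image q.+1 (ev f l * v) -> jac_image q v.
Proof.
move=> dq hv [a]; rewrite /shom => ha elv.
have [[hl _ _] [sl rs_uniq srs] rootE rsP _] := gl.
have l0 : ev f l != 0 by rewrite -size_poly_gt0 sl.
have d0 : d%:R != 0 :> K by rewrite pnatr_eq0; lia.
have span r : r \in rs -> exists uv : K * K, forall j, (ev f (a j)).[r] =
    uv.1 * (f j)^`().[r] + uv.2 * (d%:R *: f j - 'X * (f j)^`()).[r].
  move=> hr; have [] := rsP r hr; rewrite hornerM mulf_eq0 negb_or => /andP[cr jr] _.
  case: (@jac_span j0 (fun j => (ev f (a j)).[r]) r jr) => [|u [v' uv]].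
    move: hr; rewrite -rootE => /eqP lr; have := congr1 (fun p : {poly K} => p.[r]) elv.
    rewrite hornerM lr mul0r horner_sum => e; rewrite [RHS]e; apply: eq_bigr => j _.
    by rewrite hornerM.
  (* Rewrites u f + v' f' in the two partial derivatives, by d f = X f' + (d f - X f'). *)
  exists (v' + r * (u / d%:R), u / d%:R) => j /=.
  by rewrite uv hornerD hornerN hornerZ hornerM hornerX; field.
have [uv uvP] : exists uv : K -> K * K, forall r, r \in rs -> forall j, (ev f (a j)).[r] =
    (uv r).1 * (f j)^`().[r] + (uv r).2 * (d%:R *: f j - 'X * (f j)^`()).[r].
  have /choice[uv h] : forall r, exists uv : K * K, r \in rs -> forall j, (ev f (a j)).[r] =
    uv.1 * (f j)^`().[r] + uv.2 * (d%:R *: f j - 'X * (f j)^`()).[r].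
    move=> r; case: (boolP (r \in rs)) => [/span[x hx]|_]; first by exists x.
    by exists (0, 0).
  by exists uv => r; apply: h.
have [al hal alE] := interpolation (fun r => (uv r).1 / c.[r]) rs_uniq.
have [be hbe beE] := interpolation (fun r => (uv r).2 / c.[r]) rs_uniq.
pose s j := al * (f j)^`() + be * (d%:R *: f j - 'X * (f j)^`()).
have sdeg j : deg_le (d.-1 + d.-1) (s j).
  have hd (w : {poly K}) : (size w <= size rs)%N -> deg_le d.-1 w.
    by rewrite srs /deg_le prednK //; lia.
  apply: (subspaceD (deg_le_subspace K _)); apply: deg_le_mul; try exact: hd.
    exact: deg_le_deriv (fd j).
  apply/deg_le_coef => i hi; rewrite coefB coefZ coefXM coef_deriv.
  case: eqVneq => [i0|i0]; first by lia.
  have [->|ne] := eqVneq i d.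
    by rewrite prednK ?mulr_natl ?subrr //; lia.
  have /deg_le_coef fj := fd j; rewrite prednK; last by lia.
  by rewrite fj ?mulr0 ?mul0rn ?subr0 //; lia.
(* The degree 2(d - 1) of [s j] is at most (q - 1) d - (d - 1)(d - 2) exactly when q >= d, whence
   the range of the theorem. *)
have sec j : section q.-1 (c * s j).
  have [||G hG <-] := condc (k := q.-1) (g := s j); first by lia.
    apply: deg_leW (sdeg j); have : (d.-1 * d <= q.-1 * d)%N by rewrite leq_mul2r; lia.
    by case: d d3 => [|[|d']] //= _; nia.
  by exists G.
have sa j : section q.-1 (ev f (a j)).
  exists (a j) => //; have := ha j; rewrite ifT; last by lia.
  by have -> : (q.+1 - 2 = q.-1)%N by lia.
have /fin_all_exists2[b bdeg bE] : forall j, exists2 b : {poly K},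
    deg_le ((q - 2) * d) b & ev f (a j) - c * s j = ev f l * b.
  move=> j; apply: line_factor => [|r hr].
    have -> : ((q - 2) * d + d = q.-1 * d)%N by rewrite -mulSnr; congr (_ * _)%N; lia.
    apply: (subspaceB (deg_le_subspace K _)); apply: (section_deg rc).
      exact: sa.
    exact: sec.
  have [cjr _] := rsP r hr; have cr : c.[r] != 0.
    by move: cjr; rewrite hornerM mulf_eq0 negb_or => /andP[].
  have sr : (s j).[r] = al.[r] * (f j)^`().[r] + be.[r] * (d%:R *: f j - 'X * (f j)^`()).[r].
    by rewrite /s hornerD hornerM (hornerM be).
  by rewrite hornerD hornerN hornerM uvP // sr alE // beE //; field.
have bsec j : section (q - 2) (b j).
  apply: (saturation rc gl (bdeg j)); rewrite -bE.
  have -> : (q - 2).+1 = q.-1 by lia.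
  exact: (subspaceB (section_subspace f _)).
suff -> : v = \sum_j b j * jac j by apply: jac_image_intro => //; lia.
apply: (mulfI l0); rewrite elv mulr_sumr.
have s0 : \sum_j s j * jac j = 0.
  transitivity (al * \sum_j jac j * (f j)^`() + be *
    (d%:R *: \sum_j jac j * f j - 'X * \sum_j jac j * (f j)^`())).
    by rewrite !sum3 /s -!mul_polyC; ring.
  by rewrite jac_f jac_df !mulr0 scaler0 subrr mulr0 addr0.
transitivity (\sum_j ev f l * (b j * jac j) + c * \sum_j s j * jac j); last first.
  by rewrite s0 mulr0 addr0.
rewrite [c * _]mulr_sumr -big_split; apply: eq_bigr => j _ /=.
by rewrite mulrA -bE; ring.
Qed.

(** Injectivity is [jac_image_saturated]. For surjectivity, l is coprime to [jac j0], so Bezout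
    writes a form as u [jac j0] + v l, and [section_onto] trades u for a section plus a multiple of
    l. *)
Lemma coker2_step q n : (d <= q)%N -> qdim (deg_le (q * d - 2)) (jac_image q) n ->
  qdim (deg_le (q.+1 * d - 2)) (jac_image q.+1) n.
Proof.
move=> dq; have [[hl _ _] [sl rs_uniq srs] rootE rsP _] := gl.
have sl1 : section 1 (ev f l) by exists l.
have fl : deg_le d (ev f l) by rewrite /deg_le sl.
have edeg : (d + (q * d - 2) = q.+1 * d - 2)%N by rewrite mulSn addnBA //; nia.
have jw p : section q.-1 p -> jac_image q.+1 (p * jac j0).
  move=> hp; have -> : p * jac j0 = \sum_i (if i == j0 then p else 0) * jac i.
    by rewrite (bigD1 j0) //= eqxx big1 ?addr0 // => i /negPf ->; rewrite mul0r.
  apply: jac_image_intro => [|i]; first by lia.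
  have -> : (q.+1 - 2 = q.-1)%N by lia.
  by case: ifP => // _; apply: subspace0 (section_subspace f _).
apply: (qdim_map (f := mulby (ev f l)) (deg_le_subspace K _) (jac_image_subspace _)).
- by move=> v hv; rewrite /= /mulby -edeg; apply: deg_le_mul.
- move=> w hw; have cj : coprime_forms (2 * d - 2) d (jac j0) (ev f l).
    split; [exact: jac_deg | exact: fl | | by rewrite sl eqxx orbT].
    rewrite coprimep_sym; apply/Pdiv.ClosedField.coprimepP => r; rewrite rootE => hr.
    have [cjr _] := rsP r hr.
    by move: cjr; rewrite hornerM mulf_eq0 negb_or => /andP[].
  have [|u [v [hu hv ew]]] := bezout_forms cj _ hw; first by nia.
  have hu' : deg_le ((q - 2).+1 * d) u.
    apply: deg_leW hu; have -> : (q - 2).+1 = q.-1 by lia.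
    by case: q dq {hw hv jw edeg} => [|q'] /=; rewrite ?mulSn; lia.
  have [|g hg hug] := section_onto rc gl _ hu'; first by lia.
  exists (v + g * jac j0).
    apply: (subspaceD (deg_le_subspace K _)).
      by apply: deg_leW hv; rewrite -edeg; lia.
    apply: deg_leW (deg_le_mul hg (jac_deg j0)).
    rewrite mulnBl; nia.
  rewrite /= /mulby ew.
  have -> : u * jac j0 + v * ev f l - ev f l * (v + g * jac j0) = (u - ev f l * g) * jac j0.
    by ring.
  by apply: jw; move: hug; have -> : (q - 2).+1 = q.-1 by lia.
- move=> v hv; rewrite /= /mulby; split=> [[a ha ->]|]; last exact: jac_image_saturated.
  exists (fun i => l * a i) => [i|]; first by rewrite -[q.+1]addn1; apply: shomM.
  by rewrite mulr_sumr; apply: eq_bigr => i _; rewrite rmorphM mulrA.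
Qed.

End Step.

Theorem coker2 : exists n, forall q, (d <= q)%N -> qdim (deg_le (q * d - 2)) (jac_image q) n.
Proof.
have [c [c0 cdeg gradE condc]] := conductor rc.
have [j0 j0P] := jac_neq0 gradE.
have [l [M [N [rs gl]]]] := good_line_exists rc (mulf_neq0 c0 j0P).
have [m mle [h1 h2]] := qdim_split (deg_le_subspace K (d * d - 2)) (jac_image_subspace d)
  (zero_subspace _) (@jac_image_deg d)
  (fun p e => eq_rect_r (jac_image d) (subspace0 (jac_image_subspace d)) e)
  (qdim_deg_le K (d * d - 2)).
exists ((d * d - 2).+1 - m)%N => q dq; rewrite -(subnK dq).
elim: (q - d)%N => [//|k IH]; rewrite addSn.
by apply: (coker2_step c0 condc j0P gl) => //; lia.
Qed.

(** * The Jacobian ideal and the Tjurina number *)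

Definition jacobian_ideal k G := G \is k.-homog /\ in_jacobian_ideal F G.

Lemma jacobian_ideal_subspace k : subspace (jacobian_ideal k).
Proof.
split.
  split; first exact: dhomog0.
  by exists (fun=> 0); rewrite big1 // => i _; rewrite mul0r.
move=> c u v [hu [a ea]] [hv [b eb]]; split.
  by have [_ h] := homog_subspace K 3 k; apply: h.
exists (fun i => c *: a i + b i); rewrite ea eb scaler_sumr -big_split.
by apply: eq_bigr => i _ /=; rewrite mulrDl scalerAl.
Qed.

Lemma F_in_jacobian U : in_jacobian_ideal F (U * F).
Proof.
exists (fun i => d%:R^-1 *: (U * 'X_i)).
transitivity (d%:R^-1 *: (U * (\sum_i 'X_i * F^`M(i)))).
  rewrite (euler hF) -scalerAr scalerA mulVf ?scale1r // pnatr_eq0; lia.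
rewrite mulr_sumr scaler_sumr; apply: eq_bigr => i _.
by rewrite -scalerAl mulrA.
Qed.

(** The codimension of [cI] in the forms of degree k d is computed twice: through [cA] it is 2 delta
    + n, through A_k it is delta plus the dimension sought. As F lies in its Jacobian ideal by
    Euler's formula, A_k / [cI] is S_k / J_k. *)
Theorem tjurina n q : (d <= q)%N -> qdim (deg_le (q * d - 2)) (jac_image q) n ->
  qdim (fun G : S => G \is (q + d - 3).-homog) (jacobian_ideal (q + d - 3)) (delta d + n).
Proof.
move=> dq hn; set k := (q + d - 3)%N.
have [c [c0 cdeg gradE condc]] := conductor rc.
pose cA p := exists2 v, deg_le (q * d - 2) v & p = c * v.
pose cI p := exists2 v, jac_image q v & p = c * v.
have scA : subspace cA.
  split; first by exists 0; rewrite ?mulr0 //; apply: subspace0 (deg_le_subspace K _).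
  move=> a u v [u' hu ->] [v' hv ->]; exists (a *: u' + v'); last by rewrite mulrDr -scalerAr.
  by have [_ h] := deg_le_subspace K (q * d - 2); apply: h.
have scI : subspace cI.
  split; first by exists 0; rewrite ?mulr0 //; apply: subspace0 (jac_image_subspace _).
  move=> a u v [u' hu ->] [v' hv ->]; exists (a *: u' + v'); last by rewrite mulrDr -scalerAr.
  by have [_ h] := jac_image_subspace q; apply: h.
have cmul0 v : v = 0 <-> c * v = 0.
  by split=> [->|/eqP]; rewrite ?mulr0 // mulf_eq0 (negPf c0) => /eqP.
have cAI : qdim cA cI n.
  apply: (qdim_map (f := mulby c) (deg_le_subspace K _) scI _ _ _ hn).
  - by move=> v hv; exists v.
  - by move=> w [v hv ->]; exists v => //; rewrite /= /mulby subrr; apply: subspace0 scI.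
  - move=> v hv; split=> [h|[w hw /(mulfI c0) ->]] //; by exists v.
(* This identity dictates k = q + d - 3. *)
have dk2 : (d.-1 * d.-2 + (q * d - 2) = k * d)%N.
  rewrite /k; case: d d3 dq => [|[|[|d']]] // _ dq.
  have -> : (q + d'.+3 - 3 = q + d')%N by lia.
  have : (2 <= q * d'.+3)%N by nia.
  by rewrite /=; nia.
have cAdeg p : cA p -> deg_le (k * d) p.
  by case=> v hv ->; rewrite -dk2; apply: deg_le_mul.
have cA0 : qdim cA (fun p => p = 0) (q * d - 2).+1.
  apply: (qdim_map (f := mulby c) (deg_le_subspace K _) (zero_subspace _) _ _ _ (qdim_deg_le K _)).
  - by move=> v hv; exists v.
  - by move=> w [v hv ->]; exists v => //; rewrite /= /mulby subrr.
  - by move=> v hv; apply: cmul0.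
have [m mle [h1 h2]] := qdim_split (deg_le_subspace K (k * d)) scA (zero_subspace _) cAdeg
  (fun p e => eq_rect_r cA (subspace0 scA) e) (qdim_deg_le K (k * d)).
have em := qdim_uniq (zero_subspace _) h2 cA0.
have e2 : ((k * d).+1 - m = delta d * 2)%N by rewrite em (delta_double rc) -dk2; lia.
rewrite e2 in h1.
have cIcA p : cI p -> cA p.
  by case=> v hv ->; exists v => //; apply: jac_image_deg.
have dI := qdim_trans cAdeg scI cIcA scA h1 cAI.
have cIsec p : cI p -> section k p.
  case=> v [a ha ->] ->; exists (\sum_i a i * F^`M(i)).
    apply: (subspace_sum (homog_subspace K 3 k)) => i _.
    have -> : k = ((q - 2) + d.-1)%N by rewrite /k; lia.
    apply: dhomogM; last exact: mderiv_homog.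
    by have := ha i; rewrite /shom ifT //; lia.
  rewrite mulr_sumr rmorph_sum; apply: eq_bigr => i _.
  by rewrite rmorphM /= -/(grad i) gradE mulrCA.
have [m' m'le [h3 h4]] := qdim_split (deg_le_subspace K (k * d)) (section_subspace f k) scI
  (@section_deg _ _ _ _ rc k) cIsec dI.
have dk : (d <= k.+2)%N by rewrite /k; lia.
have em' := qdim_uniq (section_subspace f k) h3 (qdim_coker0 rc dk).
have e : m' = (delta d + n)%N by lia.
rewrite e in h4.
apply: (qdim_comap (f := ev f) (homog_subspace K 3 k) scI _ _ _ h4).
- by move=> G hG; exists G.
- by move=> p [G hG ->]; exists G => //; rewrite subrr; apply: subspace0 scI.
move=> G hG; split.
  move=> [_ [b eG]]; pose a i := pihomog mdeg (q - 2) (b i).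
  have eG' : G = \sum_i a i * F^`M(i).
    rewrite -{1}(pihomog_dE hG) {1}eG raddf_sum; apply: eq_bigr => i _ /=.
    rewrite (pihomogM _ _ (mderiv_homog i hF)) ifT; last by rewrite /k; lia.
    by rewrite /a; congr (pihomog _ _ _ * _); rewrite /k; lia.
  exists (\sum_i ev f (a i) * jac i).
    exists a => // i; rewrite /shom ifT; last by lia.
    exact: pihomogP.
  rewrite {1}eG' rmorph_sum mulr_sumr; apply: eq_bigr => i _.
  by rewrite rmorphM /= -/(grad i) gradE mulrCA.
move=> [v [a ha ->] eG]; split=> //.
have [|||U _ eU] := ev_eq0_high rc (k := k) (G := G - \sum_i a i * F^`M(i)).
- by rewrite /k; lia.
- apply: (subspaceB (homog_subspace K 3 k)) => //.
  have [H hH eH] := cIsec _ (ex_intro2 _ _ _ (ex_intro2 _ _ a ha erefl) erefl).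
  apply: (subspace_sum (homog_subspace K 3 k)) => i _.
  have -> : k = ((q - 2) + d.-1)%N by rewrite /k; lia.
  apply: dhomogM; last exact: mderiv_homog.
  by have := ha i; rewrite /shom ifT //; lia.
- rewrite rmorphB /= eG; apply/eqP; rewrite subr_eq0; apply/eqP.
  rewrite mulr_sumr rmorph_sum; apply: eq_bigr => i _.
  by rewrite rmorphM /= -/(grad i) gradE mulrCA.
have [b eb] := F_in_jacobian U.
exists (fun i => a i + b i); rewrite -[LHS](subrK (\sum_i a i * F^`M(i))) eU eb -big_split.
by apply: eq_bigr => i _ /=; rewrite mulrDl addrC.
Qed.

End Curve.

(** * Free and nearly free curves *)

Section Products.
Variables (K : fieldType) (V W : lmodType K).

Lemma qdim_prod (A B : V -> Prop) (A' B' : W -> Prop) n m :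
  subspace A -> subspace A' -> qdim A B n -> qdim A' B' m ->
  qdim (fun v : V * W => A v.1 /\ A' v.2) (fun v => B v.1 /\ B' v.2) (n + m).
Proof.
move=> sA sA' [e [eA eg ei]] [e' [e'A eg' ei']].
pose u i : V * W := match split i with inl j => (e j, 0) | inr j => (0, e' j) end.
have linu c c' : lin u (row_mx c c') = (lin e c, lin e' c').
  rewrite /lin big_split_ord /=.
  rewrite (eq_bigr (fun i => (c 0 i *: e i, 0 : W))) => [|i _]; last first.
    rewrite row_mxEl /u; case: splitP => j /=; last by have := ltn_ord i; lia.
    by move=> /ord_inj ->; congr (_, _); rewrite /= scaler0.
  rewrite [X in _ + X](eq_bigr (fun i => (0 : V, c' 0 i *: e' i))) => [|i _]; last first.
    rewrite row_mxEr /u; case: splitP => j /=; first by have := ltn_ord j; lia.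
    by move=> /addnI/ord_inj ->; congr (_, _); rewrite /= scaler0.
  apply: injective_projections; rewrite /= !raddf_sum /=.
    by rewrite [X in _ + X]big1 ?addr0.
  by rewrite [X in X + _]big1 ?add0r.
exists u; split.
- by move=> i; rewrite /u; case: split => j /=; split=> //; apply: subspace0.
- move=> [v w] /= [/eg[c hc] /eg'[c' hc']].
  by exists (row_mx c c'); rewrite linu.
- move=> c; rewrite -[c]hsubmxK linu /= => -[/ei -> /ei' ->].
  by rewrite row_mx0.
Qed.

Lemma qdim_prod0 (A : V -> Prop) (A' : W -> Prop) n m : subspace A -> subspace A' ->
  qdim A (fun v => v = 0) n -> qdim A' (fun v => v = 0) m ->
  qdim (fun v : V * W => A v.1 /\ A' v.2) (fun v => v = 0) (n + m).
Proof.
move=> sA sA' h h'; apply: qdim_ext (qdim_prod sA sA' h h') => // -[v w] /=.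
by split=> [[-> ->]|[-> ->]].
Qed.

Lemma subspace_prod (A : V -> Prop) (A' : W -> Prop) : subspace A -> subspace A' ->
  subspace (fun v : V * W => A v.1 /\ A' v.2).
Proof.
move=> [A0 hA] [A'0 hA']; split=> // c [u u'] [v v'] /= [hu hu'] [hv hv'].
by split; [apply: hA | apply: hA'].
Qed.

End Products.

Section GradedParts.
Variables (K : numClosedFieldType) (n : nat).
Implicit Types G H : {mpoly K[n]}.

Definition hpart j q G : {mpoly K[n]} :=
  if (j <= q)%N then pihomog mdeg (q - j) G else 0.

Lemma hpartP j q G : shom j q (hpart j q G).
Proof. by rewrite /shom /hpart; case: (j <= q)%N; [apply: pihomogP | apply: eqxx]. Qed.

Lemma hpart_id j q G : shom j q G -> hpart j q G = G.
Proof.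
rewrite /shom /hpart; case: (j <= q)%N; first exact: pihomog_dE.
by move/eqP.
Qed.

Lemma hpartD j q G H : hpart j q (G + H) = hpart j q G + hpart j q H.
Proof. by rewrite /hpart; case: ifP => _; rewrite ?addr0 // raddfD. Qed.

Lemma hpartM j i q G H : H \is i.-homog -> hpart j q (G * H) = hpart (j + i) q G * H.
Proof.
move=> hH; rewrite /hpart; case: leqP => jq; last by rewrite leqNgt ltn_addr // mul0r.
rewrite (pihomogM _ _ hH).
have -> : (j + i <= q)%N = (i <= q - j)%N by lia.
by case: ifP => _; rewrite ?mul0r // subnDA.
Qed.

Lemma shomMr j i q G H : shom (j + i) q G -> H \is i.-homog -> shom j q (G * H).
Proof.
move=> hG hH; rewrite -[G](hpart_id hG) -hpartM //; exact: hpartP.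
Qed.

Lemma mderiv_shom j q i G : shom j q G -> shom j.+1 q G^`M(i).
Proof.
rewrite /shom; case: (leqP j q) => jq; last first.
  by move/eqP ->; rewrite mderiv0 ifN // -leqNgt ltnW.
case: (ltnP j q) => [jq' /(mderiv_homog i)|qj].
  by have -> : (q - j).-1 = (q - j.+1)%N by lia.
have -> : (q - j = 0)%N by lia.
elim/homog_ind => [|c m p m0 /eqP hp]; first by rewrite mderiv0.
rewrite mderivD mderivZ mderivX hp addr0.
by move/eqP: m0; rewrite mdeg_eq0 => /eqP ->; rewrite mnm0E scale0r scaler0.
Qed.

End GradedParts.

Lemma qdim_shom (K : numClosedFieldType) j q :
  qdim (fun G : {mpoly K[3]} => shom j q G) (fun G => G = 0) 'C(q.+2 - j, 2).
Proof.
have [jq|qj] := leqP j q.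
  have -> : (q.+2 - j = (q - j).+2)%N by lia.
  by apply: qdim_ext (qdim_homog K (q - j)) => // G; rewrite /shom jq.
have -> : 'C(q.+2 - j, 2) = 0%N by rewrite bin_small //; lia.
have h G : shom j q G -> G = 0 by rewrite /shom leqNgt qj /= => /eqP.
exists (fun=> 0); split=> [[]//|G /h ->|c _]; first by exists 0; rewrite lin0 subr0.
by apply/rowP => -[].
Qed.

Notation S3 K := ({mpoly K[3]} * {mpoly K[3]} * {mpoly K[3]})%type.

Section LinearMaps.
Variable K : numClosedFieldType.
Local Notation S := {mpoly K[3]}.

(** Triples are nested pairs so that [qdim_prod0] counts them; [entry] restores the indexing. *)
Definition entry (v : S3 K) : 'I_3 -> S := triple v.1.1 v.1.2 v.2.

Definition jac_map (f : 'I_3 -> {poly K}) (v : S3 K) : {poly K} :=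
  \sum_i ev f (entry v i) * jac f i.

Definition comb2 (r1 r2 : 'I_3 -> S) (p : S * S) : S3 K :=
  (p.1 * r1 o0 + p.2 * r2 o0, p.1 * r1 o1 + p.2 * r2 o1, p.1 * r1 o2 + p.2 * r2 o2).

Definition comb3 (r1 r2 r3 : 'I_3 -> S) (p : S3 K) : S3 K :=
  (p.1.1 * r1 o0 + p.1.2 * r2 o0 + p.2 * r3 o0, p.1.1 * r1 o1 + p.1.2 * r2 o1 + p.2 * r3 o1,
   p.1.1 * r1 o2 + p.1.2 * r2 o2 + p.2 * r3 o2).

Definition scale3 (w : 'I_3 -> S) (g : S) : S3 K := (g * w o0, g * w o1, g * w o2).

Lemma jac_map_linear f : linear (jac_map f).
Proof.
move=> c u v; rewrite /jac_map !sum3 /entry !tripleE !linearP /= -!mul_polyC; ring.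
Qed.
HB.instance Definition _ f := GRing.isLinear.Build K (S3 K) {poly K} *:%R (jac_map f) (jac_map_linear f).

Lemma comb2_linear r1 r2 : linear (comb2 r1 r2).
Proof.
move=> c [u u'] [v v']; rewrite /comb2 /=; congr (_, _, _); rewrite /= -!mul_mpolyC; ring.
Qed.
HB.instance Definition _ r1 r2 :=
  GRing.isLinear.Build K (S * S)%type (S3 K) *:%R (comb2 r1 r2) (comb2_linear r1 r2).

Lemma comb3_linear r1 r2 r3 : linear (comb3 r1 r2 r3).
Proof.
move=> c [[u u'] u''] [[v v'] v'']; rewrite /comb3 /=; congr (_, _, _); rewrite /= -!mul_mpolyC; ring.
Qed.
HB.instance Definition _ r1 r2 r3 :=
  GRing.isLinear.Build K (S3 K) (S3 K) *:%R (comb3 r1 r2 r3) (comb3_linear r1 r2 r3).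

Lemma scale3_linear w : linear (scale3 w).
Proof.
move=> c u v; rewrite /scale3; congr (_, _, _); rewrite /= -!mul_mpolyC; ring.
Qed.
HB.instance Definition _ w :=
  GRing.isLinear.Build K S (S3 K) *:%R (scale3 w) (scale3_linear w).

Lemma entry_comb2 r1 r2 p i : entry (comb2 r1 r2 p) i = p.1 * r1 i + p.2 * r2 i.
Proof. by move: i; apply: ord3P. Qed.
Lemma entry_comb3 r1 r2 r3 p i :
  entry (comb3 r1 r2 r3 p) i = p.1.1 * r1 i + p.1.2 * r2 i + p.2 * r3 i.
Proof. by move: i; apply: ord3P. Qed.
Lemma entry_scale3 w g i : entry (scale3 w g) i = g * w i.
Proof. by move: i; apply: ord3P. Qed.
Lemma entry_inj u v : (forall i, entry u i = entry v i) -> u = v.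
Proof.
case: u v => [[u0 u1] u2] [[v0 v1] v2] h.
by have := h o0; have := h o1; have := h o2; rewrite /entry !tripleE /= => -> -> ->.
Qed.
Lemma entryP c u v i : entry (c *: u + v) i = c *: entry u i + entry v i.
Proof. by move: i; apply: ord3P. Qed.
Lemma entryB u v i : entry (u - v) i = entry u i - entry v i.
Proof. by move: i; apply: ord3P. Qed.
Lemma entry0 i : entry 0 i = 0.
Proof. by move: i; apply: ord3P. Qed.

End LinearMaps.

Section Curve.
Variables (K : numClosedFieldType) (d : nat) (f : 'I_3 -> {poly K}) (F : {mpoly K[3]}).
Hypothesis rc : rational_curve d f F.
Local Notation S := {mpoly K[3]}.
Local Notation grad := (grad f F).
Local Notation jac := (jac f).
Local Notation section := (section f).

Let d3 : (3 <= d)%N := rc_d rc.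
Let fd : forall i, deg_le d (f i) := rc_deg rc.
Let hF : F \is d.-homog := rc_homog rc.

Definition forms3 j q (v : S3 K) := (shom j q v.1.1 /\ shom j q v.1.2) /\ shom j q v.2.

Lemma forms3P j q v : forms3 j q v <-> forall i, shom j q (entry v i).
Proof.
split=> [[[h0 h1] h2]|h]; first by apply: ord3P.
by split; [split|]; [apply: (h o0) | apply: (h o1) | apply: (h o2)].
Qed.

Lemma forms3_subspace j q : subspace (forms3 j q).
Proof.
have sh := shom_subspace K 3 j q.
exact: (subspace_prod (subspace_prod sh sh) sh).
Qed.

Lemma qdim_forms3 j q :
  qdim (forms3 j q) (fun v => v = 0) ('C(q.+2 - j, 2) + 'C(q.+2 - j, 2) + 'C(q.+2 - j, 2)).
Proof.
have sh := shom_subspace K 3 j q; have dh := qdim_shom K j q.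
exact: (qdim_prod0 (subspace_prod sh sh) sh (qdim_prod0 sh sh dh dh) dh).
Qed.

(** Graded by the degree q of the associated 2-form: the coefficients have degree q - 2. *)
Definition syz q (v : S3 K) := forms3 2 q v /\ \sum_i entry v i * F^`M(i) = 0.

Lemma syz_subspace q : subspace (syz q).
Proof.
split.
  split; first exact: subspace0 (forms3_subspace 2 q).
  by rewrite big1 // => i _; rewrite entry0 mul0r.
move=> c u v [hu u0] [hv v0]; split.
  by have [_ h] := forms3_subspace 2 q; apply: h.
transitivity (c *: (\sum_i entry u i * F^`M(i)) + \sum_i entry v i * F^`M(i)).
  rewrite scaler_sumr -big_split; apply: eq_bigr => i _ /=.
  by rewrite entryP mulrDl scalerAl.
by rewrite u0 v0 scaler0 addr0.
Qed.

(** Because F_i(f) = c m_i, a triple a gives a relation between the m_i iff the sum of the a_i F_i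
    is a multiple of F. Modulo syzygies only the multiples of (x, y, z) remain, by Euler's formula,
    which accounts for 'C(q.-1, 2). The additive form of the identity avoids truncated
    subtraction. *)
Lemma coker2_syz q r : (0 < q)%N -> qdim (syz q) (fun v => v = 0) r ->
  exists2 m, qdim (deg_le (q * d - 2)) (jac_image f q) m
    & (m + 'C(q, 2) * 3 = (q * d - 2).+1 + 'C(q.-1, 2) + r)%N.
Proof.
move=> q0 hr; have [c [c0 _ gradE _]] := conductor rc.
have d0 : d%:R != 0 :> K by rewrite pnatr_eq0; lia.
pose Ker v := forms3 2 q v /\ jac_map f v = 0.
have jacE v : ev f (\sum_i entry v i * F^`M(i)) = c * jac_map f v.
  rewrite rmorph_sum mulr_sumr; apply: eq_bigr => i _.
  by rewrite rmorphM /= -/(grad i) gradE mulrCA.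
have sKer : subspace Ker.
  split; first by split; [apply: subspace0 (forms3_subspace 2 q) | apply: linear0].
  move=> a u v [hu u0] [hv v0]; split; last by rewrite linearP /= u0 v0 scaler0 addr0.
  by have [_ h] := forms3_subspace 2 q; apply: h.
have syzKer v : syz q v -> Ker v.
  move=> [hv v0]; split=> //; apply/(mulfI c0).
  by rewrite -jacE v0 rmorph0 mulr0.
have dKs : qdim Ker (syz q) 'C(q.+2 - 3, 2).
  pose X (i : 'I_3) : S := 'X_i; pose sc : {linear S -> S3 K} := scale3 X.
  have scE U i : entry (sc U) i = U * 'X_i by apply: entry_scale3.
  have := qdim_shom K 3 q; move: 'C(_, _) => b hb.
  apply: (qdim_map (f := sc) (shom_subspace K 3 3 q) (syz_subspace q) _ _ _ hb).
  - move=> U hU; split.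
      by apply/forms3P => i; rewrite scE; apply: shomMr (X_homog _ _); rewrite addn1.
    transitivity (ev f U * \sum_i jac i * f i); last by rewrite jac_f mulr0.
    rewrite mulr_sumr; apply: eq_bigr => i _.
    by rewrite scE rmorphM /= evX -mulrA [f i * _]mulrC.
  - move=> v [hv v0]; pose G := \sum_i entry v i * F^`M(i).
    have evG : ev f G = 0 by rewrite jacE v0 mulr0.
    have [U hU eG] : exists2 U, shom 3 q U & G = U * F.
      have [q2|q2] := ltnP q 2.
        exists 0; first exact: subspace0 (shom_subspace K 3 3 q).
        rewrite mul0r /G big1 // => i _; move/forms3P/(_ i): hv.
        by rewrite /shom leqNgt q2 => /eqP ->; rewrite mul0r.
      have hG : G \is (q - 2 + d.-1).-homog.
        apply: (subspace_sum (homog_subspace K 3 _)) => i _; apply: dhomogM.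
          by move/forms3P/(_ i): hv; rewrite /shom q2.
        exact: mderiv_homog.
      have [dk|kd] := leqP d (q - 2 + d.-1).
        have [U hU eG] := ev_eq0_high rc dk hG evG; exists U => //.
        rewrite /shom ifT; last by lia.
        by have -> : (q - 3 = q - 2 + d.-1 - d)%N by lia.
      exists 0; first exact: subspace0 (shom_subspace K 3 3 q).
      by rewrite mul0r; apply: (ev_eq0_low rc kd).
    exists (d%:R^-1 *: U); first exact: (subspaceZ (shom_subspace K 3 3 q)).
    split.
      apply: (subspaceB (forms3_subspace 2 q)) => //.
      apply/forms3P => i; rewrite scE; apply: shomMr (X_homog _ _); rewrite addn1.
      exact: (subspaceZ (shom_subspace K 3 3 q)).
    transitivity (G - d%:R^-1 *: (U * \sum_i 'X_i * F^`M(i))).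
      rewrite mulr_sumr scaler_sumr -sumrB; apply: eq_bigr => i _.
      by rewrite entryB scE mulrBl -!scalerAl mulrA.
    by rewrite (euler hF) eG -scalerAr scalerA mulVf // scale1r subrr.
  - move=> U hU; split=> [->|[_ h]]; first by rewrite linear0; apply: subspace0 (syz_subspace q).
    have : d%:R *: (U * F) = 0.
      rewrite scalerAr -(euler hF) mulr_sumr; rewrite [RHS](esym h); apply: eq_bigr => i _.
      by rewrite scE mulrA.
    by move/eqP; rewrite scaler_eq0 (negPf d0) mulf_eq0 (negPf (F_neq0 rc)) orbF => /eqP.
have z v : v = 0 -> syz q v by move=> ->; apply: subspace0 (syz_subspace q).
have dK := qdim_trans syzKer (zero_subspace _) z (syz_subspace q) dKs hr.
have zK v : v = 0 -> Ker v by move=> ->; apply: subspace0 sKer.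
have [m mle [h1 h2]] := qdim_split (forms3_subspace 2 q) sKer (zero_subspace _)
  (fun v (h : Ker v) => h.1) zK (qdim_forms3 2 q).
have em := qdim_uniq (zero_subspace _) h2 dK.
have dI b : qdim (forms3 2 q) Ker b -> qdim (jac_image f q) (fun p => p = 0) b.
  move=> hb; pose jm : {linear S3 K -> {poly K}} := jac_map f.
  apply: (qdim_map (f := jm) (forms3_subspace 2 q) (zero_subspace _) _ _ _ hb).
  - by move=> v /forms3P hv; exists (entry v).
  - move=> p [a ha ->]; exists (a o0, a o1, a o2); first by split; [split|]; apply: ha.
    by rewrite /jm /= /jac_map !sum3 /entry !tripleE subrr.
  - by move=> v hv; split=> [[]|].
have {}dI := dI _ h1.
have zI p : p = 0 -> jac_image f q p by move=> ->; apply: subspace0 (jac_image_subspace f q).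
have [m' m'le [h3 h4]] := qdim_split (deg_le_subspace K (q * d - 2)) (jac_image_subspace f q)
  (zero_subspace _) (@jac_image_deg _ _ _ _ rc q) zI (qdim_deg_le K _).
exists ((q * d - 2).+1 - m')%N => //.
have := qdim_uniq (zero_subspace _) h4 dI; rewrite !subSS subn0 in em mle m'le *.
rewrite em subn1 in mle *; lia.
Qed.

End Curve.

Lemma bin2S n : 'C(n.+1, 2) = ('C(n, 2) + n)%N.
Proof. by rewrite binS bin1. Qed.

Section Curve.
Variables (K : numClosedFieldType) (d : nat) (f : 'I_3 -> {poly K}) (F : {mpoly K[3]}).
Hypothesis rc : rational_curve d f F.
Local Notation S := {mpoly K[3]}.
Local Notation grad := (grad f F).
Local Notation jac := (jac f).
Local Notation section := (section f).
Local Notation syz := (syz F).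

Let d3 : (3 <= d)%N := rc_d rc.
Let fd : forall i, deg_le d (f i) := rc_deg rc.
Let hF : F \is d.-homog := rc_homog rc.

(** If c is nonzero, a multiple of c is the cross product of two independent vectors p and q, and
    the same multiple of the sum is the Wronskian of p.f and q.f; its vanishing would make the
    entries of f dependent. *)
Lemma jac_indep c : \sum_i c i *: jac i = 0 -> forall i, c i = 0.
Proof.
have key (p q : 'I_3 -> K) : (forall s t, (forall i, s * p i + t * q i = 0) -> s = 0 /\ t = 0) ->
    (\sum_i p i *: f i) * (\sum_i q i *: (f i)^`()) !=
    (\sum_i p i *: (f i)^`()) * (\sum_i q i *: f i).
  move=> ind; apply/eqP => h; set P := \sum_i p i *: f i in h.
  have P' : P^`() = \sum_i p i *: (f i)^`().
    by rewrite raddf_sum; apply: eq_bigr => i _; rewrite /= derivZ.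
  set Q := \sum_i q i *: f i in h.
  have Q' : Q^`() = \sum_i q i *: (f i)^`().
    by rewrite raddf_sum; apply: eq_bigr => i _; rewrite /= derivZ.
  have [P0|P0] := eqVneq P 0.
    have e := lin_indep rc P0; have [|/eqP] := ind 1 0; last by rewrite oner_eq0.
    by move=> i; rewrite e mulr0 mul0r addr0.
  have [|c0 eQ] := wronskian_eq0 P0 (q := Q); first by rewrite Q' P'.
  have e : \sum_i (- c0 * p i + q i) *: f i = 0.
    transitivity (Q - c0 *: P); last by rewrite eQ subrr.
    rewrite /P /Q scaler_sumr -sumrB; apply: eq_bigr => i _.
    by rewrite scalerDl scalerA mulNr scaleNr addrC.
  have {}e := lin_indep rc e.
  by have [|_ /eqP] := ind (- c0) 1; [move=> i; rewrite mul1r | rewrite oner_eq0].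
rewrite sum3 /jac /cross !tripleE => h.
have {}h : (c o0)%:P * (f o1 * (f o2)^`() - f o2 * (f o1)^`()) +
  ((c o1)%:P * (f o2 * (f o0)^`() - f o0 * (f o2)^`()) +
   (c o2)%:P * (f o0 * (f o1)^`() - f o1 * (f o0)^`())) = 0 by rewrite !mul_polyC.
have eqsub (p q s m : {poly K}) : s = 0 -> p - q = m * s -> p = q.
  by move=> ->; rewrite mulr0 => /eqP; rewrite subr_eq0 => /eqP.
have zz (x s : K) : x != 0 -> s * x = 0 -> s = 0.
  by move=> x0 /eqP; rewrite mulf_eq0 (negPf x0) orbF => /eqP.
apply: ord3P; apply/eqP/negPn/negP => c0.
- have := key (triple (- c o1) (c o0) 0) (triple (- c o2) 0 (c o0)).
  rewrite !sum3 !tripleE -!mul_polyC !polyCN !polyC0 => /(_ _)/eqP[].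
    move=> s t e; have := e o1; have := e o2; rewrite !tripleE !mulr0 add0r addr0.
    by move=> /zz-> // /zz ->.
  by apply: (eqsub _ _ _ (c o0)%:P h); ring.
- have := key (triple (c o1) (- c o0) 0) (triple 0 (- c o2) (c o1)).
  rewrite !sum3 !tripleE -!mul_polyC !polyCN !polyC0 => /(_ _)/eqP[].
    move=> s t e; have := e o0; have := e o2; rewrite !tripleE !mulr0 add0r addr0.
    by move=> /zz-> // /zz ->.
  by apply: (eqsub _ _ _ (- (c o1)%:P) h); ring.
- have := key (triple (c o2) 0 (- c o0)) (triple 0 (c o2) (- c o1)).
  rewrite !sum3 !tripleE -!mul_polyC !polyCN !polyC0 => /(_ _)/eqP[].
    move=> s t e; have := e o0; have := e o1; rewrite !tripleE !mulr0 add0r addr0.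
    by move=> /zz-> // /zz ->.
  by apply: (eqsub _ _ _ (c o2)%:P h); ring.
Qed.

Lemma homog0_const (G : S) : G \is 0.-homog -> exists c : K, G = c%:MP.
Proof.
elim/homog_ind => [|c m p m0 [c' ->]]; first by exists 0; rewrite mpolyC0.
exists (c + c'); move/eqP: m0; rewrite mdeg_eq0 => /eqP ->.
by rewrite mpolyX0 mpolyCD -mul_mpolyC mulr1.
Qed.

Lemma AR_degree0 (r : 'rV[S]_3) : homog_AR F 0 r -> r = 0.
Proof.
move=> [ar hr]; have /fin_all_exists[c hc] : forall i, exists c : K, r 0 i = c%:MP.
  by move=> i; apply: homog0_const.
have [e [e0 _ gradE _]] := conductor rc.
have h : \sum_i c i *: jac i = 0.
  apply: (mulfI e0); transitivity (ev f (\sum_i r 0 i * F^`M(i))); last first.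
    by rewrite (_ : \sum_i _ = 0) ?rmorph0 ?mulr0 //; apply: ar.
  rewrite rmorph_sum mulr_sumr; apply: eq_bigr => i _.
  by rewrite rmorphM /= -/(grad i) gradE hc evC mul_polyC -scalerAr.
apply/rowP => i; rewrite hc (jac_indep h) mxE; exact: mpolyC0.
Qed.

Definition row_entry (r : 'rV[S]_3) : 'I_3 -> S := fun i => r 0 i.
Definition to_row (v : S3 K) : 'rV[S]_3 := \row_i entry v i.

Lemma syz_AR q v : syz q v -> AR F (to_row v).
Proof.
by case=> _ h; rewrite /AR -[RHS]h; apply: eq_bigr => i _; rewrite mxE.
Qed.

Lemma free_qdim_syz d1 d2 q : free_curve F d1 d2 ->
  qdim (syz q) (fun v => v = 0) ('C(q - d1, 2) + 'C(q - d2, 2)).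
Proof.
case=> _ [r1 [r2 [[a1 h1] [a2 h2] uniq12]]].
pose cb : {linear (S * S)%type -> S3 K} := comb2 (row_entry r1) (row_entry r2).
have cbE p i : entry (cb p) i = p.1 * r1 0 i + p.2 * r2 0 i by apply: entry_comb2.
have cb_row p : to_row (cb p) = p.1 *: r1 + p.2 *: r2.
  by apply/rowP => i; rewrite !mxE cbE.
have sh j := shom_subspace K 3 j q.
have hC : qdim (fun p : S * S => shom (2 + d1) q p.1 /\ shom (2 + d2) q p.2) (fun p => p = 0)
    ('C(q.+2 - (2 + d1), 2) + 'C(q.+2 - (2 + d2), 2)).
  exact: (qdim_prod0 (sh _) (sh _) (qdim_shom K _ q) (qdim_shom K _ q)).
move: hC; rewrite !subSS; move: ('C(_, _) + _)%N => b hb.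
apply: (qdim_map (f := cb) (subspace_prod (sh _) (sh _)) (zero_subspace _) _ _ _ hb).
- move=> [u v] [hu hv]; split.
    apply/forms3P => i; rewrite cbE /=.
    by apply: (subspaceD (sh 2%N)); [exact: (shomMr (G := u) hu (h1 i)) | exact: (shomMr (G := v) hv (h2 i))].
  transitivity (u * \sum_i r1 0 i * F^`M(i) + v * \sum_i r2 0 i * F^`M(i)).
    rewrite !mulr_sumr -big_split; apply: eq_bigr => i _ /=.
    by rewrite cbE mulrDl !mulrA.
  by rewrite a1 a2 !mulr0 addr0.
- move=> v hv; have [[u w] [/= e _]] := uniq12 _ (syz_AR hv).
  exists (hpart (2 + d1) q u, hpart (2 + d2) q w); first by split; apply: hpartP.
  apply/eqP; rewrite subr_eq0; apply/eqP/entry_inj => i.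
  have [/forms3P hvi _] := hv; rewrite -(hpart_id (hvi i)) cbE /=.
  have -> : entry v i = u * r1 0 i + w * r2 0 i.
    by have := congr1 (fun r : 'rV[S]_3 => r 0 i) e; rewrite !mxE.
  by rewrite hpartD (hpartM _ _ _ (h1 i)) (hpartM _ _ _ (h2 i)).
- move=> p _; split=> [->|h]; first exact: linear0.
  have AR0 : AR F 0 by rewrite /AR big1 // => i _; rewrite mxE mul0r.
  have [p0 [_ uq]] := uniq12 _ AR0.
  have <- : p0 = p.
    by apply: uq; rewrite -cb_row h; apply/rowP => i; rewrite !mxE entry0.
  by apply: uq; rewrite /= !scale0r addr0.
Qed.

(** Count in the resolution 0 -> S(-d2-1) -> S(-d1) + S(-d2)^2 -> AR(F) -> 0, with all degrees
    shifted by 2. *)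
Lemma nearly_free_qdim_syz d1 d2 q : nearly_free_curve F d1 d2 ->
  exists2 r, qdim (syz q) (fun v => v = 0) r
  & (r + 'C(q.-1 - d2, 2) = 'C(q - d1, 2) + 'C(q - d2, 2) * 2)%N.
Proof.
case=> d12 [r1 [r2 [r3 [[a1 h1] [a2 h2] [a3 h3] gen [h [l [l' [hh [hl hl' ind] rel relP]]]]]]]].
pose cb : {linear S3 K -> S3 K} := comb3 (row_entry r1) (row_entry r2) (row_entry r3).
have cbE p i : entry (cb p) i = p.1.1 * r1 0 i + p.1.2 * r2 0 i + p.2 * r3 0 i.
  exact: entry_comb3.
have cb_row p : to_row (cb p) = p.1.1 *: r1 + p.1.2 *: r2 + p.2 *: r3.
  by apply/rowP => i; rewrite !mxE cbE.
have sh j := shom_subspace K 3 j q.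
pose A (p : S3 K) := (shom (2 + d1) q p.1.1 /\ shom (2 + d2) q p.1.2) /\ shom (2 + d2) q p.2.
have sA : subspace A by apply: (subspace_prod (subspace_prod (sh _) (sh _)) (sh _)).
have hA : qdim A (fun p => p = 0)
    ('C(q.+2 - (2 + d1), 2) + 'C(q.+2 - (2 + d2), 2) + 'C(q.+2 - (2 + d2), 2)).
  exact: (qdim_prod0 (subspace_prod (sh _) (sh _)) (sh _) (qdim_prod0 (sh _) (sh _)
    (qdim_shom K _ q) (qdim_shom K _ q)) (qdim_shom K _ q)).
pose Ker p := A p /\ cb p = 0.
have sKer : subspace Ker.
  split; first by split; [apply: subspace0 sA | apply: linear0].
  move=> c u v [hu u0] [hv v0]; split; last by rewrite linearP /= u0 v0 scaler0 addr0.
  by have [_ hs] := sA; apply: hs.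
have l0 : l != 0.
  apply/eqP => e; have [|/eqP] := ind 1 0; last by rewrite oner_eq0.
  by rewrite e scaler0 scale0r addr0.
pose w : 'I_3 -> S := triple h l l'.
pose sc : {linear S -> S3 K} := scale3 w.
have dKer : qdim Ker (fun p => p = 0) 'C(q.+2 - (3 + d2), 2).
  have := qdim_shom K (3 + d2) q; move: 'C(_, _) => b hb.
  apply: (qdim_map (f := sc) (sh _) (zero_subspace _) _ _ _ hb).
  - move=> g hg; split.
      split; [split|]; rewrite /=.
      + by apply: shomMr hh; have -> : (2 + d1 + (d2 + 1 - d1) = 3 + d2)%N by lia.
      + by apply: shomMr hl; have -> : (2 + d2 + 1 = 3 + d2)%N by lia.
      + by apply: shomMr hl'; have -> : (2 + d2 + 1 = 3 + d2)%N by lia.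
    apply: entry_inj => i; rewrite cbE entry0 /=.
    have := congr1 (fun r : 'rV[S]_3 => g * r 0 i) rel; rewrite !mxE mulr0 => <-.
    rewrite /w !tripleE; ring.
  - move=> p [[[p0 p1] p2] e]; have [|g [e0 e1 e2]] := relP p.1.1 p.1.2 p.2.
      by rewrite -cb_row e; apply/rowP => i; rewrite !mxE entry0.
    exists (hpart (3 + d2) q g); first exact: hpartP.
    apply/eqP; rewrite subr_eq0; apply/eqP/entry_inj; apply: ord3P.
    + rewrite /entry /= /w !tripleE -(hpart_id p0) e0 (hpartM _ _ _ hh).
      by have -> : (2 + d1 + (d2 + 1 - d1) = 3 + d2)%N by lia.
    + rewrite /entry /= /w !tripleE -(hpart_id p1) e1 (hpartM _ _ _ hl).
      by have -> : (2 + d2 + 1 = 3 + d2)%N by lia.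
    + rewrite /entry /= /w !tripleE -(hpart_id p2) e2 (hpartM _ _ _ hl').
      by have -> : (2 + d2 + 1 = 3 + d2)%N by lia.
  - move=> g _; split=> [->|e]; first exact: linear0.
    have := congr1 (fun v => entry v o1) e; rewrite /sc /= entry_scale3 entry0 /w tripleE.
    by move/eqP; rewrite mulf_eq0 (negPf l0) orbF => /eqP.
have zK v : v = 0 -> Ker v by move=> ->; apply: subspace0 sKer.
have [m mle [dm hm]] := qdim_split sA sKer (zero_subspace _) (fun v (hv : Ker v) => hv.1) zK hA.
have em := qdim_uniq (zero_subspace _) hm dKer.
exists ('C(q.+2 - (2 + d1), 2) + 'C(q.+2 - (2 + d2), 2) + 'C(q.+2 - (2 + d2), 2) - m)%N; last first.
  have -> : (q.-1 - d2 = q.+2 - (3 + d2))%N by lia.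
  by rewrite -em subnK // !subSS; lia.
move: dm; move: (_ - m)%N => b hb.
apply: (qdim_map (f := cb) sA (zero_subspace _) _ _ _ hb).
- move=> [[u v] t] [[hu hv] ht]; split.
    apply/forms3P => i; rewrite cbE /=; apply: (subspaceD (sh 2%N)); last exact: (shomMr (G := t) ht (h3 i)).
    by apply: (subspaceD (sh 2%N)); [exact: (shomMr (G := u) hu (h1 i)) | exact: (shomMr (G := v) hv (h2 i))].
  transitivity (u * \sum_i r1 0 i * F^`M(i) + v * \sum_i r2 0 i * F^`M(i)
     + t * \sum_i r3 0 i * F^`M(i)).
    rewrite !mulr_sumr -!big_split; apply: eq_bigr => i _ /=.
    by rewrite cbE /= !mulrDl !mulrA.
  by rewrite a1 a2 a3 !mulr0 !addr0.
- move=> v hv; have [a [b' [c e]]] := gen _ (syz_AR hv).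
  exists (hpart (2 + d1) q a, hpart (2 + d2) q b', hpart (2 + d2) q c).
    by split; [split|]; apply: hpartP.
  apply/eqP; rewrite subr_eq0; apply/eqP/entry_inj => i.
  have [/forms3P hvi _] := hv; rewrite -(hpart_id (hvi i)) cbE /=.
  have -> : entry v i = a * r1 0 i + b' * r2 0 i + c * r3 0 i.
    by have := congr1 (fun r : 'rV[S]_3 => r 0 i) e; rewrite !mxE.
  by rewrite !hpartD (hpartM _ _ _ (h1 i)) (hpartM _ _ _ (h2 i)) (hpartM _ _ _ (h3 i)).
- by move=> p hp; split=> [[]|].
Qed.

(** * Exponents and stable range of free and nearly free curves *)

Section Exponents.
Variable n : nat.
Hypothesis hn : forall q, (d <= q)%N -> qdim (deg_le (q * d - 2)) (jac_image f q) n.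

(** A syzygy of degree 0 vanishes, so it is not a basis element. Subtracting the counts of
    [coker2_syz] in two consecutive large degrees, where n is the same, gives 3q = d + (q - 1) + (q
    - d1) + (q - d2). *)
Lemma free_exponents d1 d2 : free_curve F d1 d2 -> (0 < d1)%N /\ (d1 + d2 = d.-1)%N.
Proof.
move=> fr; split.
  case: fr => _ [r1 [r2 [h1 h2 uq]]]; rewrite lt0n; apply/eqP => e; rewrite e in h1.
  have r10 := AR_degree0 h1.
  have AR0 : AR F 0 by rewrite /AR big1 // => i _; rewrite mxE mul0r.
  have [p0 [_ up]] := uq _ AR0.
  have /(congr1 fst)/eqP : p0 = (1, 0) by apply: up; rewrite r10 /= scaler0 scale0r addr0.
  rewrite (up (0, 0)) /=; first by rewrite eq_sym oner_eq0.
  by rewrite !scale0r addr0.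
have rel q : (d <= q)%N -> (n + 'C(q, 2) * 3 = (q * d - 2).+1 + 'C(q.-1, 2) + ('C(q - d1, 2) + 'C(q - d2, 2)))%N.
  move=> dq; have [|m hm <-] := coker2_syz rc (q := q) _ (free_qdim_syz q fr); first by lia.
  by rewrite (qdim_uniq (jac_image_subspace f q) hm (hn dq)).
have := rel (d + d1 + d2)%N; have := rel (d + d1 + d2).+1.
have [q eq] : exists q, (d + d1 + d2 = q.+1)%N by exists (d + d1 + d2).-1; lia.
rewrite eq /=; have -> : (q.+2 - d1 = (q.+1 - d1).+1)%N by lia.
have -> : (q.+2 - d2 = (q.+1 - d2).+1)%N by lia.
rewrite !bin2S (mulSn q.+1) => /(_ _) r2 /(_ _) r1.
have {}r1 := r1 ltac:(lia); have {}r2 := r2 ltac:(lia).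
have : (2 <= q.+1 * d)%N by nia.
move: r1 r2; move: 'C(_, _) 'C(_, _) 'C(_, _) (q.+1 * d)%N => x y z t; lia.
Qed.

(** The value n is known from degree d on; a dimension constant from q0 on agrees with it, by
    climbing from q to q + d. *)
Lemma coker2_stationary q0 q : (q0 <= q)%N ->
  (forall q' m m', (q0 <= q')%N -> qdim (deg_le (q' * d - 2)) (jac_image f q') m ->
     qdim (deg_le (q'.+1 * d - 2)) (jac_image f q'.+1) m' -> m = m') ->
  qdim (deg_le (q * d - 2)) (jac_image f q) n.
Proof.
move=> q0q step.
have ex q' : exists m, qdim (deg_le (q' * d - 2)) (jac_image f q') m.
  have zI p : p = 0 -> jac_image f q' p by move=> ->; apply: subspace0 (jac_image_subspace f q').
  have [m' _ [h _]] := qdim_split (deg_le_subspace K (q' * d - 2)) (jac_image_subspace f q')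
    (zero_subspace _) (@jac_image_deg _ _ _ _ rc q') zI (qdim_deg_le K _).
  by eexists; exact: h.
have [m hm] := ex q; suff /qdim_uniq-/(_ _ (jac_image_subspace f _) (hn (leq_addl q d))) <- :
  qdim (deg_le ((q + d) * d - 2)) (jac_image f (q + d)) m by [].
elim: {1 3}d => [|k IH]; first by rewrite addn0.
have [m' hm'] := ex (q + k).+1; rewrite addnS (step _ _ _ _ IH hm') //.
exact: leq_trans q0q (leq_addr _ _).
Qed.

(** From degree d2 on no difference q - d1 or q - d2 is truncated, so the difference identity behind
    [free_exponents] runs backwards and shows the dimension constant. *)
Theorem free_coker2 d1 d2 q : free_curve F d1 d2 -> (0 < q)%N -> (d2 <= q)%N ->
  qdim (deg_le (q * d - 2)) (jac_image f q) n.
Proof.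
move=> fr q0 d2q; have [d1_gt0 d12] := free_exponents fr.
have dle : (d1 <= d2)%N by case: fr.
have rel q' m : (0 < q')%N -> qdim (deg_le (q' * d - 2)) (jac_image f q') m ->
    (m + 'C(q', 2) * 3 = (q' * d - 2).+1 + 'C(q'.-1, 2) + ('C(q' - d1, 2) + 'C(q' - d2, 2)))%N.
  move=> q'0 hm; have [m' hm' <-] := coker2_syz rc q'0 (free_qdim_syz q' fr).
  by rewrite (qdim_uniq (jac_image_subspace f q') hm hm').
apply: (coker2_stationary d2q) => -[|p] m m' d2p.
  by lia.
move=> /(rel _ _ (ltn0Sn _)) r1 /(rel _ _ (ltn0Sn _)); move: r1.
have -> : (p.+2 - d1 = (p.+1 - d1).+1)%N by lia.
have -> : (p.+2 - d2 = (p.+1 - d2).+1)%N by lia.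
rewrite /= !bin2S (mulSn p.+1); have : (2 <= p.+1 * d)%N by nia.
move: 'C(_, _) 'C(_, _) 'C(_, _) (p.+1 * d)%N => x y z t; lia.
Qed.

Lemma nearly_free_exponents d1 d2 : nearly_free_curve F d1 d2 -> (d1 + d2 = d)%N.
Proof.
move=> nf.
have rel q : (d <= q)%N -> (n + 'C(q, 2) * 3 + 'C(q.-1 - d2, 2) =
    (q * d - 2).+1 + 'C(q.-1, 2) + ('C(q - d1, 2) + 'C(q - d2, 2) * 2))%N.
  move=> dq; have [r hr <-] := nearly_free_qdim_syz q nf.
  have [|m hm em] := coker2_syz rc (q := q) _ hr; first by lia.
  by rewrite addnA -em (qdim_uniq (jac_image_subspace f q) hm (hn dq)).
have := rel (d + d1 + d2)%N; have := rel (d + d1 + d2).+1.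
have [q eq] : exists q, (d + d1 + d2 = q.+1)%N by exists (d + d1 + d2).-1; lia.
rewrite eq /=; have -> : (q.+2 - d1 = (q.+1 - d1).+1)%N by lia.
have -> : (q.+2 - d2 = (q - d2).+2)%N by lia.
have -> : (q.+1 - d2 = (q - d2).+1)%N by lia.
rewrite !bin2S (mulSn q.+1) => /(_ _) r2 /(_ _) r1.
have {}r1 := r1 ltac:(lia); have {}r2 := r2 ltac:(lia).
have : (2 <= q.+1 * d)%N by nia.
move: r1 r2; move: 'C(_, _) 'C(_, _) 'C(_, _) (q.+1 * d)%N => x y z t; lia.
Qed.

(** The relation contributes 'C(q.-1 - d2, 2), whose increments are linear only from q = d2 + 1 on:
    hence a range starting at d2 + 1 = d - d1 + 1. *)
Theorem nearly_free_coker2 d1 d2 q : nearly_free_curve F d1 d2 -> (d2 < q)%N ->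
  qdim (deg_le (q * d - 2)) (jac_image f q) n.
Proof.
move=> nf d2q; have d12 := nearly_free_exponents nf.
have dle : (d1 <= d2)%N by case: nf.
have rel q' m : (0 < q')%N -> qdim (deg_le (q' * d - 2)) (jac_image f q') m ->
    (m + 'C(q', 2) * 3 + 'C(q'.-1 - d2, 2) =
     (q' * d - 2).+1 + 'C(q'.-1, 2) + ('C(q' - d1, 2) + 'C(q' - d2, 2) * 2))%N.
  move=> q'0 hm; have [r hr <-] := nearly_free_qdim_syz q' nf.
  have [m' hm' em] := coker2_syz rc q'0 hr.
  by rewrite addnA -em (qdim_uniq (jac_image_subspace f q') hm hm').
apply: (coker2_stationary d2q) => -[|p] m m' d2p; first by lia.
move=> /(rel _ _ (ltn0Sn _)) r1 /(rel _ _ (ltn0Sn _)); move: r1.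
have -> : (p.+2 - d1 = (p.+1 - d1).+1)%N by lia.
have -> : (p.+2 - d2 = (p - d2).+2)%N by lia.
have -> : (p.+1 - d2 = (p - d2).+1)%N by lia.
rewrite /= !bin2S (mulSn p.+1); have : (2 <= p.+1 * d)%N by nia.
have : (p.+1 - d2 = (p - d2).+1)%N by lia.
move: 'C(_, _) 'C(_, _) 'C(_, _) (p.+1 * d)%N => x y z t; lia.
Qed.

End Exponents.

End Curve.

(** * The cokernel on 1-forms *)

Section EulerContraction.
Variable K : numClosedFieldType.
Local Notation P2 := ({poly K} * {poly K})%type.

(** Contraction of a 1-form with the Euler field, at t = 1. The next map is, up to sign, its
    contraction of the 2-form u ds dt, whose image is the kernel of this one. *)
Definition contraction (v : P2) : {poly K} := 'X * v.1 + v.2.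
Definition cocontraction (u : {poly K}) : P2 := (u, - 'X * u).

Lemma contraction_linear : linear contraction.
Proof. by move=> c [u u'] [v v']; rewrite /contraction /= -!mul_polyC; ring. Qed.
HB.instance Definition _ :=
  GRing.isLinear.Build K P2 {poly K} *:%R contraction contraction_linear.

Lemma cocontraction_linear : linear cocontraction.
Proof. by move=> c u v; rewrite /cocontraction; congr (_, _); rewrite /= -!mul_polyC; ring. Qed.
HB.instance Definition _ :=
  GRing.isLinear.Build K {poly K} P2 *:%R cocontraction cocontraction_linear.
End EulerContraction.

Section Curve.
Variables (K : numClosedFieldType) (d : nat) (f : 'I_3 -> {poly K}) (F : {mpoly K[3]}).
Hypothesis rc : rational_curve d f F.
Local Notation S := {mpoly K[3]}.
Local Notation P2 := ({poly K} * {poly K})%type.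
Local Notation grad := (grad f F).
Local Notation jac := (jac f).
Local Notation section := (section f).

Let d3 : (3 <= d)%N := rc_d rc.
Let fd : forall i, deg_le d (f i) := rc_deg rc.
Let hF : F \is d.-homog := rc_homog rc.
Let d0 : d%:R != 0 :> K. Proof. by rewrite pnatr_eq0; lia. Qed.

Definition one_forms q (v : P2) := deg_le (q * d - 1) v.1 /\ deg_le (q * d - 1) v.2.

Definition pull1 (w : 'I_3 -> S) : P2 :=
  (\sum_i ev f (w i) * (f i)^`(), \sum_i ev f (w i) * (d%:R *: f i - 'X * (f i)^`())).

Definition one_image q (v : P2) : Prop :=
  exists2 w : 'I_3 -> S, (forall i, shom 1 q (w i)) & v = pull1 w.

Lemma deg_le_dt i : deg_le d.-1 (d%:R *: f i - 'X * (f i)^`()).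
Proof.
apply/deg_le_coef => k hk; rewrite coefB coefZ coefXM coef_deriv.
case: eqVneq => [k0|k0]; first by lia.
have [->|ne] := eqVneq k d; first by rewrite prednK ?mulr_natl ?subrr //; lia.
have /deg_le_coef fj := fd i; rewrite prednK; last by lia.
by rewrite fj ?mulr0 ?mul0rn ?subr0 //; lia.
Qed.

Lemma one_forms_subspace q : subspace (one_forms q).
Proof. exact: subspace_prod (deg_le_subspace K _) (deg_le_subspace K _). Qed.

Lemma one_image_subspace q : subspace (one_image q).
Proof.
split.
  exists (fun=> 0); first by move=> i; apply: subspace0 (shom_subspace _ _ _ _).
  by rewrite /pull1 !big1 // => i _; rewrite rmorph0 mul0r.
move=> c u v [a ha ->] [a' ha' ->]; exists (fun i => c *: a i + a' i).
  by move=> i; have [_ h] := shom_subspace K 3 1 q; apply: h.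
rewrite /pull1; apply: injective_projections; rewrite /= scaler_sumr -big_split;
  by apply: eq_bigr => i _ /=; rewrite linearP /= mulrDl -scalerAl.
Qed.

Lemma one_image_forms q v : one_image q v -> one_forms q v.
Proof.
have key (w : 'I_3 -> S) (g : 'I_3 -> {poly K}) : (forall i, shom 1 q (w i)) ->
    (forall i, deg_le d.-1 (g i)) -> deg_le (q * d - 1) (\sum_i ev f (w i) * g i).
  move=> hw hg; apply: (subspace_sum (deg_le_subspace K _)) => i _.
  have := hw i; rewrite /shom; case: ifP => q1; last first.
    by move/eqP ->; rewrite rmorph0 mul0r; apply: subspace0 (deg_le_subspace K _).
  move/(ev_deg_le fd) => h; apply: deg_leW (deg_le_mul h (hg i)).
  by rewrite mulnBl; nia.
case=> w hw ->; split; apply: key => // i; [exact: deg_le_deriv (fd i) | exact: deg_le_dt].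
Qed.

Lemma contraction_pull1 w : contraction (pull1 w) = d%:R *: \sum_i ev f (w i) * f i.
Proof. by rewrite /contraction /pull1 /= !sum3 -!mul_polyC; ring. Qed.

Lemma hom1_euler q (G : S) : (0 < q)%N -> shom 0 q G ->
  exists2 w : 'I_3 -> S, (forall i, shom 1 q (w i)) & \sum_i 'X_i * w i = G.
Proof.
move=> q0 hG; exists (fun i => q%:R^-1 *: G^`M(i)).
  by move=> i; apply: (subspaceZ (shom_subspace K 3 1 q)); apply: mderiv_shom.
move: hG; rewrite /shom subn0 /= => /euler e.
under eq_bigr do rewrite -scalerAr.
by rewrite -scaler_sumr e scalerA mulVf ?scale1r // pnatr_eq0; lia.
Qed.

(* Koszul exactness by Euler's formula: a 1-form of degree [q] annihilated by
   the Euler field is [1 / q] times the contraction of its own differential. *)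
Lemma contraction_free q (w : 'I_3 -> S) : (0 < q)%N -> (forall i, shom 1 q (w i)) ->
  \sum_i 'X_i * w i = 0 -> jac_image f q (\sum_i ev f (w i) * (f i)^`()).
Proof.
move=> q0 hw Xw; pose th i j := (w j)^`M(i) - (w i)^`M(j).
have q0' : q%:R != 0 :> K by rewrite pnatr_eq0; lia.
have wE j : q%:R *: w j = \sum_i 'X_i * th i j.
  have e1 : w j + \sum_i 'X_i * (w i)^`M(j) = 0.
    have := congr1 (mderiv j) Xw; rewrite mderiv0 raddf_sum /= => e; rewrite -[RHS]e.
    under [RHS]eq_bigr do rewrite mderivM.
    rewrite big_split /=; congr (_ + _); rewrite (bigD1 j) //= big1 => [|i ij].
      by rewrite mderivX mnm1E eqxx scale1r -{1}[U_(j)%MM]add0m addmK mpolyX0 mul1r addr0.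
    by rewrite mderivX mnm1E (negPf ij) scale0r mul0r.
  have e2 : \sum_i 'X_i * (w j)^`M(i) = q.-1%:R *: w j.
    have := hw j; rewrite /shom ifT; last by lia.
    by move/euler; rewrite subn1.
  transitivity (q.-1%:R *: w j + (w j + \sum_i 'X_i * (w i)^`M(j)) - \sum_i 'X_i * (w i)^`M(j)).
    by rewrite addrA addrK -[X in _ + X]scale1r -scalerDl natr1 prednK.
  by rewrite e1 addr0 -e2 -sumrB; apply: eq_bigr => i _; rewrite -mulrBr.
pose a := triple (q%:R^-1 *: th o1 o2) (q%:R^-1 *: th o2 o0) (q%:R^-1 *: th o0 o1).
have hth i j : shom 2 q (q%:R^-1 *: th i j).
  apply: (subspaceZ (shom_subspace K 3 2 q)); apply: (subspaceB (shom_subspace K 3 2 q));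
    exact: mderiv_shom.
exists a; first by apply: ord3P; rewrite /a !tripleE.
have wE' j : ev f (w j) = q%:R^-1 *: \sum_i f i * ev f (th i j).
  apply: (scalerI q0'); rewrite scalerA mulfV // scale1r -linearZ /= wE rmorph_sum.
  by apply: eq_bigr => i _; rewrite rmorphM /= evX.
rewrite !sum3 !wE' !sum3 /a /jac /cross !tripleE !linearZ /= /th !rmorphB /= -!mul_polyC.
ring.
Qed.

(** [B] consists of the 1-forms whose contraction lies in A. The quotient by [B] is the cokernel of
    functions, through the contraction. By Euler's formula a form in [B] is a pull-back plus a form
    killed by the contraction, which makes [B] modulo pull-backs the cokernel of 2-forms. *)
Theorem coker1 q m n : (0 < q)%N -> qdim (deg_le (q * d)) (section q) m ->
  qdim (deg_le (q * d - 2)) (jac_image f q) n -> qdim (one_forms q) (one_image q) (m + n).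
Proof.
move=> q0 hm hn; have qd : (3 <= q * d)%N by nia.
have d1 : d.-1.+1 = d by lia.
pose B v := one_forms q v /\ section q (contraction v).
have sB : subspace B.
  split; first by split; [exact: subspace0 (one_forms_subspace q)|
    rewrite linear0; exact: subspace0 (section_subspace f q)].
  move=> c u v [hu su] [hv sv]; split.
    by have [_ h] := one_forms_subspace q; apply: h.
  by rewrite linearP; have [_ h] := section_subspace f q; apply: h.
have imB v : one_image q v -> B v.
  move=> hv; split; first exact: one_image_forms.
  case: hv => w hw ->; rewrite contraction_pull1.
  exists (d%:R *: \sum_i w i * 'X_i).
    apply: dhomogZ; apply: (subspace_sum (homog_subspace K 3 q)) => i _.
    have := hw i; rewrite /shom q0 => h.
    by have := dhomogM h (X_homog K i); rewrite subnK.
  rewrite linearZ /= rmorph_sum; congr (_ *: _); apply: eq_bigr => i _.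
  by rewrite rmorphM /= evX.
apply: (qdim_trans (fun v (h : B v) => h.1) (one_image_subspace q) imB sB).
  pose ct : {linear P2 -> {poly K}} := @contraction K.
  apply: (qdim_comap (f := ct) (one_forms_subspace q) (section_subspace f q) _ _ _ hm).
  - move=> [u v] [hu hv]; rewrite /ct /= /contraction /=.
    apply: (subspaceD (deg_le_subspace K _)); last by apply: deg_leW hv; lia.
    have e : (1 + (q * d - 1) = q * d)%N by lia.
    by rewrite -e; apply: deg_le_mul hu; rewrite /deg_le size_polyX.
  - move=> p hp; exists (\poly_(i < q * d) p`_i.+1, (p`_0)%:P).
      split; rewrite /deg_le /=; last by rewrite (leq_trans (size_polyC_leq1 _)).
      by apply: leq_trans (size_poly _ _) _; lia.
    have -> : ct (\poly_(i < q * d) p`_i.+1, (p`_0)%:P) = p.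
      apply/polyP => i; rewrite /ct /= /contraction /= coefD coefXM coefC coef_poly.
      case: i => [|i] /=; first by rewrite add0r.
      rewrite addr0; case: ltnP => // h; move/deg_le_coef: hp => -> //.
    rewrite subrr; exact: subspace0 (section_subspace f q).
  - by move=> v hv; split=> [[]|].
pose cc : {linear {poly K} -> P2} := @cocontraction K.
apply: (qdim_map (f := cc) (deg_le_subspace K (q * d - 2)) (one_image_subspace q) _ _ _ hn).
- move=> u hu; split; last first.
    by rewrite /cc /= /contraction /= mulNr subrr; exact: subspace0 (section_subspace f q).
  split; rewrite /cc /=; first by apply: deg_leW hu; lia.
  have e : (1 + (q * d - 2) = q * d - 1)%N by lia.
  by rewrite -e; apply: deg_le_mul hu; rewrite /deg_le size_polyN size_polyX.
- move=> v [hv [G hG eG]]; have hG' : shom 0 q G by rewrite /shom subn0.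
  have [w hw ew] := hom1_euler q0 hG'.
  pose w' i := d%:R^-1 *: w i.
  have hw' i : shom 1 q (w' i) by apply: (subspaceZ (shom_subspace K 3 1 q)).
  have im' : one_image q (pull1 w') by exists w'.
  have [hu1 hu2] : one_forms q (v - pull1 w').
    by apply: (subspaceB (one_forms_subspace q)) => //; apply: one_image_forms.
  have e0 : contraction (v - pull1 w') = 0.
    rewrite linearB /= contraction_pull1 eG -ew rmorph_sum scaler_sumr -sumrB big1 // => i _.
    by rewrite rmorphM /= evX /w' evZ -!mul_polyC mulrA mulrA -polyCM mulfV // polyC1 mul1r mulrC subrr.
  exists (v - pull1 w').1.
    apply/deg_le_coef => i hi; have := congr1 (fun p : {poly K} => p`_i.+1) e0.
    rewrite /contraction coefD coefXM coef0 /=.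
    move/deg_le_coef: hu2 => -> //; [by rewrite addr0 | by lia].
  suff -> : v - cc (v - pull1 w').1 = pull1 w' by [].
  rewrite -[LHS](subrK (pull1 w')) -[RHS]add0r; congr (_ + _).
  rewrite addrAC; apply/eqP; rewrite subr_eq0; apply/eqP.
  apply: injective_projections => //=.
  by rewrite mulNr; apply/eqP; rewrite -addr_eq0 addrC; apply/eqP.
move=> u hu; split.
  (* The contraction, up to sign, of the 2-form a with the Euler field of the 3-space. *)
  case=> a ha ->; pose w := triple (a o1 * 'X_o2 - a o2 * 'X_o1)
    (a o2 * 'X_o0 - a o0 * 'X_o2) (a o0 * 'X_o1 - a o1 * 'X_o0).
  exists w.
    have h i j k l : shom 1 q (a i * 'X_j - a k * 'X_l).
      by apply: (subspaceB (shom_subspace K 3 1 q)); apply: shomMr (X_homog _ _); apply: ha.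
    by apply: ord3P; rewrite /w !tripleE.
  rewrite /cc /= /cocontraction /pull1 !sum3 /w !tripleE !rmorphB !rmorphM /= !evX /jac /cross !tripleE.
  by congr (_, _); rewrite -?mul_polyC; ring.
case=> w hw [e1 e2].
have e3 : \sum_i ev f (w i) * f i = 0.
  have := contraction_pull1 w; rewrite /contraction /pull1 /= -e1 -e2 mulNr subrr.
  by move/esym/eqP; rewrite scaler_eq0 (negPf d0) => /eqP.
pose G := \sum_i 'X_i * w i.
have hG : G \is q.-homog.
  apply: (subspace_sum (homog_subspace K 3 q)) => i _.
  have := hw i; rewrite /shom q0 => h.
  by have := dhomogM (X_homog K i) h; rewrite subnKC.
have evG : ev f G = 0.
  rewrite rmorph_sum -[RHS]e3; apply: eq_bigr => i _.
  by rewrite rmorphM /= evX mulrC.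
have [U hU eGU] : exists2 U, shom d q U & G = U * F.
  have [dq|qd'] := leqP d q.
    by have [U hU ->] := ev_eq0_high rc dq hG evG; exists U => //; rewrite /shom dq.
  exists 0; first exact: subspace0 (shom_subspace K 3 d q).
  by rewrite mul0r; apply: (ev_eq0_low rc qd').
(* The 1-form U dF pulls back to 0 and contracts to d U F, so this correction keeps the pull-back of
   w and makes the contraction of w vanish exactly, not only modulo F. *)
pose w' i := w i - d%:R^-1 *: (U * F^`M(i)).
have -> : u = \sum_i ev f (w' i) * (f i)^`().
  rewrite e1; transitivity (\sum_i ev f (w i) * (f i)^`() -
      d%:R^-1 *: (ev f U * \sum_i grad i * (f i)^`())).
    by rewrite (grad_df rc) mulr0 scaler0 subr0.
  rewrite mulr_sumr scaler_sumr -sumrB; apply: eq_bigr => i _.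
  by rewrite /w' rmorphB /= evZ rmorphM mulrBl -scalerAl mulrA.
apply: contraction_free => // [i|].
  apply: (subspaceB (shom_subspace K 3 1 q)) => //.
  apply: (subspaceZ (shom_subspace K 3 1 q)); apply: shomMr (mderiv_homog i hF).
  by rewrite add1n d1.
transitivity (G - d%:R^-1 *: (U * \sum_i 'X_i * F^`M(i))).
  rewrite mulr_sumr scaler_sumr -sumrB; apply: eq_bigr => i _.
  by rewrite /w' mulrBr -scalerAr mulrCA.
by rewrite (euler hF) eGU -scalerAr scalerA mulVf // scale1r subrr.
Qed.

End Curve.

(** * Points of the curve *)

Section Determinants.

Lemma det_homog (K : numClosedFieldType) m n k (A : 'M[{mpoly K[m]}]_n) :
  (forall i j, A i j \is k.-homog) -> \det A \is (n * k).-homog.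
Proof.
move=> hA; rewrite /determinant; apply: (subspace_sum (homog_subspace K m (n * k))) => s _.
have h : \prod_i A i (s i) \is (n * k).-homog.
  rewrite -[n in (n * k)%N]card_ord -sum_nat_const.
  elim/big_ind2: _ => [|x x' y y' hx hy|i _]; [exact: dhomog1 | exact: dhomogM | exact: hA].
case: (perm.odd_perm s); rewrite ?expr1 ?expr0 ?mul1r // mulN1r.
exact: (subspaceN (homog_subspace K m (n * k))).
Qed.

Lemma det_kernel (R : idomainType) n (A : 'M[R]_n) (x : 'I_n -> R) i :
  x i != 0 -> (forall i, \sum_j A i j * x j = 0) -> \det A = 0.
Proof.
move=> xi h; pose c : 'cV_n := \col_j x j.
have Ac : A *m c = 0 by apply/colP => a; rewrite !mxE -[RHS](h a); apply: eq_bigr => j _; rewrite mxE.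
have := congr1 (mulmx (\adj A)) Ac; rewrite mulmx0 mulmxA mul_adj_mx mul_scalar_mx.
by move=> /colP/(_ i)/eqP; rewrite !mxE mulf_eq0 (negPf xi) orbF => /eqP.
Qed.

End Determinants.

Section Points.
Variables (K : numClosedFieldType) (d : nat) (f : 'I_3 -> {poly K}) (F : {mpoly K[3]}).
Hypothesis rc : rational_curve d f F.
Local Notation S := {mpoly K[3]}.

Let d3 : (3 <= d)%N := rc_d rc.
Let fd : forall i, deg_le d (f i) := rc_deg rc.
Let hF : F \is d.-homog := rc_homog rc.

(* The binary forms of degree congruent to [d - 1] modulo [d] are generated, as
   a module over the forms in [L0] and [L1], by the monomials of degree [d - 1];
   [B] is the matrix of the multiplication by [p]. *)
Lemma multiplication_matrix (L0 L1 : S) k (p : {poly K}) : L0 \is 1.-homog -> L1 \is 1.-homog ->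
  coprime_forms d d (ev f L0) (ev f L1) -> deg_le (k * d) p ->
  exists B : 'M[S]_(d.-1.+1), [/\ forall i j, B i j \is k.-homog,
    forall i : 'I_(d.-1.+1), p * 'X^i = \sum_(j < d.-1.+1) ev f (B i j) * 'X^j &
    forall v, (0 < k)%N -> L0.@[v] = 0 -> L1.@[v] = 0 -> forall i j, (B i j).@[v] = 0].
Proof.
move=> h0 h1 cab hp; pose LL : 2.-tuple S := [tuple L0; L1].
have LLE (i : 'I_2) : tnth LL i = pair2 L0 L1 i.
  by rewrite (tnth_nth 0) /pair2 -val_eqE; case: i => -[|[|//]].
have /fin_all_exists2[t th tE] : forall i : 'I_(d.-1.+1), exists2 t : 'I_(d.-1.+1) -> {mpoly K[2]},
    (forall l, t l \is k.-homog) &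
    p * 'X^i = \sum_l ev (pair2 (ev f L0) (ev f L1)) (t l) * 'X^l.
  move=> i; apply: (pencil_decomp _ cab); [by lia | by lia |].
  by apply: deg_le_mul => //; rewrite /deg_le size_polyXn; have := ltn_ord i; lia.
exists (\matrix_(i, j) (t i j \mPo LL)); split=> [i j|i|v k0 v0 v1 i j].
- rewrite mxE; apply: comp_homog (th i j) => a; rewrite LLE /pair2; by case: ifP.
- rewrite tE; apply: eq_bigr => l _; rewrite mxE ev_comp; congr (_ * _).
  by apply: eq_ev => a; rewrite LLE /pair2; case: ifP.
- rewrite mxE comp_mpoly_meval (meval_eq (v2 := fun a => 0 * v ord0)) => [|a]; last first.
    by rewrite LLE /pair2 mul0r; case: ifP.
  by rewrite (meval_homog 0 (fun=> v ord0) (th i j)) expr0n eqn0Ngt k0 mul0r.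
Qed.

Lemma lines_through (P : 'rV[K]_3) : P != 0 -> exists L0 L1 L2 : S,
  [/\ [/\ L0 \is 1.-homog, L1 \is 1.-homog & L2 \is 1.-homog],
      [/\ L0.@[P 0] = 0, L1.@[P 0] = 0 & L2.@[P 0] != 0]
    & forall v, L0.@[v] = 0 -> L1.@[v] = 0 -> exists c, forall i, v i = c * P 0 i].
Proof.
move=> P0; have [a Pa] : exists a, P 0 a != 0.
  by apply/not_existsP => z; case/eqP: P0; apply/rowP => i; rewrite mxE; apply/eqP/negPn/negP/z.
pose L b : S := P 0 a *: 'X_b - P 0 b *: 'X_a.
have hL b : L b \is 1.-homog.
  by apply: (subspaceB (homog_subspace K 3 1)); apply: dhomogZ; apply: X_homog.
have LE b v : (L b).@[v] = P 0 a * v b - P 0 b * v a by rewrite mevalB !mevalZ !mevalXU.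
have LP b : (L b).@[P 0] = 0 by rewrite LE mulrC subrr.
have key v b : (L b).@[v] = 0 -> v b = v a / P 0 a * P 0 b.
  rewrite LE => /eqP; rewrite subr_eq0 => /eqP h; apply: (mulfI Pa); rewrite h; field.
  exact: Pa.
have keya v : v a = v a / P 0 a * P 0 a by rewrite divfK.
have X2 : ('X_a : S).@[P 0] != 0 by rewrite mevalXU.
have := X_homog K a; move: key keya LP hL X2 => key keya LP hL X2 Xa.
have [b [c bc]] : exists b c, forall Q : 'I_3 -> Prop, Q a -> Q b -> Q c -> forall i, Q i.
  move: a {Pa L hL LE LP key keya X2 Xa}; apply: ord3P.
  - by exists o1, o2 => Q; apply: ord3P.
  - by exists o0, o2 => Q h1 h0 h2; apply: ord3P.
  - by exists o0, o1 => Q h2 h0 h1; apply: ord3P.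
exists (L b), (L c), 'X_a; split=> // v v0 v1.
by exists (v a / P 0 a); apply: bc; [exact: keya | exact: key | exact: key].
Qed.

Lemma lines_coprime (L0 L1 : S) : L0 \is 1.-homog -> L1 \is 1.-homog ->
  (forall a, (ev f L0).[a] = 0 -> (ev f L1).[a] = 0 -> False) ->
  (L0.@[fun i => (f i)`_d] = 0 -> L1.@[fun i => (f i)`_d] = 0 -> False) ->
  coprime_forms d d (ev f L0) (ev f L1).
Proof.
move=> h0 h1 nofin noinf.
have ha : deg_le d (ev f L0) by have := ev_deg_le fd h0; rewrite mul1n.
have hb : deg_le d (ev f L1) by have := ev_deg_le fd h1; rewrite mul1n.
split=> //.
  by apply/Pdiv.ClosedField.coprimepP => r /eqP e0; apply/eqP => e1; apply: (nofin r).
have big (w : {poly K}) : deg_le d w -> w`_d != 0 -> size w == d.+1.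
  move=> hw wd; rewrite eqn_leq hw /= ltnNge; apply: contra wd.
  by move/(nth_default 0) ->.
have [/(big _ ha)->//|/negPn/eqP a0] := boolP ((ev f L0)`_d != 0).
have [/(big _ hb)->|/negPn/eqP b0] := boolP ((ev f L1)`_d != 0); first by rewrite orbT.
by case: noinf; [have := ev_top fd h0 | have := ev_top fd h1]; rewrite mul1n => <-.
Qed.

(* A point [P] of the curve outside the image would give a projection to the
   line, with centre [P], over which the ring of binary forms is finite; the
   characteristic equation of the last coordinate is then a multiple of [F]
   that does not vanish at [P]. *)
Lemma point_on_image (P : 'rV[K]_3) : P != 0 -> F.@[P 0] = 0 ->
  (exists a c, forall i, (f i).[a] = c * P 0 i) \/ (exists c, forall i, (f i)`_d = c * P 0 i).
Proof.
move=> P0 FP; apply/or_asboolP; rewrite -[X in is_true X]negbK; apply/negP.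
rewrite negb_or => /andP[/asboolPn nofin /asboolPn noinf].
have [L0 [L1 [L2 [[h0 h1 h2] [P0L P1L P2L] span]]]] := lines_through P0.
have cab : coprime_forms d d (ev f L0) (ev f L1).
  apply: lines_coprime => // [a|]; rewrite ?horner_ev => e0 e1.
    by apply: nofin; have [c hc] := span _ e0 e1; exists a, c.
  by apply: noinf; have [c hc] := span _ e0 e1; exists c.
have h2d : deg_le (1 * d) (ev f L2) := ev_deg_le fd h2.
have [B [hB BE B0]] := multiplication_matrix h0 h1 cab h2d.
pose A := L2%:M - B.
have hA i j : A i j \is 1.-homog.
  rewrite !mxE; apply: (subspaceB (homog_subspace K 3 1)) => //.
  by case: eqP => _; rewrite ?mulr1n ?mulr0n ?dhomog0.
have evA : ev f (\det A) = 0.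
  rewrite -det_map_mx; apply: (@det_kernel _ _ _ (fun j => 'X^j) ord0); first by rewrite expr0 oner_neq0.
  move=> i; transitivity (\sum_j (ev f (L2 *+ (i == j)) * 'X^j - ev f (B i j) * 'X^j)).
    by apply: eq_bigr => j _; rewrite !mxE rmorphB mulrBl.
  rewrite sumrB -BE (bigD1 i) //= eqxx big1 ?addr0 ?subrr // => j ji.
  by rewrite eq_sym (negPf ji) rmorph0 mul0r.
have /(rc_eq rc (det_homog hA))[U eU] := evA.
have : (\det A).@[P 0] = 0 by rewrite eU mevalM FP mulr0.
rewrite -det_map_mx (_ : map_mx _ A = (L2.@[P 0])%:M) ?det_scalar.
  by move/eqP; rewrite expf_eq0 (negPf P2L) andbF.
apply/matrixP => i j; rewrite !mxE /= rmorphB /= B0 // subr0.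
by case: eqP => _; rewrite ?mulr1n ?mulr0n ?meval0.
Qed.

Lemma distinct_representatives (V : eqType) (E : V -> V -> Prop) (L : seq V) :
  (forall x, E x x) -> (forall x y, E x y -> E y x) ->
  exists L' : seq V, [/\ {subset L' <= L},
    forall i j x0, (i < size L')%N -> (j < size L')%N -> E (nth x0 L' i) (nth x0 L' j) -> i = j
    & forall x, x \in L -> exists2 y, y \in L' & E x y].
Proof.
move=> Er Es; elim: L => [|x L [L' [sub dist cov]]]; first by exists [::]; split.
have [[y yL' xy]|nex] := pselect (exists2 y, y \in L' & E x y).
  exists L'; split=> // [z /sub zL|z]; first by rewrite inE zL orbT.
  by rewrite inE => /orP[/eqP->|/cov//]; exists y.
exists (x :: L'); split.
- by move=> z; rewrite !inE => /orP[->//|/sub ->]; rewrite orbT.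
- move=> [|i] [|j] x0 //=; rewrite ?ltnS => hi hj h.
  + by case: nex; exists (nth x0 L' j) => //; apply: mem_nth.
  + by case: nex; exists (nth x0 L' i); [apply: mem_nth | apply: Es].
  + by congr _.+1; apply: dist h.
- move=> z; rewrite inE => /orP[/eqP->|/cov[y yL zy]]; first by exists x => //; apply: mem_head.
  by exists y => //; rewrite inE yL orbT.
Qed.

(** Points of the curve lie on the image, so a singular point comes from infinity or from a root of
    a nonzero entry of [grad]; this finite list is then cleared of repetitions. *)
Lemma singular_points_finite : exists k (P : 'I_k -> 'rV[K]_3),
  [/\ forall i, singular_point F (P i), forall i j, proj_eq (P i) (P j) -> i = j
    & forall Q, singular_point F Q -> exists i, proj_eq Q (P i)].
Proof.
have [i0 gi0] : exists i, grad f F i != 0 by exact: grad_neq0 rc.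
have [rs Drs] := closed_field_poly_normal (grad f F i0).
pose pt a : 'rV[K]_3 := \row_i (f i).[a]; pose ptinf : 'rV[K]_3 := \row_i (f i)`_d.
pose L := [seq P <- ptinf :: map pt rs | `[< singular_point F P >]].
have Er (x : 'rV[K]_3) : proj_eq x x by exists 1; rewrite ?oner_neq0 ?scale1r.
have Es (x y : 'rV[K]_3) : proj_eq x y -> proj_eq y x.
  by case=> c c0 ->; exists c^-1; rewrite ?invr_eq0 // scalerA mulVf // scale1r.
have [L' [sub dist cov]] := distinct_representatives L Er Es.
exists (size L'), (fun i => nth 0 L' i); split.
- move=> i; have /sub : nth 0 L' i \in L' by apply: mem_nth.
  by rewrite mem_filter => /andP[/asboolP].
- by move=> i j h; apply: val_inj; apply: dist h.
move=> Q singQ; have [Q0 FQ gQ] := singQ.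
have found P : singular_point F P -> P \in ptinf :: map pt rs -> proj_eq Q P ->
    exists i : 'I_(size L'), proj_eq Q (nth 0 L' i).
  move=> sP PL QP; have /cov[y yL' Py] : P \in L.
    by rewrite mem_filter PL andbT; apply/asboolP.
  have hi : (index y L' < size L')%N by rewrite index_mem.
  exists (Ordinal hi); rewrite /= nth_index //.
  case: QP => c c0 ->; case: Py => c' c'0 ->.
  by exists (c * c'); rewrite ?mulf_neq0 // scalerA.
have sing_scale c P : c != 0 -> P = c *: Q -> singular_point F P.
  move=> c0 eP; have e G k : G \is k.-homog -> G.@[P 0] = c ^+ k * G.@[Q 0].
    by move=> hG; rewrite -(meval_homog _ _ hG); apply: meval_eq => i; rewrite eP mxE.
  split=> [||i]; first by rewrite eP scaler_eq0 negb_or c0.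
    by rewrite (e _ _ hF) FQ mulr0.
  by rewrite (e _ _ (mderiv_homog i hF)) gQ mulr0.
have back c P : c != 0 -> P = c *: Q -> proj_eq Q P.
  by move=> c0 ->; exists c^-1; rewrite ?invr_eq0 // scalerA mulVf // scale1r.
have [[a [c hc]]|[c hc]] := point_on_image Q0 FQ.
  have c0 : c != 0.
    case: (rc_base rc a) => i; apply: contraNneq => c0; by rewrite hc c0 mul0r.
  have eP : pt a = c *: Q by apply/rowP => i; rewrite !mxE hc.
  have sP := sing_scale _ _ c0 eP; apply: (found (pt a) sP) (back _ _ c0 eP).
  rewrite inE; apply/orP; right; apply: map_f.
  rewrite -root_prod_XsubC -(rootZ _ _ (a := lead_coef (grad f F i0))) ?lead_coef_eq0 // -Drs.
  have [_ _ /(_ i0)] := sP; rewrite /root horner_ev => h; apply/eqP; rewrite -[RHS]h.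
  by apply: meval_eq => i; rewrite mxE.
have c0 : c != 0.
  case: (rc_base_inf rc) => i; apply: contraNneq => c0; by rewrite hc c0 mul0r.
have eP : ptinf = c *: Q by apply/rowP => i; rewrite !mxE hc.
by apply: (found ptinf (sing_scale _ _ c0 eP)) (back _ _ c0 eP); apply: mem_head.
Qed.

End Points.

(** * Local rings and their normalizations *)

Lemma det_ind (R : comPzRingType) (Q : R -> Prop) n (A : 'M[R]_n) :
  Q 1 -> (forall x y, Q x -> Q y -> Q (x + y)) -> (forall x y, Q x -> Q y -> Q (x * y)) ->
  (forall x, Q x -> Q (- x)) -> (forall i j, Q (A i j)) -> Q (\det A).
Proof.
move=> Q1 QD QM QN QA; have Q0 : Q 0 by rewrite -(subrr 1); apply: QD => //; apply: QN.
rewrite /determinant; apply: (big_ind Q _ QD) => // s _; apply: (QM).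
  by case: (odd_perm s); rewrite ?expr1 ?expr0 //; apply: QN.
by apply: (big_ind Q _ QM) => // i _; apply: QA.
Qed.

(* Clearing denominators, and then cancelling common factors, a root [y] of a
   monic equation with denominator [h] is a polynomial divided by [h]; the
   degree bound says that the pole at infinity is no worse. *)
Lemma integral_fraction (K : numClosedFieldType) D n (h a b : {poly K}) (g : nat -> {poly K}) :
  h != 0 -> b != 0 -> deg_le D h -> (forall i, deg_le D (g i)) -> g n = h ->
  \sum_(i < n.+1) g i * a ^+ i * b ^+ (n - i) = 0 ->
  exists2 p, deg_le D p & p * b = a * h.
Proof.
move=> h0 b0 hD gD gn eq0.
pose c := gcdp a b; have c0 : c != 0 by rewrite gcdp_eq0 (negPf b0) andbF.
pose u := a %/ c; pose w := b %/ c.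
have ea : a = u * c by rewrite divpK ?dvdp_gcdl.
have eb : b = w * c by rewrite divpK ?dvdp_gcdr.
have cop : coprimep w u.
  by rewrite coprimep_sym; apply: coprimep_div_gcd; rewrite b0 orbT.
have {}eq0 : \sum_(i < n.+1) g i * u ^+ i * w ^+ (n - i) = 0.
  apply: (mulIf (expf_neq0 n c0)); rewrite mul0r -[RHS]eq0 mulr_suml; apply: eq_bigr => i _.
  have -> : c ^+ n = c ^+ i * c ^+ (n - i) by rewrite -exprD subnKC // -ltnS.
  by rewrite ea eb !exprMn; ring.
have /dvdpP[w' eh] : w %| h.
  rewrite -(Gauss_dvdpl h (coprimep_expr n cop)).
  move: eq0; rewrite big_ord_recr /= subnn expr0 mulr1 gn => /eqP.
  rewrite addrC addr_eq0 => /eqP ->; rewrite dvdpNr; apply: (big_ind (fun q => w %| q)) => [|q q'|i _];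
    [exact: dvdp0 | exact: dvdp_add |].
  by apply: dvdp_mull; rewrite -subnSK // exprS; apply: dvdp_mulr.
exists (w' * u); last by rewrite eb ea eh; ring.
set p := w' * u; have {}eq0 : \sum_(i < n.+1) g i * p ^+ i * h ^+ (n - i) = 0.
  transitivity (w' ^+ n * \sum_(i < n.+1) g i * u ^+ i * w ^+ (n - i)); last by rewrite eq0 mulr0.
  rewrite mulr_sumr; apply: eq_bigr => i _.
  have -> : w' ^+ n = w' ^+ i * w' ^+ (n - i) by rewrite -exprD subnKC // -ltnS.
  by rewrite eh /p !exprMn; ring.
(* If p had degree above D, hence above the degrees of h and of all the g i, the term h p^n would
   have larger degree than every other term. *)
rewrite /deg_le leqNgt; apply/negP => Dp.
have p0 : p != 0 by rewrite -size_poly_gt0; apply: leq_ltn_trans Dp.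
move: eq0; rewrite big_ord_recr /= subnn expr0 mulr1 gn => /eqP.
rewrite addrC addr_eq0 => /eqP eq0.
pose x := (size p).-1; pose y := (size h).-1.
have hx : deg_le x p by rewrite /deg_le /x; case: (size p) Dp.
have hy : deg_le y h by rewrite /deg_le /y prednK ?size_poly_gt0.
have yD : (y <= D)%N by move: hD; rewrite /deg_le /y; case: (size h).
have Dx : (D < x)%N by move: Dp; rewrite /x; case: (size p).
have sz : size (h * p ^+ n) = (y + x * n).+1.
  rewrite size_mul ?expf_neq0 // -[size (p ^+ n)]prednK ?size_poly_gt0 ?expf_neq0 //.
  by rewrite size_exp addnS /y -[in RHS]addSn prednK ?size_poly_gt0.
have n0 : (0 < n)%N.
  rewrite lt0n; apply/negP => /eqP en; move: eq0; rewrite en big_ord0 oppr0 expr0 mulr1 => h00.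
  by rewrite h00 eqxx in h0.
have : deg_le (y + x * n).-1 (h * p ^+ n).
  rewrite eq0; apply: (subspaceN (deg_le_subspace K _)).
  apply: (subspace_sum (deg_le_subspace K _)) => i _.
  apply: deg_leW (deg_le_mul (deg_le_mul (gD i) (deg_le_exp i hx)) (deg_le_exp (n - i) hy)).
  have := ltn_ord i; move: (nat_of_ord i) => j jn.
  have [m em] : exists m, n = (j + m.+1)%N by exists (n - j.+1)%N; lia.
  have ym : (m * y <= m * x)%N by apply: leq_mul => //; lia.
  rewrite em; have -> : (j + m.+1 - j = m.+1)%N by lia.
  rewrite mulnDr !mulSn mulnS (mulnC x j) (mulnC x m); lia.
rewrite /deg_le sz prednK ?ltnn //; first by rewrite addn_gt0 muln_gt0 n0 andbT (leq_ltn_trans _ Dx) ?orbT.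
Qed.

Lemma clear_denominators (L : fieldType) n (g : nat -> L) (h a b : L) : h != 0 -> b != 0 ->
  \sum_(i < n.+1) g i / h * (a / b) ^+ i = 0 ->
  \sum_(i < n.+1) g i * a ^+ i * b ^+ (n - i) = 0.
Proof.
move=> h0 b0 e; transitivity (h * b ^+ n * \sum_(i < n.+1) g i / h * (a / b) ^+ i); last first.
  by rewrite e mulr0.
rewrite mulr_sumr; apply: eq_bigr => i _.
have -> : b ^+ n = b ^+ i * b ^+ (n - i) by rewrite -exprD subnKC // -ltnS.
rewrite exprMn exprVn; field.
by rewrite h0 expf_neq0.
Qed.

Lemma clear_denominators_frac (R : idomainType) n (g : nat -> R) (h a b : R) : h != 0 -> b != 0 ->
  \sum_(i < n.+1) tofrac (g i) / tofrac h * (tofrac a / tofrac b) ^+ i = 0 ->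
  \sum_(i < n.+1) g i * a ^+ i * b ^+ (n - i) = 0.
Proof.
rewrite -(tofrac_eq0 h) -(tofrac_eq0 b) => h0 b0 e; apply/eqP; rewrite -tofrac_eq0; apply/eqP.
rewrite -[RHS](@clear_denominators _ n (fun i => tofrac (g i)) _ _ _ h0 b0 e).
by rewrite rmorph_sum; apply: eq_bigr => i _; rewrite /= !tofracM !tofracXn.
Qed.

Section Curve.
Variables (K : numClosedFieldType) (d : nat) (f : 'I_3 -> {poly K}) (F : {mpoly K[3]}).
Hypothesis rc : rational_curve d f F.
Local Notation S := {mpoly K[3]}.
Local Notation rat3 := {fraction {mpoly K[3]}}.
Local Notation rat1 := {fraction {poly K}}.
Local Notation section := (section f).

Let d3 : (3 <= d)%N := rc_d rc.
Let fd : forall i, deg_le d (f i) := rc_deg rc.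
Let hF : F \is d.-homog := rc_homog rc.

Lemma mp_dvd_ev k G : G \is k.-homog -> mp_dvd F G <-> ev f G = 0.
Proof. by move=> hG; have [h1 h2] := rc_eq rc hG; split. Qed.

(** The function on the curve represented by [x], as a fraction in the affine
    parameter. *)
Definition residue (x : rat3) (y : rat1) : Prop :=
  exists k G H, [/\ G \is k.-homog, H \is k.-homog, ev f H != 0,
    x = tofrac G / tofrac H & y = tofrac (ev f G) / tofrac (ev f H)].

Lemma residue_frac k G H : G \is k.-homog -> H \is k.-homog -> ev f H != 0 ->
  residue (tofrac G / tofrac H) (tofrac (ev f G) / tofrac (ev f H)).
Proof. by move=> hG hH H0; exists k, G, H. Qed.

Lemma ev_neq0 H : ev f H != 0 -> H != 0.
Proof. by apply: contraNneq => ->; rewrite rmorph0. Qed.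

Lemma residue_uniq x y y' : residue x y -> residue x y' -> y = y'.
Proof.
case=> k [G [H [hG hH H0 -> ->]]] [k' [G' [H' [hG' hH' H'0 e ->]]]].
move/eqP: e; rewrite eqr_div ?tofrac_eq0 ?ev_neq0 // -!rmorphM tofrac_eq => /eqP e.
by apply/eqP; rewrite eqr_div ?tofrac_eq0 // -!rmorphM tofrac_eq e.
Qed.

Lemma residueC c : residue (tofrac c%:MP) (tofrac c%:P).
Proof.
exists 0%N, c%:MP, 1; rewrite !rmorph1 !divr1 evC; split=> //; last exact: oner_neq0.
  by rewrite -[_%:MP]mulr1 mul_mpolyC dhomogZ ?dhomog1.
exact: dhomog1.
Qed.

Lemma residue0 : residue 0 0.
Proof. by have := residueC 0; rewrite mpolyC0 polyC0 !rmorph0. Qed.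

Lemma residue1 : residue 1 1.
Proof. by have := residueC 1; rewrite mpolyC1 polyC1 !rmorph1. Qed.

Lemma residueM x y x' y' : residue x y -> residue x' y' -> residue (x * x') (y * y').
Proof.
case=> k [G [H [hG hH H0 -> ->]]] [k' [G' [H' [hG' hH' H'0 -> ->]]]].
exists (k + k')%N, (G * G'), (H * H'); rewrite !rmorphM /= ?rmorphM /= !mulf_div mulf_neq0 //.
by split=> //; apply: dhomogM.
Qed.

Lemma residueD x y x' y' : residue x y -> residue x' y' -> residue (x + x') (y + y').
Proof.
case=> k [G [H [hG hH H0 -> ->]]] [k' [G' [H' [hG' hH' H'0 -> ->]]]].
exists (k + k')%N, (G * H' + G' * H), (H * H').
rewrite !addf_div ?tofrac_eq0 ?ev_neq0 // ?(rmorphD, rmorphM) /= ?(rmorphD, rmorphM) mulf_neq0 //.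
split=> //; last exact: dhomogM.
by apply: (subspaceD (homog_subspace K 3 _)); [|rewrite addnC]; apply: dhomogM.
Qed.

Lemma residueN x y : residue x y -> residue (- x) (- y).
Proof.
move=> h; have := residueM (residueC (-1)) h.
by rewrite mpolyCN polyCN !rmorphN mpolyC1 polyC1 !rmorph1 !mulN1r.
Qed.

Lemma residueB x y x' y' : residue x y -> residue x' y' -> residue (x - x') (y - y').
Proof. by move=> h h'; apply: residueD h (residueN h'). Qed.

Lemma residue_sum (I : Type) (r : seq I) (x : I -> rat3) y :
  (forall i, residue (x i) (y i)) -> residue (\sum_(i <- r) x i) (\sum_(i <- r) y i).
Proof.
move=> h; elim/big_ind2: _ => [|a b a' b'|i _]; [exact: residue0 | exact: residueD | exact: h].
Qed.

Lemma residueX x y n : residue x y -> residue (x ^+ n) (y ^+ n).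
Proof.
move=> h; elim: n => [|n IH]; first by rewrite !expr0; apply: residue1.
by rewrite !exprS; apply: residueM.
Qed.

Lemma residue_det n (A : 'M[rat3]_n) (B : 'M[rat1]_n) :
  (forall i j, residue (A i j) (B i j)) -> residue (\det A) (\det B).
Proof.
move=> h; apply: residue_sum => s; apply: residueM.
  by apply: residueX; apply: residueN; apply: residue1.
elim/big_ind2: _ => [|a b a' b'|i _]; [exact: residue1 | exact: residueM | exact: h].
Qed.

(** The numerator p need not lie in A, but c p and c both do in suitable degrees: multiply numerator
    and denominator by c. *)
Lemma residue_lift k p H : deg_le (k * d) p -> H \is k.-homog -> ev f H != 0 ->
  exists x, residue x (tofrac p / tofrac (ev f H)).
Proof.
move=> hp hH H0; have [c [c0 _ _ cond]] := conductor rc.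
have [||C hC eC] := cond d.-1 1; first by [].
  by rewrite /deg_le size_poly1.
have [||G hG eG] := cond (d.-1 + k)%N p; first exact: leq_addr.
  by apply: deg_leW hp; case: d d3 => [|[|[|d']]] //= _; nia.
rewrite mulr1 in eC; have eCH : ev f (C * H) = c * ev f H by rewrite rmorphM /= eC.
exists (tofrac G / tofrac (C * H)); exists (d.-1 + k)%N, G, (C * H); split=> //.
- exact: dhomogM.
- by rewrite eCH mulf_neq0.
- apply/eqP; rewrite eG eCH eqr_div ?tofrac_eq0 ?mulf_neq0 //.
  by rewrite -!rmorphM tofrac_eq; apply/eqP; ring.
Qed.

Lemma local_ring_genericP x : local_ring_generic F x <-> exists y, residue x y.
Proof.
split=> [[k [G [H [hG hH /(mp_dvd_ev hH)/eqP H0 ->]]]]|[_ [k [G [H [hG hH H0 -> _]]]]]].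
  by eexists; apply: (residue_frac hG hH).
by exists k, G, H; split=> //; move=> /(mp_dvd_ev hH)/eqP; rewrite (negPf H0).
Qed.

Lemma max_ideal_genericP x : max_ideal_generic F x <-> residue x 0.
Proof.
split=> [[k [G [H [hG hH /(mp_dvd_ev hH)/eqP H0 /(mp_dvd_ev hG) G0 ->]]]]|].
  by have := residue_frac hG hH H0; rewrite G0 rmorph0 mul0r.
case=> k [G [H [hG hH H0 -> /esym/eqP]]].
rewrite mulf_eq0 invr_eq0 !tofrac_eq0 (negPf H0) orbF => /eqP G0.
exists k, G, H; split=> //; first by move=> /(mp_dvd_ev hH)/eqP; rewrite (negPf H0).
exact/(mp_dvd_ev hG).
Qed.

Section Point.
Variable P : 'rV[K]_3.
Hypothesis FP : F.@[P 0] = 0.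

Lemma ev_denominator k H : H \is k.-homog -> H.@[P 0] != 0 -> ev f H != 0.
Proof.
move=> hH; apply: contraNneq => /(mp_dvd_ev hH)[U ->].
by rewrite mevalM FP mulr0.
Qed.

Lemma residue_local x : local_ring_plane P x ->
  exists k G H, [/\ G \is k.-homog, H \is k.-homog, H.@[P 0] != 0,
    x = tofrac G / tofrac H & residue x (tofrac (ev f G) / tofrac (ev f H))].
Proof.
case=> k [G [H [hG hH HP ->]]]; exists k, G, H; split=> //.
exact: residue_frac hG hH (ev_denominator hH HP).
Qed.

Lemma local_ring_planeC c : local_ring_plane P (tofrac c%:MP).
Proof.
exists 0%N, c%:MP, 1; rewrite tofrac1 divr1 meval1 oner_neq0; split=> //; last exact: dhomog1.
by rewrite -[_%:MP]mulr1 mul_mpolyC dhomogZ ?dhomog1.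
Qed.

Lemma local_ring_planeM x y :
  local_ring_plane P x -> local_ring_plane P y -> local_ring_plane P (x * y).
Proof.
case=> k [G [H [hG hH HP ->]]] [k' [G' [H' [hG' hH' HP' ->]]]].
exists (k + k')%N, (G * G'), (H * H'); rewrite mevalM mulf_neq0 // !rmorphM mulf_div.
by split=> //; apply: dhomogM.
Qed.

Lemma local_ring_planeD x y :
  local_ring_plane P x -> local_ring_plane P y -> local_ring_plane P (x + y).
Proof.
case=> k [G [H [hG hH HP ->]]] [k' [G' [H' [hG' hH' HP' ->]]]].
have H0 : H != 0 by apply: contraNneq HP => ->; rewrite meval0.
have H'0 : H' != 0 by apply: contraNneq HP' => ->; rewrite meval0.
exists (k + k')%N, (G * H' + G' * H), (H * H').
rewrite mevalM mulf_neq0 // addf_div ?tofrac_eq0 // !(rmorphD, rmorphM).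
split=> //; last exact: dhomogM.
by apply: (subspaceD (homog_subspace K 3 _)); [|rewrite addnC]; apply: dhomogM.
Qed.

Lemma in_local_ringP x : in_local_ring F P x <-> exists k G H,
  [/\ G \is k.-homog, H \is k.-homog, H.@[P 0] != 0
    & residue x (tofrac (ev f G) / tofrac (ev f H))].
Proof.
split=> [[y [z [/residue_local[k [G [H [hG hH HP _ ry]]]] /max_ideal_genericP rz ->]]]|].
  by exists k, G, H; split=> //; have := residueD ry rz; rewrite addr0.
case=> k [G [H [hG hH HP rx]]].
exists (tofrac G / tofrac H), (x - tofrac G / tofrac H); split; last by rewrite addrC subrK.
  by exists k, G, H.
apply/max_ideal_genericP; rewrite -(subrr (tofrac (ev f G) / tofrac (ev f H))).
exact: residueB rx (residue_frac hG hH (ev_denominator hH HP)).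
Qed.

(** This brings the local ring back to graded modules: p / H is regular at P iff the class of p
    modulo A is killed by a form that does not vanish at P. *)
Lemma in_local_ring_section k p H x : deg_le (k * d) p -> H \is k.-homog -> H.@[P 0] != 0 ->
  residue x (tofrac p / tofrac (ev f H)) ->
  in_local_ring F P x <->
  exists j H', [/\ H' \is j.-homog, H'.@[P 0] != 0 & section (j + k) (ev f H' * p)].
Proof.
move=> hp hH HP rx; have H0 := ev_denominator hH HP; split.
  move/in_local_ringP => [j [G [H' [hG hH' HP' rx']]]]; have H'0 := ev_denominator hH' HP'.
  have /eqP := residue_uniq rx rx'.
  rewrite eqr_div ?tofrac_eq0 // -!rmorphM tofrac_eq /= => /eqP e.
  exists j, H'; split=> //; exists (G * H); first exact: dhomogM.
  by rewrite -e mulrC.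
case=> j [H' [hH' HP' [G hG eG]]]; have H'0 := ev_denominator hH' HP'.
apply/in_local_ringP; exists (j + k)%N, G, (H' * H); split=> //; first exact: dhomogM.
  by rewrite mevalM mulf_neq0.
rewrite -eG !rmorphM /= ?rmorphM /= -mulf_div divff ?mul1r //.
by rewrite tofrac_eq0.
Qed.

(** Multiplication by p / H on 1, X, ..., X^(d-1) has a matrix over the local ring, whose
    characteristic polynomial is the integral equation: the vector of monomials is in the kernel of
    the evaluated matrix. *)
Lemma in_normalization_ex k p H x : deg_le (k * d) p -> H \is k.-homog -> H.@[P 0] != 0 ->
  residue x (tofrac p / tofrac (ev f H)) -> in_normalization F P x.
Proof.
move=> hp hH HP rx; have H0 := ev_denominator hH HP.
split; first by apply/local_ring_genericP; exists (tofrac p / tofrac (ev f H)).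
have [al [be F_albe]] := homog_nonzero_affine hF (F_neq0 rc).
have := shear_coprime rc F_albe; rewrite -(ev_shear0 f al) -(ev_shear1 f be) => cab.
have [hL0 hL1] := shear_homog al be.
have [B [hB BE _]] := multiplication_matrix rc hL0 hL1 cab hp.
pose A : 'M[rat3]_(d.-1.+1) := \matrix_(i, j) (tofrac (B i j) / tofrac H).
pose A1 : 'M[rat1]_(d.-1.+1) := \matrix_(i, j) (tofrac (ev f (B i j)) / tofrac (ev f H)).
exists (char_poly A); split; first exact: char_poly_monic.
  pose Q (q : {poly rat3}) := forall i, local_ring_plane P q`_i.
  have L0 : local_ring_plane P 0 by have := local_ring_planeC 0; rewrite mpolyC0 rmorph0.
  have L1 : local_ring_plane P 1 by have := local_ring_planeC 1; rewrite mpolyC1 rmorph1.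
  have LN y : local_ring_plane P y -> local_ring_plane P (- y).
    move=> hy; have := local_ring_planeM (local_ring_planeC (-1)) hy.
    by rewrite mpolyCN rmorphN mpolyC1 rmorph1 mulN1r.
  have Q1 : Q 1 by move=> i; rewrite coef1; case: (i == 0%N).
  have QN q : Q q -> Q (- q) by move=> hq i; rewrite coefN; apply: LN.
  have QD q q' : Q q -> Q q' -> Q (q + q').
    by move=> hq hq' i; rewrite coefD; apply: local_ring_planeD.
  have QM q q' : Q q -> Q q' -> Q (q * q').
    move=> hq hq' i; rewrite coefM; elim/big_ind: _ => // [y z|j _]; first exact: local_ring_planeD.
    exact: local_ring_planeM.
  apply: (@det_ind _ Q) => // i j; rewrite !mxE; apply: (QD) => [n|].
    rewrite coefMn coefX; case: (n == 1%N); case: (i == j); rewrite ?mulr1n ?mulr0n //.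
  apply: (QN) => n; rewrite coefC; case: (n == 0%N) => //.
  by exists k, (B i j), H.
apply/max_ideal_genericP.
have -> : (char_poly A).[x] = \det (x%:M - A).
  rewrite -[LHS]/(horner_eval x (char_poly A)) /char_poly -det_map_mx; congr (\det _).
  apply/matrixP => i j; rewrite !mxE /= /horner_eval; by rewrite hornerD hornerN hornerMn hornerX hornerC.
have -> : 0 = \det ((tofrac p / tofrac (ev f H))%:M - A1).
  apply/esym; apply: (@det_kernel _ _ _ (fun j => tofrac 'X^j) ord0).
    by rewrite expr0 rmorph1 oner_neq0.
  move=> i; under eq_bigr => j _ do rewrite !mxE mulrBl.
  rewrite sumrB (bigD1 i) //= eqxx mulr1n big1 ?addr0 => [|j ji]; last first.
    by rewrite eq_sym (negPf ji) mulr0n mul0r.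
  apply/eqP; rewrite subr_eq0 mulrAC -rmorphM BE rmorph_sum /= mulr_suml; apply/eqP.
  by apply: eq_bigr => j _; rewrite rmorphM /= mulrAC.
apply: residue_det => i j; rewrite !mxE; apply: residueB; last exact: residue_frac (hB i j) hH H0.
by case: (i == j); rewrite ?mulr1n ?mulr0n //; apply: residue0.
Qed.

Lemma common_denominator (s : seq rat3) : (forall i, local_ring_plane P s`_i) ->
  exists k H, [/\ H \is k.-homog, H.@[P 0] != 0 &
    exists2 G : nat -> S, (forall i, G i \is k.-homog) &
    forall i, s`_i = tofrac (G i) / tofrac H].
Proof.
elim: s => [|a s IH] sL.
  exists 0%N, 1; split; [exact: dhomog1 | by rewrite meval1 oner_neq0 |].
  exists (fun=> 0) => i; first exact: dhomog0.
  by rewrite nth_nil tofrac0 mul0r.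
have [|k [H [hH HP [G hG GE]]]] := IH; first by move=> i; apply: (sL i.+1).
have [j [U [W [hU hW WP /= e0]]]] := sL 0%N.
have W0 : W != 0 by apply: contraNneq WP => ->; rewrite meval0.
have H0 : H != 0 by apply: contraNneq HP => ->; rewrite meval0.
exists (j + k)%N, (W * H); split; [exact: dhomogM | by rewrite mevalM mulf_neq0 |].
exists (fun i => if i is i'.+1 then W * G i' else U * H) => [[|i]|[|i]] /=; try exact: dhomogM.
  by rewrite e0 !tofracM -mulf_div divff ?tofrac_eq0 // mulr1.
by rewrite GE !tofracM -mulf_div divff ?tofrac_eq0 // mul1r.
Qed.

(** For the direct implication, the coefficients of an integral equation get a common denominator H
    of degree k; [integral_fraction] then bounds the poles by H, infinity included. *)
Lemma in_normalizationP x : in_normalization F P x <-> exists k p H,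
  [/\ deg_le (k * d) p, H \is k.-homog, H.@[P 0] != 0
    & residue x (tofrac p / tofrac (ev f H))].
Proof.
split=> [[/local_ring_genericP[y rx] [p [pm pL /max_ideal_genericP rp]]]|]; last first.
  by case=> k [p [H [hp hH HP rx]]]; exact: (in_normalization_ex hp hH HP rx).
have [k1 [G1 [H1 [hG1 hH1 H10 _ ey]]]] := rx.
pose n := (size p).-1.
have sp : size p = n.+1 by rewrite /n prednK // size_poly_gt0 monic_neq0.
have [k [H [hH HP [G hG GE]]]] := common_denominator pL.
have H0 := ev_denominator hH HP.
have eq0 : \sum_(i < n.+1) tofrac (ev f (G i)) / tofrac (ev f H) * y ^+ i = 0.
  apply: residue_uniq rp; rewrite horner_coef sp; apply: residue_sum => i.
  by apply: residueM; [rewrite GE; apply: residue_frac hH H0 | apply: residueX].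
have Gn : ev f (G n) = ev f H.
  have := residue_frac (hG n) hH H0; rewrite -GE -[p`_n]/(lead_coef p) (monicP pm).
  by move=> /(residue_uniq residue1) e; apply/eqP; rewrite -tofrac_eq; apply/eqP; rewrite -[RHS]mul1r e divfK // tofrac_eq0.
have [||||||q hq e] := @integral_fraction K (k * d) n (ev f H) (ev f G1) (ev f H1) (fun i => ev f (G i)).
- by [].
- by [].
- exact: ev_deg_le.
- by move=> i; apply: ev_deg_le.
- by [].
- by rewrite ey in eq0; apply: (@clear_denominators_frac _ n (fun i => ev f (G i)) _ _ _ H0 H10 eq0).
exists k, q, H; split=> //.
suff <- : y = tofrac q / tofrac (ev f H) by [].
by apply/eqP; rewrite ey eqr_div ?tofrac_eq0 // -!tofracM tofrac_eq e.
Qed.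

End Point.
End Curve.

(** * The delta invariants *)

Lemma common_eigenvector_in (K : numClosedFieldType) n (U : 'M[K]_n) (A : 'I_3 -> 'M[K]_n) :
  U != 0 -> (forall i, stablemx U (A i)) -> (forall i j, A i *m A j = A j *m A i) ->
  exists2 w : 'rV_n, w != 0 & (w <= U)%MS /\ exists Q : 'I_3 -> K, forall i, w *m A i = Q i *: w.
Proof.
move=> U0 stA comA.
have := @common_eigenvector K _ [seq restrictmx U (A i) | i <- enum 'I_3] _ _.
case=> [||v v0 /allP hv].
- by rewrite lt0n mxrank_eq0.
- move=> _ _ /mapP[i _ ->] /mapP[j _ ->].
  by rewrite /comm_mx -!conjmxM ?inE ?stablemx_row_base // comA.
exists (v *m row_base U); first by rewrite mulmx_free_eq0 ?row_base_free.
split; first by rewrite mulmx_sub // eq_row_base.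
have /fin_all_exists[Q hQ] : forall i, exists a, v *m row_base U *m A i = a *: (v *m row_base U).
  move=> i; have : stablemx (v *m row_base U) (A i).
    rewrite -stablemx_restrict ?stA // hv //; apply: map_f; exact: mem_enum.
  by case/sub_rVP => a ->; exists a.
by exists Q.
Qed.

Section Curve.
Variables (K : numClosedFieldType) (d : nat) (f : 'I_3 -> {poly K}) (F : {mpoly K[3]}).
Hypothesis rc : rational_curve d f F.
Local Notation S := {mpoly K[3]}.
Local Notation grad := (grad f F).
Local Notation jac := (jac f).
Local Notation section := (section f).
Local Notation delta := (delta d).

Let d3 : (3 <= d)%N := rc_d rc.
Let fd : forall i, deg_le d (f i) := rc_deg rc.
Let hF : F \is d.-homog := rc_homog rc.
Let sS k : subspace (section k) := section_subspace f k.

(** * The action of forms on the stable cokernel of functions *)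

Section Action.
Variables (l M N : S) (rs : seq K).
Hypothesis gl : good_line d f 1 l M N rs.
Variable e : 'I_delta -> {poly K}.
Let k0 := (d - 2)%N.
Hypothesis e_deg : forall i, deg_le (k0 * d) (e i).
Hypothesis e_gen : forall p, deg_le (k0 * d) p -> exists c, section k0 (p - lin e c).
Hypothesis e_ind : forall c, section k0 (lin e c) -> c = 0.
Let lam := ev f l.

Lemma lam_section j : section j (lam ^+ j).
Proof.
have [[hl _ _] _ _ _ _] := gl.
exists (l ^+ j); last by rewrite rmorphXn.
by have := dhomogMn j hl; rewrite mul1n.
Qed.

Lemma lam_deg j : deg_le (j * d) (lam ^+ j).
Proof. exact: (section_deg rc (lam_section j)). Qed.

Lemma saturationX j k g : deg_le (k * d) g -> section (j + k) (lam ^+ j * g) -> section k g.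
Proof.
move=> hg; elim: j => [|j IH]; first by rewrite expr0 mul1r.
rewrite exprS -mulrA addSn => h; apply: IH; apply: (saturation rc gl) h.
by rewrite mulnDl; apply: deg_le_mul => //; apply: lam_deg.
Qed.

Lemma lin_deg v : deg_le (k0 * d) (lin e v).
Proof. by apply: (subspace_lin (deg_le_subspace K _)). Qed.

(** [v] is the vector of coordinates of [p], of degree [k d], in the basis [e]
    of the stable value of the graded module of all binary forms of degree
    divisible by [d] modulo the coordinate ring; [lam] is invertible on it. *)
Definition rel k (p : {poly K}) (v : 'rV[K]_delta) : Prop :=
  section (k0 + k) (lam ^+ k0 * p - lam ^+ k * lin e v).

Lemma rel_lin v : rel k0 (lin e v) v.
Proof. by rewrite /rel subrr; apply: subspace0. Qed.

Lemma relP k c p q u v : rel k p u -> rel k q v -> rel k (c *: p + q) (c *: u + v).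
Proof.
move=> hp hq; rewrite /rel linD linZ.
have -> : lam ^+ k0 * (c *: p + q) - lam ^+ k * (c *: lin e u + lin e v) =
   c *: (lam ^+ k0 * p - lam ^+ k * lin e u) + (lam ^+ k0 * q - lam ^+ k * lin e v).
  by rewrite -!mul_polyC; ring.
by have [_ h] := sS (k0 + k); apply: h.
Qed.

Lemma rel0 k p : deg_le (k * d) p -> rel k p 0 <-> section k p.
Proof.
move=> hp; rewrite /rel lin0 mulr0 subr0; split; first exact: saturationX.
by apply: sectionM; apply: lam_section.
Qed.

Lemma rel_section k p v : section k p -> rel k p v -> v = 0.
Proof.
move=> hp h; apply: e_ind; apply: (@saturationX k); first exact: lin_deg.
rewrite -[X in section _ X]opprK -[- (_ * _)](addKr (lam ^+ k0 * p)) addnC.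
apply: subspaceN => //; apply: subspaceD => //.
by apply: subspaceN => //; apply: sectionM => //; apply: lam_section.
Qed.

Lemma rel_uniq k p u v : rel k p u -> rel k p v -> u = v.
Proof.
move=> hu hv; apply/eqP; rewrite -subr_eq0; apply/eqP.
apply: (@rel_section k 0); first exact: subspace0.
have := relP (-1) hv hu; rewrite !scaleN1r addNr addrC //.
Qed.

Lemma rel_shift j k p v : rel k p v -> rel (j + k) (lam ^+ j * p) v.
Proof.
move=> h; rewrite /rel addnCA exprD.
have -> : lam ^+ k0 * (lam ^+ j * p) - lam ^+ j * lam ^+ k * lin e v =
  lam ^+ j * (lam ^+ k0 * p - lam ^+ k * lin e v) by ring.
by apply: sectionM => //; apply: lam_section.
Qed.

Lemma rel_ex k p : deg_le (k * d) p -> exists v, rel k p v.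
Proof.
move=> hp.
have gen j q : deg_le ((j + k0) * d) q -> exists v, section (j + k0) (q - lam ^+ j * lin e v).
  elim: j q => [|j IH] q hq; first by have [c hc] := e_gen hq; exists c; rewrite expr0 mul1r.
  have [|g hg hs] := section_onto rc gl (k := j + k0) _ hq; first by rewrite /k0; lia.
  have [v hv] := IH g hg; exists v; rewrite addSn.
  have -> : q - lam ^+ j.+1 * lin e v = (q - lam * g) + lam * (g - lam ^+ j * lin e v).
    by rewrite exprS; ring.
  apply: subspaceD => //; rewrite -add1n; apply: sectionM => //.
  exact: (lam_section 1).
have [|v hv] := gen k (lam ^+ k0 * p); last by exists v; rewrite /rel addnC.
by rewrite addnC mulnDl; apply: deg_le_mul => //; apply: lam_deg.
Qed.

(** The rows are the coordinates of the products of H with the basis. That one matrix serves in all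
    degrees k follows after multiplication by powers of [lam], which [saturationX] cancels. *)
Lemma action_ex j H : H \is j.-homog -> exists A : 'M[K]_delta,
  forall k p v, deg_le (k * d) p -> rel k p v -> rel (j + k) (ev f H * p) (v *m A).
Proof.
move=> hH; have hHd := ev_deg_le fd hH; have sH : section j (ev f H) by exists H.
have /fin_all_exists[r hr] : forall i, exists v, rel (j + k0) (ev f H * e i) v.
  by move=> i; apply: rel_ex; rewrite mulnDl; apply: deg_le_mul.
exists (\matrix_i r i) => k p v hp hv.
have hlin : rel (j + k0) (ev f H * lin e v) (v *m \matrix_i r i).
  have -> : v *m \matrix_i r i = \sum_i v 0 i *: r i.
    by rewrite mulmx_sum_row; apply: eq_bigr => i _; rewrite rowK.
  rewrite /lin mulr_sumr; elim/big_ind2: _ => [|p1 u1 p2 u2 h1 h2|i _].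
  - by rewrite /rel mulr0 lin0 mulr0 subrr; apply: subspace0.
  - by have := relP 1 h1 h2; rewrite !scale1r.
  - have z : rel (j + k0) 0 0 by rewrite /rel mulr0 lin0 mulr0 subrr; apply: subspace0.
    by have := relP (v 0 i) (hr i) z; rewrite !addr0 scalerAr.
rewrite /rel.
have -> : lam ^+ k0 * (ev f H * p) - lam ^+ (j + k) * lin e (v *m \matrix_i r i) =
    ev f H * (lam ^+ k0 * p - lam ^+ k * lin e v) +
    (lam ^+ k * (ev f H * lin e v) - lam ^+ (j + k) * lin e (v *m \matrix_i r i)) by ring.
apply: subspaceD => //; first by rewrite addnCA; apply: sectionM.
apply: (@saturationX k0).
  apply: (subspaceB (deg_le_subspace K _)).
    have -> : ((k0 + (j + k)) * d = k * d + (j * d + k0 * d))%N by lia.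
    by apply: deg_le_mul; [exact: lam_deg | apply: deg_le_mul => //; exact: lin_deg].
  rewrite addnC mulnDl; apply: deg_le_mul; [exact: lam_deg | exact: lin_deg].
have -> : lam ^+ k0 * (lam ^+ k * (ev f H * lin e v) - lam ^+ (j + k) * lin e (v *m \matrix_i r i)) =
  lam ^+ k * (lam ^+ k0 * (ev f H * lin e v) - lam ^+ (j + k0) * lin e (v *m \matrix_i r i)).
  by rewrite !exprD; ring.
have -> : (k0 + (k0 + (j + k)) = k + (k0 + (j + k0)))%N by lia.
by apply: sectionM => //; apply: lam_section.
Qed.

Definition action j (H : S) : 'M[K]_delta :=
  if pselect (H \is j.-homog) is left hH then projT1 (cid (action_ex hH)) else 0.

Lemma actionP j H k p v : H \is j.-homog -> deg_le (k * d) p -> rel k p v ->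
  rel (j + k) (ev f H * p) (v *m action j H).
Proof.
by move=> hH; rewrite /action; case: pselect => // hH'; case: cid => A /= hA; apply: hA.
Qed.

Lemma action_eq j H (B : 'M[K]_delta) : H \is j.-homog ->
  (forall v, rel (j + k0) (ev f H * lin e v) (v *m B)) -> action j H = B.
Proof.
move=> hH hB; apply/row_matrixP => i; rewrite !rowE.
exact: rel_uniq (actionP hH (lin_deg _) (rel_lin _)) (hB _).
Qed.

Lemma actionM i j G H : G \is i.-homog -> H \is j.-homog ->
  action (i + j) (G * H) = action i G *m action j H.
Proof.
move=> hG hH; apply: action_eq => [|v]; first exact: dhomogM.
rewrite rmorphM mulmxA [ev f G * _]mulrC -mulrA -addnA addnCA.
apply: actionP => //; last by apply: actionP => //; [exact: lin_deg | exact: rel_lin].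
by rewrite mulnDl; apply: deg_le_mul; [exact: ev_deg_le | exact: lin_deg].
Qed.

Lemma actionC i j G H : G \is i.-homog -> H \is j.-homog ->
  action i G *m action j H = action j H *m action i G.
Proof. by move=> hG hH; rewrite -!actionM // mulrC addnC. Qed.

Lemma actionD j c G H : G \is j.-homog -> H \is j.-homog ->
  action j (c *: G + H) = c *: action j G + action j H.
Proof.
move=> hG hH; apply: action_eq => [|v].
  by have [_ h] := homog_subspace K 3 j; apply: h.
have := relP c (actionP hG (lin_deg v) (rel_lin v)) (actionP hH (lin_deg v) (rel_lin v)).
by rewrite linearP /= mulrDl -scalerAl mulmxDr -scalemxAr.
Qed.

(** All degrees are identified through multiplication by [lam], which is the action of l itself. *)
Lemma action_line : action 1 l = 1%:M.
Proof.
have [[hl _ _] _ _ _ _] := gl; apply: action_eq => // v.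
by rewrite mulmx1; have := rel_shift 1 (rel_lin v); rewrite expr1.
Qed.

Lemma action_one : action 0 1 = 1%:M.
Proof. by apply: action_eq => [|v]; rewrite ?dhomog1 // mulmx1 rmorph1 mul1r; apply: rel_lin. Qed.

Lemma action0 j H : H \is j.-homog ->
  (forall p, deg_le (k0 * d) p -> section (j + k0) (ev f H * p)) -> action j H = 0.
Proof.
move=> hH h; apply: action_eq => // v; rewrite mulmx0; apply/rel0.
  by rewrite mulnDl; apply: deg_le_mul; [exact: ev_deg_le | exact: lin_deg].
by apply: h; apply: lin_deg.
Qed.

Lemma actionF : action d F = 0.
Proof.
by apply: action0 => // p _; rewrite (ev_F rc) mul0r; apply: subspace0.
Qed.

(** The derivative evaluates to c times [jac i], and c carries the product of [jac i] with a form of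
    degree (d - 2) d into A, the degrees d^2 - 2 matching exactly. *)
Lemma action_grad i : action d.-1 F^`M(i) = 0.
Proof.
have [c [_ _ gradE condc]] := conductor rc.
apply: action0 => [|p hp]; first exact: mderiv_homog.
rewrite -/(grad i) gradE -mulrA; have [||G hG <-] := condc (d.-1 + k0)%N (jac i * p); last by exists G.
  exact: leq_addr.
apply: deg_leW (deg_le_mul (jac_deg rc i) hp).
rewrite /k0; case: d d3 => [|[|[|d']]] //= _; nia.
Qed.

(* Eigenvectors of the coordinates: the eigenvalues are the coordinates of a
   point at which the conductor, hence the Jacobian ideal, vanishes. *)
Lemma eigen_singular (U : 'M[K]_delta) : U != 0 ->
  (forall j H, H \is j.-homog -> stablemx U (action j H)) ->
  exists2 w : 'rV_delta, w != 0 & (w <= U)%MS /\ exists2 Q : 'rV[K]_3, singular_point F Q &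
    forall j H, H \is j.-homog -> w *m action j H = H.@[Q 0] *: w.
Proof.
move=> U0 stU.
have [||w w0 [wU [q hq]]] := @common_eigenvector_in K _ U (fun i => action 1 'X_i) U0.
- by move=> i; apply: stU; apply: X_homog.
- by move=> i j; apply: actionC; apply: X_homog.
have hX k m : mdeg m = k -> w *m action k 'X_[m] = 'X_[m].@[q] *: w.
  elim: k m => [|k IH] m mk.
    by move/eqP: mk; rewrite mdeg_eq0 => /eqP ->; rewrite mpolyX0 action_one mulmx1 meval1 scale1r.
  have [i mi] : exists i, (0 < m i)%N.
    apply/not_existsP => h; have : mdeg m = 0%N by rewrite mdegE big1 // => i _; have := h i; lia.
    by rewrite mk.
  have em : m = (U_(i) + (m - U_(i)))%MM.
    rewrite addmC submK //; apply/mnm_lepP => j; rewrite mnm1E.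
    by case: eqP => // <-.
  have mk' : mdeg (m - U_(i)) = k by have := congr1 mdeg em; rewrite mdegD mdeg1 mk add1n => -[].
  rewrite em mpolyXD -[k.+1]add1n actionM ?X_homog ?dhomogX /= ?mk' //.
  by rewrite mulmxA hq -scalemxAl IH // scalerA mevalM mevalXU.
have hH j H : H \is j.-homog -> w *m action j H = H.@[q] *: w.
  move=> hH; suff [] : H \is j.-homog /\ w *m action j H = H.@[q] *: w by [].
  elim/homog_ind: H / hH => [|c m p mj [hp IH]].
    split; first exact: dhomog0.
    rewrite meval0 scale0r (_ : action j 0 = 0) ?mulmx0 //.
    apply: action0 => [|p _]; first exact: dhomog0.
    by rewrite rmorph0 mul0r; apply: subspace0.
  have hm : 'X_[m] \is [in K[3], j.-homog] by rewrite dhomogX /= mj.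
  split; first by have [_ h] := homog_subspace K 3 j; apply: h.
  by rewrite actionD // mulmxDr -scalemxAr (hX j) // IH mevalD mevalZ scalerDl scalerA.
have lin_w (a : K) : a *: w = 0 -> a = 0.
  by move/eqP; rewrite scaler_eq0 (negPf w0) orbF => /eqP.
have eQ H : H.@[(\row_i q i) 0] = H.@[q] by apply: meval_eq => i; rewrite mxE.
exists w => //; split=> //; exists (\row_i q i) => [|j H hH']; last by rewrite eQ hH.
have [[hl _ _] _ _ _ _] := gl.
split=> [|| i]; rewrite ?eQ.
(* Were all eigenvalues 0, the linear form l would kill w although it acts as the identity. *)
- apply/eqP => /rowP Q0; have q0 i : q i = 0 by have := Q0 i; rewrite !mxE.
  have := hH 1%N l hl; rewrite action_line mulmx1 (meval_eq (v2 := fun i => 0 * q i)) => [|i]; last first.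
    by rewrite q0 mulr0.
  by rewrite (meval_homog _ _ hl) expr1 mul0r scale0r => w00; rewrite w00 eqxx in w0.
- by apply: lin_w; rewrite -(hH d) // actionF mulmx0.
- by apply: lin_w; rewrite -(hH d.-1) ?mderiv_homog // action_grad mulmx0.
Qed.

(* The image of the action of such an [H0] is the localization at [P] of the
   module of finite length on which the forms act. *)
Definition killer (P : 'rV[K]_3) j (H0 : S) : Prop :=
  [/\ H0 \is j.-homog, H0.@[P 0] != 0 & forall i H (v : 'rV_delta), H \is i.-homog -> H.@[P 0] != 0 ->
     v *m action i H = 0 -> v *m action j H0 = 0].

(** Choose H0 of minimal rank among the actions of forms not vanishing at P. For another such H, the
    product H0 H has the same rank and thus the same kernel as H0, and this kernel contains that of
    H. *)
Lemma killer_exists P : exists j H0, killer P j H0.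
Proof.
pose R r := `[< exists j H, [/\ H \is j.-homog, H.@[P 0] != 0 & \rank (action j H) = r] >].
have R0 : exists r, R r.
  exists (\rank (action 0 1)); apply/asboolP; exists 0%N, 1; split=> //; first exact: dhomog1.
  by rewrite meval1 oner_neq0.
case: (ex_minnP R0) => r /asboolP[j [H0 [hH0 H0P rk]]] minr.
exists j, H0; split=> // i H v hH HP vH.
have rkM : \rank (action j H0 *m action i H) = r.
  apply/eqP; rewrite eqn_leq -{1}rk mxrankM_maxl minr //; apply/asboolP.
  exists (j + i)%N, (H0 * H); rewrite -actionM //; split=> //; first exact: dhomogM.
  by rewrite mevalM mulf_neq0.
have sub : (kermx (action j H0) <= kermx (action j H0 *m action i H))%MS.
  by apply/sub_kermxP; rewrite mulmxA mulmx_ker mul0mx.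
have sub' : (kermx (action j H0 *m action i H) <= kermx (action j H0))%MS.
  by rewrite -(geq_leqif (mxrank_leqif_sup sub)) !mxrank_ker rkM rk.
apply/sub_kermxP; apply: submx_trans sub'; apply/sub_kermxP.
by rewrite actionC // mulmxA vH mul0mx.
Qed.

Lemma killer_inj P j H0 i H (v : 'rV_delta) : killer P j H0 -> H \is i.-homog -> H.@[P 0] != 0 ->
  v *m action j H0 *m action i H = 0 -> v *m action j H0 = 0.
Proof.
case=> hH0 H0P kill hH HP vHH; apply: (kill (j + i)%N (H0 * H)).
- exact: dhomogM.
- by rewrite mevalM mulf_neq0.
- by rewrite actionM // mulmxA.
Qed.

Lemma proj_eq_of_forms (P R : 'rV[K]_3) : P != 0 -> R != 0 ->
  (forall H : S, H \is 1.-homog -> H.@[P 0] != 0 -> H.@[R 0] != 0) -> proj_eq P R.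
Proof.
move=> P0 R0 h.
have [a Ra] : exists a, R 0 a != 0.
  by apply/not_existsP => z; case/eqP: R0; apply/rowP => i; rewrite mxE; apply/eqP/negPn/negP/z.
have PR b : P 0 b = P 0 a / R 0 a * R 0 b.
  pose H : S := R 0 a *: 'X_b - R 0 b *: 'X_a.
  have hH : H \is 1.-homog.
    by apply: (subspaceB (homog_subspace K 3 1)); apply: dhomogZ; apply: X_homog.
  have HE (V : 'rV[K]_3) : H.@[V 0] = R 0 a * V 0 b - R 0 b * V 0 a.
    by rewrite mevalB !mevalZ !mevalXU.
  have : H.@[P 0] == 0.
    by apply: contraT => /(h H hH); rewrite HE mulrC subrr eqxx.
  rewrite HE subr_eq0 => /eqP PE; apply: (mulfI Ra); rewrite PE; field.
  exact: Ra.
exists (P 0 a / R 0 a); last by apply/rowP => b; rewrite mxE; apply: PR.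
apply: contra P0 => /eqP z; apply/eqP/rowP => b.
by rewrite PR z mul0r mxE.
Qed.

(** On the image of H0 the forms not vanishing at P act injectively, so none of them can have
    eigenvalue 0, its value at R, on w. *)
Lemma eigen_at_point (P : 'rV[K]_3) j H0 (w : 'rV_delta) (R : 'rV[K]_3) u :
  killer P j H0 -> P != 0 -> R != 0 -> w != 0 -> w = u *m action j H0 ->
  (forall i H, H \is i.-homog -> w *m action i H = H.@[R 0] *: w) -> proj_eq P R.
Proof.
move=> kP P0 R0 w0 ew hw; apply: proj_eq_of_forms => // H hH HP.
apply: contra w0 => /eqP HR; rewrite ew; apply/eqP.
by apply: (killer_inj kP hH HP); rewrite -ew hw // HR scale0r.
Qed.

(** The image of the product is stable; an eigenvector in it would lie in both localizations, and
    its point would be both P and Q. *)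
Lemma killer_orth P Q j i H G : P != 0 -> Q != 0 -> ~ proj_eq P Q ->
  killer P j H -> killer Q i G -> action j H *m action i G = 0.
Proof.
move=> P0 Q0 PQ kP kQ; have [hH _ _] := kP; have [hG _ _] := kQ.
apply/eqP/negPn/negP => U0.
have [|w w0 [/submxP[u ew] [R [R0 _ _] hR]]] := eigen_singular U0.
  move=> k L hL; rewrite -mulmxA (actionC hG hL) mulmxA (actionC hH hL) -mulmxA.
  exact: submxMl.
have [c c0 eP] : proj_eq P R.
  apply: (eigen_at_point (u := u *m action i G) kP P0 R0 w0) hR.
  by rewrite ew -mulmxA actionC.
have [c' c'0 eQ] : proj_eq Q R.
  apply: (eigen_at_point (u := u *m action j H) kQ Q0 R0 w0) hR.
  by rewrite ew mulmxA.
apply: PQ; exists (c / c'); first by rewrite mulf_neq0 ?invr_eq0.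
by rewrite eP eQ scalerA divfK.
Qed.

(** The images are independent by orthogonality. They fill the space because the sum [T] is
    injective: its kernel is stable, and an eigenvector in it would belong to some P i, where [A i]
    acts by a nonzero scalar. *)
Lemma sum_rank_killers k (P : 'I_k -> 'rV[K]_3) (j : 'I_k -> nat) (H : 'I_k -> S) :
  (forall i, P i != 0) -> (forall i i', proj_eq (P i) (P i') -> i = i') ->
  (forall Q, singular_point F Q -> exists i, proj_eq Q (P i)) ->
  (forall i, killer (P i) (j i) (H i)) ->
  delta = (\sum_i \rank (action (j i) (H i)))%N.
Proof.
move=> P0 Pdist Psing kP; pose A i := action (j i) (H i).
have orth i i' : i != i' -> A i *m A i' = 0.
  move=> ne; apply: (killer_orth (P0 i) (P0 i') _ (kP i) (kP i')) => /Pdist ii.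
  by rewrite ii eqxx in ne.
have hH i : H i \is (j i).-homog by case: (kP i).
have AA i (v : 'rV_delta) : v *m A i *m A i = 0 -> v *m A i = 0.
  by have [h hP _] := kP i; apply: killer_inj (kP i) h hP.
pose T := \sum_i A i.
have TA i : T *m A i = A i *m A i.
  rewrite /T mulmx_suml (bigD1 i) //= big1 ?addr0 // => i' ne.
  exact: orth.
have freeT : row_free T.
  rewrite -kermx_eq0; apply/negPn/negP => U0.
  have [|w w0 [/sub_kermxP wT [Q singQ hQ]]] := eigen_singular U0.
    move=> n G hG; apply/sub_kermxP.
    rewrite -mulmxA; have -> : action n G *m T = T *m action n G.
      rewrite /T mulmx_suml mulmx_sumr; apply: eq_bigr => i _.
      exact: actionC.
    by rewrite mulmxA mulmx_ker mul0mx.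
  have [i [c c0 eQ]] := Psing Q singQ; have [_ HP _] := kP i.
  have HQ : (H i).@[Q 0] != 0.
    have -> : (H i).@[Q 0] = c ^+ j i * (H i).@[P i 0].
      by rewrite -(meval_homog _ _ (hH i)); apply: meval_eq => a; rewrite eQ mxE.
    by rewrite mulf_neq0 // expf_neq0.
  have : w *m A i *m A i = 0 by rewrite -mulmxA -TA mulmxA wT mul0mx.
  rewrite /A hQ // -scalemxAl hQ // scalerA => /eqP.
  by rewrite scaler_eq0 mulf_eq0 (negPf HQ) (negPf w0).
have dir : mxdirect (\sum_i A i)%MS.
  apply/mxdirect_sumsP => i _; apply/eqP/rowV0P => v.
  rewrite sub_capmx => /andP[/submxP[u ->] /sub_sumsmxP[b ub]].
  apply: AA; rewrite ub mulmx_suml big1 // => i' /andP[_ ne].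
  by rewrite -mulmxA orth // mulmx0.
have full : (\rank (\sum_i A i)%MS = delta)%N.
  apply/eqP; rewrite eqn_leq rank_leq_col /=; move/eqP: freeT => {1}<-.
  apply: mxrankS; rewrite /T; apply: summx_sub => i _; exact: (sumsmx_sup i).
by rewrite -[LHS]full; apply/mxdirectP.
Qed.

(* The quotient is the image of [action j H0]: a fraction [p / H] corresponds to
   the vector [v *m action j H0], for [v] the coordinates of [p], divided by the
   action of [H], which is invertible on that image. *)
Lemma local_delta (P : 'rV[K]_3) j H0 : P != 0 -> F.@[P 0] = 0 -> killer P j H0 ->
  has_local_delta F P (\rank (action j H0)).
Proof.
move=> P0 FP kP; have [hH0 H0P kill] := kP; set A := action j H0; pose B := row_base A.
have [a Pa] : exists a, P 0 a != 0.
  by apply/not_existsP => z; case/eqP: P0; apply/rowP => i; rewrite mxE; apply/eqP/negPn/negP/z.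
pose L : S := 'X_a ^+ k0.
have hL : L \is k0.-homog by have := dhomogMn k0 (X_homog K a); rewrite mul1n.
have LP : L.@[P 0] != 0 by rewrite rmorphXn /= mevalXU expf_neq0.
have evL := ev_denominator rc FP hL LP.
have [U BU] : exists U, B = U *m A by apply/submxP; rewrite eq_row_base.
(* The numerator over L of the fraction with coordinates c: dividing c U L by L and localizing by A
   gives c U A = c B. *)
pose M1 := U *m action k0 L; pose q c := lin e (c *m M1).
have qrel c : rel k0 (q c) (c *m M1) := rel_lin _.
have qdeg c : deg_le (k0 * d) (q c) := lin_deg _.
have /fin_all_exists[x hx] : forall i, exists x,
    residue f x (tofrac (lin e (row i M1)) / tofrac (ev f L)).
  by move=> i; apply: (residue_lift rc (lin_deg _) hL evL).
have comb (c : 'rV_(\rank A)) : residue f (\sum_i tofrac (c 0 i)%:MP * x i) (tofrac (q c) / tofrac (ev f L)).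
  rewrite /q lin_mul {2}/lin rmorph_sum mulr_suml; apply: residue_sum => i.
  rewrite /= -mul_polyC tofracM -mulrA; apply: residueM (hx i).
  exact: residueC.
have commU (v : 'rV_delta) i H : H \is i.-homog -> v *m action i H *m A = v *m A *m action i H.
  by move=> hH; rewrite -!mulmxA (actionC hH hH0).
have commB (c : 'rV_(\rank A)) i H : H \is i.-homog -> c *m B *m action i H = c *m U *m action i H *m A.
  by move=> hH; rewrite commU // BU !mulmxA.
have Binj (c : 'rV_(\rank A)) i H : H \is i.-homog -> H.@[P 0] != 0 ->
    c *m (B *m action i H) = 0 -> c = 0.
  move=> hH HP; rewrite mulmxA BU mulmxA => /(killer_inj kP hH HP) /eqP.
  by rewrite -mulmxA -BU mulmx_free_eq0 ?row_base_free // => /eqP.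
exists x; split=> [i|y /(in_normalizationP rc FP)[k [p [H [hp hH HP rx]]]]].
  apply/(in_normalizationP rc FP); exists k0, (lin e (row i M1)), L; split=> //.
  exact: lin_deg.
have H0' := ev_denominator rc FP hH HP.
have [v hv] := rel_ex hp.
have crit (c : 'rV_(\rank A)) : in_local_ring F P (y - \sum_i tofrac (c 0 i)%:MP * x i) <->
    v *m A = c *m B *m action k H.
  (* The numerator of the difference over the common denominator H L; its regularity at P is the
     vanishing of its coordinates after the action of H0. *)
  pose p2 := -1 *: (ev f H * q c) + ev f L * p.
  have hp2 : deg_le ((k + k0) * d) p2.
    rewrite /p2 mulnDl; have [_ cl] := deg_le_subspace K (k * d + k0 * d); apply: cl.
      by apply: deg_le_mul => //; apply: ev_deg_le.
    by rewrite addnC; apply: deg_le_mul => //; apply: ev_deg_le.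
  have r2 : rel (k + k0) p2 (-1 *: (c *m M1 *m action k H) + v *m action k0 L).
    by apply: relP; [|rewrite addnC]; apply: actionP.
  have rx2 : residue f (y - \sum_i tofrac (c 0 i)%:MP * x i) (tofrac p2 / tofrac (ev f (H * L))).
    have -> : tofrac p2 / tofrac (ev f (H * L)) = tofrac p / tofrac (ev f H) - tofrac (q c) / tofrac (ev f L).
      rewrite -mulNr addf_div ?tofrac_eq0 // rmorphM /= tofracM; congr (_ / _).
      by rewrite -!tofracM -tofracN -tofracM -tofracD; congr tofrac; rewrite /p2 scaleN1r; ring.
    exact: residueB rx (comb c).
  have HLP : (H * L).@[P 0] != 0 by rewrite mevalM mulf_neq0.
  rewrite (in_local_ring_section rc FP hp2 (dhomogM hH hL) HLP rx2).
  set w := _ + _ in r2.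
  have wA : w *m A = (v *m A - c *m B *m action k H) *m action k0 L.
    rewrite /w !mulmxDl mulNmx -scalemxAl scaleN1r addrC commU // commB //; congr (_ - _).
    rewrite /M1 mulmxA -(commU _ _ _ hL); congr (_ *m A).
    by rewrite -!mulmxA (actionC hL hH).
  split=> [[i [G [hG GP sG]]]|e1].
    have /(kill _ _ _ hG GP) : w *m action i G = 0.
      by apply: rel_section sG _; apply: actionP.
    rewrite -/A wA commB // -mulmxBl => /(killer_inj kP hL LP).
    by rewrite mulmxBl => /eqP; rewrite subr_eq0 -commB // => /eqP.
  exists j, H0; split=> //; apply/rel0; first by rewrite mulnDl; apply: deg_le_mul => //; apply: ev_deg_le.
  have := actionP hH0 hp2 r2; rewrite -/A wA e1 subrr mul0mx.
  exact.
have ffunE' (c : {ffun 'I_(\rank A) -> K}) :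
    \sum_i tofrac (c i)%:MP * x i = \sum_i tofrac ((\row_i c i) 0 i)%:MP * x i.
  by apply: eq_bigr => i _; rewrite mxE.
(* H acts bijectively on the image of A, so the rows of B times its action still span this image. *)
have [c hc] : exists c, v *m A = c *m (B *m action k H).
  apply/submxP; apply: submx_trans (submxMl v A) _.
  have free : row_free (B *m action k H) by apply: inj_row_free => c; apply: Binj.
  have sub : (B *m action k H <= A)%MS.
    by rewrite BU -mulmxA -(actionC hH hH0) mulmxA submxMl.
  by rewrite -(geq_leqif (mxrank_leqif_sup sub)) (eqP free).
have rowE (c' : {ffun 'I_(\rank A) -> K}) :
    in_local_ring F P (y - \sum_i tofrac (c' i)%:MP * x i) -> \row_i c' i = c.
  rewrite ffunE' => /crit; rewrite hc -mulmxA => /eqP; rewrite -subr_eq0 -mulmxBl => /eqP.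
  by move/(Binj _ _ _ hH HP)/eqP; rewrite subr_eq0 => /eqP.
exists [ffun i => c 0 i]; split.
  rewrite ffunE'; apply/crit; rewrite -mulmxA hc; congr (_ *m _).
  by apply/rowP => i; rewrite mxE ffunE.
by move=> c' /rowE <-; apply/ffunP => i; rewrite ffunE mxE.
Qed.

Lemma delta_invariant : has_delta F delta.
Proof.
have [n [P [Psing Pdist Pall]]] := singular_points_finite rc.
have /fin_all_exists[jH kP] : forall i, exists jH : nat * S, killer (P i) jH.1 jH.2.
  by move=> i; have [j [H kH]] := killer_exists (P i); exists (j, H).
exists n, P, (fun i => \rank (action (jH i).1 (jH i).2)); split=> // [i|].
  by have [P0 FP _] := Psing i; apply: local_delta.
apply: (@sum_rank_killers n P (fun i => (jH i).1) (fun i => (jH i).2)) => // i.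
by have [] := Psing i.
Qed.

End Action.
Lemma delta_curve : has_delta F delta.
Proof.
have [l [M [N [rs gl]]]] := good_line_exists rc (oner_neq0 _).
have [|e [e_deg e_gen e_ind]] := qdim_coker0 rc (k := d - 2); first by lia.
exact: (delta_invariant gl e_deg e_gen e_ind).
Qed.

End Curve.

(** * From homogeneous to affine parametrizations *)

Section Dehomogenization.
Variable K : numClosedFieldType.
Local Notation R := {mpoly K[2]}.

Definition dehom : R -> {poly K} := ev (pair2 'X 1).
HB.instance Definition _ := GRing.RMorphism.copy dehom (ev (pair2 'X 1)).
HB.instance Definition _ := GRing.Linear.copy dehom (ev (pair2 'X 1)).

Definition rehom n (p : {poly K}) : R := \sum_(i < n.+1) p`_i *: ('X_0 ^+ i * 'X_1 ^+ (n - i)).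

Lemma sum2 (V : nmodType) (G : 'I_2 -> V) : \sum_i G i = G 0 + G 1.
Proof. by rewrite !big_ord_recl big_ord0 addr0; congr (_ + G _); apply: val_inj. Qed.

Lemma dehomX0 : dehom 'X_0 = 'X. Proof. by rewrite /dehom evX. Qed.
Lemma dehomX1 : dehom 'X_1 = 1. Proof. by rewrite /dehom evX. Qed.

Lemma deg_pair2 i : deg_le 1 (pair2 'X 1 i : {poly K}).
Proof. by rewrite /pair2 /deg_le; case: ifP => _; rewrite ?size_polyX ?size_poly1. Qed.

Lemma dehom_deg n p : p \is n.-homog -> deg_le n (dehom p).
Proof. by move=> hp; have := ev_deg_le deg_pair2 hp; rewrite muln1. Qed.

Lemma X2_homog (i : 'I_2) : ('X_i : R) \is 1.-homog.
Proof. by rewrite dhomogX /= mdeg1. Qed.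

Lemma rehom_homog n p : rehom n p \is n.-homog.
Proof.
apply: (subspace_sum (homog_subspace K 2 n)) => i _; apply: dhomogZ.
have := dhomogM (dhomogMn i (X2_homog 0)) (dhomogMn (n - i) (X2_homog 1)).
by rewrite !mul1n subnKC // -ltnS.
Qed.

Lemma rehomK n p : deg_le n p -> dehom (rehom n p) = p.
Proof.
move=> hp; rewrite -[RHS]coefK poly_def (big_ord_widen n.+1 (fun i => p`_i *: 'X^i) hp).
rewrite raddf_sum [RHS]big_mkcond; apply: eq_bigr => i _ /=.
rewrite linearZ /= rmorphM !rmorphXn /= dehomX0 dehomX1 expr1n mulr1.
by case: ltnP => // /(nth_default 0) ->; rewrite scale0r.
Qed.

Lemma dehomK n p : p \is n.-homog -> rehom n (dehom p) = p.
Proof.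
move=> hp; suff [] : p \is n.-homog /\ rehom n (dehom p) = p by [].
elim/homog_ind: p / hp => [|c m p mn [hp IH]].
  split; first exact: dhomog0.
  by rewrite rmorph0 /rehom big1 // => i _; rewrite coef0 scale0r.
have hm : 'X_[m] \is [in K[2], n.-homog] by rewrite dhomogX /= mn.
split; first by have [_ h] := homog_subspace K 2 n; apply: h.
pose i0 : 'I_2 := 0; pose i1 : 'I_2 := 1.
have e : dehom 'X_[m] = 'X^(m i0) by rewrite /dehom evXm big_ord_recl big_ord1 /pair2 /= expr1n mulr1.
rewrite linearP /= e -{2}IH /rehom.
have -> : 'X_[m] = \sum_(i < n.+1) ('X^(m i0) : {poly K})`_i *: ('X_0 ^+ i * 'X_1 ^+ (n - i)) :> R.
  have m0 : (m i0 < n.+1)%N by rewrite -mn mdegE sum2 ltnS leq_addr.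
  rewrite (bigD1 (Ordinal m0)) //= coefXn eqxx scale1r big1 ?addr0 => [|i ne]; last first.
    by rewrite coefXn -[(i == _ :> nat)]/(i == Ordinal m0) (negPf ne) scale0r.
  have -> : (n - m i0 = m i1)%N by rewrite -mn mdegE sum2 addKn.
  rewrite mpolyXE_id !big_ord_recl big_ord0 mulr1.
  by have -> : lift ord0 ord0 = i1 by apply: val_inj.
rewrite scaler_sumr -big_split; apply: eq_bigr => i _ /=.
by rewrite coefD coefZ scalerDl scalerA.
Qed.

Lemma dehom_inj n p q : p \is n.-homog -> q \is n.-homog -> dehom p = dehom q -> p = q.
Proof. by move=> hp hq e; rewrite -(dehomK hp) e dehomK. Qed.

Lemma horner_dehom a p : (dehom p).[a] = p.@[pair2 a 1].
Proof.
rewrite horner_ev; apply: meval_eq => i; rewrite /pair2.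
by case: ifP; rewrite ?hornerX ?hornerC.
Qed.

Lemma coef_dehom n p : p \is n.-homog -> (dehom p)`_n = p.@[pair2 1 0].
Proof.
move=> hp; have := ev_top deg_pair2 hp; rewrite muln1 => ->; apply: meval_eq => i.
by rewrite /pair2; case: ifP; rewrite ?coefX ?coef1.
Qed.

Lemma dehom_d0 p : dehom p^`M(0) = (dehom p)^`().
Proof.
by rewrite [RHS]deriv_ev sum2 /pair2 /= derivX derivC mulr1 mulr0 addr0.
Qed.

Lemma dehom_d1 n p : p \is n.-homog -> dehom p^`M(1) = n%:R *: dehom p - 'X * (dehom p)^`().
Proof.
move=> /euler/(congr1 dehom); rewrite linearZ sum2 rmorphD !rmorphM /= dehomX0 dehomX1.
by rewrite dehom_d0 mul1r => <-; rewrite addrC addKr.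
Qed.

End Dehomogenization.

Section Parametrization.
Variables (K : numClosedFieldType) (d : nat) (f : 3.-tuple {mpoly K[2]}) (F : {mpoly K[3]}).
Hypothesis d3 : (3 <= d)%N.
Hypothesis f_homog : forall i, tnth f i \is d.-homog.
Local Notation R := {mpoly K[2]}.
Local Notation S := {mpoly K[3]}.

Definition affine_param (i : 'I_3) : {poly K} := dehom (tnth f i).
Local Notation g := affine_param.
Local Notation pt a b := (\row_i pair2 a b i : 'rV[K]_2).

Lemma affine_param_deg i : deg_le d (g i).
Proof. exact: dehom_deg. Qed.

Lemma param_affine a i : param f (pt a 1) 0 i = (g i).[a].
Proof. by rewrite mxE /g horner_dehom; apply: meval_eq => j; rewrite mxE. Qed.

Lemma param_inf i : param f (pt 1 0) 0 i = (g i)`_d.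
Proof. by rewrite mxE /g (coef_dehom (f_homog i)); apply: meval_eq => j; rewrite mxE. Qed.

Lemma paramZ c u i : param f (c *: u) 0 i = c ^+ d * param f u 0 i.
Proof.
by rewrite !mxE -(meval_homog c (u 0) (f_homog i)); apply: meval_eq => j; rewrite mxE.
Qed.

Lemma point2P (u : 'rV[K]_2) : u != 0 -> exists2 c, c != 0 & (exists a, u = c *: pt a 1) \/ u = c *: pt 1 0.
Proof.
move=> u0; have [u1|u1] := eqVneq (u 0 1) 0; last first.
  exists (u 0 1) => //; left; exists (u 0 0 / u 0 1); apply/rowP => i; rewrite !mxE /pair2.
  have [->|i0] := eqVneq i 0; first by rewrite mulrC divfK.
  by rewrite mulr1; congr (u 0 _); apply: val_inj; case: i i0 => -[|[|]].
have e i : u 0 i = u 0 0 * pair2 1 0 i.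
  rewrite /pair2; have [->|i0] := eqVneq i 0; first by rewrite mulr1.
  by rewrite mulr0 -u1; congr (u 0 _); apply: val_inj; case: i i0 => -[|[|]].
exists (u 0 0); last by right; apply/rowP => i; rewrite !mxE e.
by apply: contra u0 => /eqP z; apply/eqP/rowP => i; rewrite e z mul0r mxE.
Qed.

Lemma pt_affine_neq0 a : pt a 1 != 0.
Proof.
by apply/eqP => /rowP/(_ 1)/eqP; rewrite !mxE /pair2 /= oner_eq0.
Qed.

Lemma meval_param k G u : G \is k.-homog -> ev g G = 0 -> u != 0 -> G.@[param f u 0] = 0.
Proof.
move=> hG G0 /point2P[c c0 [[a ->]|->]].
  rewrite (meval_eq (v2 := fun i => c ^+ d * (g i).[a])) => [|i]; last by rewrite paramZ param_affine.
  by rewrite (meval_homog _ _ hG) -horner_ev G0 horner0 mulr0.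
rewrite (meval_eq (v2 := fun i => c ^+ d * (g i)`_d)) => [|i]; last by rewrite paramZ param_inf.
by rewrite (meval_homog _ _ hG) -(ev_top affine_param_deg hG) G0 coef0 mulr0.
Qed.

Lemma linear_not_unit (L : R) : L \is 1.-homog -> L \isn't a GRing.unit.
Proof.
move=> hL; apply/negP => /mulVr/(congr1 (meval (fun=> 0))).
rewrite rmorphM rmorph1 /= [L.@[_]](meval_eq (v2 := fun=> 0 * 0)) => [|i]; last by rewrite mulr0.
by rewrite (meval_homog _ _ hL) mul0r mulr0 => /esym/eqP; rewrite oner_eq0.
Qed.

Hypothesis f_gcd : gcd_one f.

(** A common zero a would make the non-unit s - a t a common factor of the homogeneous
    parametrization. *)
Lemma affine_base a : exists i, (g i).[a] != 0.
Proof.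
apply/not_existsP => h; pose L : R := 'X_0 - a *: 'X_1.
have hL : L \is 1.-homog.
  by apply: (subspaceB (homog_subspace K 2 1)); rewrite ?dhomogZ ?X2_homog.
have := linear_not_unit hL; rewrite f_gcd // => i.
have /factor_theorem[q eq] : root (g i) a by apply/negPn/negP/h.
have hq : deg_le d.-1 q.
  have := affine_param_deg i; rewrite eq /deg_le; have [->|q0] := eqVneq q 0; first by rewrite size_poly0.
  by rewrite size_Mmonic ?monicXsubC // size_XsubC addn2 /=; move: (size _) => s; lia.
exists (rehom d.-1 q); apply: (dehom_inj (f_homog i)).
  by have := dhomogM (rehom_homog d.-1 q) hL; rewrite addn1 prednK //; lia.
by rewrite rmorphM /= rehomK // rmorphB /= linearZ /= dehomX0 dehomX1 -/(g i) eq alg_polyC.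
Qed.

Lemma affine_base_inf : exists i, (g i)`_d != 0.
Proof.
apply/not_existsP => h; have := linear_not_unit (X2_homog K 1); rewrite f_gcd // => i.
have hq : deg_le d.-1 (g i).
  apply/deg_le_coef => j jd; have [->|dj] := eqVneq j d; first by apply/eqP/negPn/negP/h.
  by have /deg_le_coef := affine_param_deg i; apply; lia.
exists (rehom d.-1 (g i)); apply: (dehom_inj (f_homog i)).
  by have := dhomogM (rehom_homog d.-1 (g i)) (X2_homog K 1); rewrite addn1 prednK //; lia.
by rewrite rmorphM /= rehomK // dehomX1 mulr1.
Qed.

Hypothesis f_generic : generically_one_to_one f.

(** The open set of the curve is pulled back to the parameter line; the pulled back form is nonzero
    because the open set meets the image. *)
Lemma affine_generic : exists2 Psi : {poly K}, Psi != 0 & forall a b c, Psi.[a] != 0 ->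
  (forall i, (g i).[a] = c * (g i).[b]) -> a = b.
Proof.
have [k [G [hG [P [u u0 [c c0 ->]] GP] inj]]] := f_generic.
exists (ev g G) => [|a b e Ga hab].
  apply: contraNneq GP => G0.
  rewrite (meval_eq (v2 := fun i => c * param f u 0 i)) => [|i]; last by rewrite mxE.
  by rewrite (meval_homog _ _ hG) (meval_param hG G0 u0) mulr0.
have e0 : e != 0.
  case: (affine_base a) => i; apply: contraNneq => e0.
  by rewrite hab e0 mul0r.
have [|| x x0 /rowP ex] := inj (pt a 1) (pt b 1) (pt_affine_neq0 a) (pt_affine_neq0 b).
- by exists e => //; apply/rowP => i; rewrite [RHS]mxE !param_affine.
- rewrite (meval_eq (v2 := fun i => (g i).[a])) => [|i]; last exact: param_affine.
  by rewrite -horner_ev.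
have x1 : x = 1 by have := ex 1; rewrite !mxE /pair2 /= mulr1.
by have := ex 0; rewrite !mxE /pair2 /= x1 mul1r.
Qed.

Hypothesis F_homog : F \is d.-homog.
Hypothesis F_def : defining_equation f F.

Lemma affine_rational_curve : rational_curve d g F.
Proof.
split=> //; [exact: affine_param_deg | exact: affine_base | exact: affine_base_inf | exact: affine_generic |].
move=> k G hG; rewrite F_def; split=> [G0 P [u u0 [c c0 ->]]|h].
  rewrite (meval_eq (v2 := fun i => c * param f u 0 i)) => [|i]; last by rewrite mxE.
  by rewrite (meval_homog _ _ hG) (meval_param hG G0 u0) mulr0.
apply/eqP/negPn/negP => /closed_nonrootP[a]; rewrite /root horner_ev => /eqP; apply.
rewrite -[RHS](h (param f (pt a 1))); last first.
  by exists (pt a 1); [exact: pt_affine_neq0 | exists 1; rewrite ?oner_neq0 ?scale1r].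
by apply: meval_eq => i; rewrite param_affine.
Qed.

End Parametrization.

(** * Differential forms *)

Section Indices.

Definition incr0 n : incr n 0 := exist _ [tuple] isT.
Definition incr1 n (i : 'I_n) : incr n 1 := exist _ [tuple i] isT.
(** Pairs are labelled by the missing index, to match the entries of [jac]. *)
Definition coincr (i : 'I_3) : incr 3 2 :=
  triple (exist _ [tuple o1; o2] isT) (exist _ [tuple o0; o2] isT)
         (exist _ [tuple o0; o1] isT) i.
Definition incr2 : incr 2 2 := exist _ [tuple ord0; ord_max] isT.

Lemma incr0P n (I : incr n 0) : I = incr0 n.
Proof. by apply: val_inj; apply: tuple0. Qed.

Lemma incr1P n (I : incr n 1) : exists i, I = incr1 i.
Proof.
case: I => -[[|a [|b s]] // ht] hs; exists a.
by apply: val_inj; apply: val_inj.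
Qed.

Lemma coincrP (I : incr 3 2) : exists i, I = coincr i.
Proof.
case: I => -[[|a [|b [|c s]]] // ht] /= hs.
suff [i hi] : exists i, tval (val (coincr i)) = [:: a; b].
  by exists i; apply: val_inj; apply: val_inj.
move: a b {ht} hs; apply: ord3P; apply: ord3P => //= _;
  by [exists o0 | exists o1 | exists o2].
Qed.

Lemma incr2P (I : incr 2 2) : I = incr2.
Proof.
case: I => -[[|a [|b [|c s]]] // ht] /= hs; apply: val_inj; apply: val_inj => /=.
move: hs; rewrite andbT => ab; have := ltn_ord b; have := ltn_ord a => ha hb.
have -> : a = ord0 by apply: val_inj => /=; lia.
by have -> : b = ord_max by apply: val_inj => /=; lia.
Qed.

Lemma sum_incr0 (V : nmodType) n (G : incr n 0 -> V) : \sum_I G I = G (incr0 n).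
Proof. by rewrite (bigD1 (incr0 n)) //= big1 ?addr0 // => I; rewrite (incr0P I) eqxx. Qed.

Lemma sum_incr1 (V : nmodType) n (G : incr n 1 -> V) : \sum_I G I = \sum_i G (incr1 i).
Proof.
rewrite (reindex (@incr1 n)) //; exists (fun I : incr n 1 => tnth (val I) ord0) => // I _.
by have [i ->] := incr1P I.
Qed.

Lemma sum_coincr (V : nmodType) (G : incr 3 2 -> V) : \sum_I G I = \sum_i G (coincr i).
Proof.
rewrite (reindex coincr) //.
pose h (I : incr 3 2) := let t := tval (val I) in
  if t == [:: o1; o2] then o0 else if t == [:: o0; o2] then o1 else o2.
have hK i : h (coincr i) = i by move: i; apply: ord3P.
by exists h => [i _|I _]; [exact: hK | have [i ->] := coincrP I; rewrite hK].
Qed.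

End Indices.

Lemma det_mx22 (R : comPzRingType) (A : 'M[R]_2) :
  \det A = A ord0 ord0 * A ord_max ord_max - A ord0 ord_max * A ord_max ord0.
Proof.
rewrite (expand_det_row _ ord0) !big_ord_recl big_ord0 addr0 /cofactor !det_mx11 !mxE /=.
have -> : lift ord0 ord0 = ord_max :> 'I_2 by apply: val_inj.
have -> : lift ord_max (0 : 'I_1) = ord0 :> 'I_2 by apply: val_inj.
by rewrite expr0 expr1; ring.
Qed.

Section Forms.
Variables (K : numClosedFieldType) (d : nat) (f : 3.-tuple {mpoly K[2]}).
Hypothesis d3 : (3 <= d)%N.
Hypothesis f_homog : forall i, tnth f i \is d.-homog.
Local Notation R := {mpoly K[2]}.
Local Notation S := {mpoly K[3]}.
Local Notation g := (affine_param f).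
Local Notation form := (Defs.form K).
Local Notation minor I J := (\det (\matrix_(a, b)
  (tnth f (tnth (val I) a))^`M(tnth (val J) b))).

Lemma homog_formP n j q (w : form n j) : homog_form q w <-> forall I, shom j q (w I).
Proof. by rewrite /homog_form /shom; case: (j <= q)%N. Qed.

Lemma homog_form_subspace n j q : subspace (V := {ffun incr n j -> {mpoly K[n]}}) (fun w => homog_form q w).
Proof.
split; first by apply/homog_formP => I; rewrite ffunE; apply: subspace0 (shom_subspace K n j q).
move=> c u v /homog_formP hu /homog_formP hv; apply/homog_formP => I; rewrite !ffunE.
by have [_ h] := shom_subspace K n j q; apply: h.
Qed.

Lemma pullbackP j c (u v : form 3 j) : pullback f (c *: u + v) = c *: pullback f u + pullback f v.
Proof.
apply/ffunP => J; rewrite !ffunE scaler_sumr -big_split; apply: eq_bigr => I _ /=.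
by rewrite !ffunE comp_mpolyD comp_mpolyZ mulrDl scalerAl.
Qed.

Lemma pullback_subspace j q : subspace (V := {ffun incr 2 j -> R})
  (fun w => exists2 v : form 3 j, homog_form q v & w = pullback f v).
Proof.
have [h0 hP] := homog_form_subspace 3 j q; split.
  exists 0 => //; apply/ffunP => J; rewrite !ffunE big1 // => I _.
  by rewrite ffunE comp_mpoly0 mul0r.
move=> c _ _ [u hu ->] [v hv ->]; exists (c *: u + v); first exact: hP.
by rewrite pullbackP.
Qed.

Lemma pullback_homog j q (v : form 3 j) : homog_form q v -> homog_form (q * d) (pullback f v).
Proof.
move=> /homog_formP hv; apply/homog_formP => J; rewrite ffunE.
apply: (subspace_sum (shom_subspace K 2 j (q * d))) => I _.
have := hv I; rewrite /shom; case: ifP => [jq hI|_ /eqP ->]; last first.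
  by rewrite comp_mpoly0 mul0r; case: ifP; rewrite ?dhomog0.
have jqd : (j <= q * d)%N by apply: leq_trans jq _; apply: leq_pmulr; lia.
have hdet : minor I J \is (j * d.-1).-homog.
  by apply: det_homog => a b; rewrite mxE; apply: mderiv_homog.
have := dhomogM (comp_homogM f_homog hI) hdet.
rewrite jqd; have -> // : ((q - j) * d + j * d.-1 = q * d - j)%N.
have [m ->] : exists m, q = (j + m)%N by exists (q - j)%N; lia.
by case: d d3 => // d' _ /=; rewrite addKn; nia.
Qed.

Lemma dehom_pullback j (v : form 3 j) J :
  dehom (pullback f v J) = \sum_I ev g (v I) * dehom (minor I J).
Proof.
rewrite ffunE rmorph_sum; apply: eq_bigr => I _ /=; rewrite rmorphM; congr (_ * _).
exact: ev_comp.
Qed.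

Lemma form_eq j q (u v : form 2 j) : homog_form q u -> homog_form q v ->
  (forall J, dehom (u J) = dehom (v J)) -> u = v.
Proof.
move=> /homog_formP hu /homog_formP hv e; apply/ffunP => J; have := hu J; have := hv J; have := e J.
rewrite /shom; case: ifP => _ {}e; last by move=> /eqP -> /eqP ->.
by move=> hvJ huJ; exact: (dehom_inj huJ hvJ e).
Qed.

Lemma form_ex j q (p : incr 2 j -> {poly K}) : (j <= q)%N -> (forall J, deg_le (q - j) (p J)) ->
  exists2 w : form 2 j, homog_form q w & forall J, dehom (w J) = p J.
Proof.
move=> jq hp; exists [ffun J => rehom (q - j) (p J)] => [|J]; last by rewrite ffunE rehomK.
by apply/homog_formP => J; rewrite /shom jq ffunE rehom_homog.
Qed.

Lemma dehom_form_deg j q (w : form 2 j) J : (j <= q)%N -> homog_form q w -> deg_le (q - j) (dehom (w J)).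
Proof. by move=> jq /homog_formP/(_ J); rewrite /shom jq; apply: dehom_deg. Qed.

Lemma pullbackE j q (w : form 2 j) (v : form 3 j) : homog_form (q * d) w -> homog_form q v ->
  w = pullback f v <-> forall J, dehom (w J) = \sum_I ev g (v I) * dehom (minor I J).
Proof.
move=> hw hv; split=> [-> J|h]; first exact: dehom_pullback.
by apply: (form_eq hw (pullback_homog hv)) => J; rewrite dehom_pullback.
Qed.

Definition coord j (J : incr 2 j) (w : {ffun incr 2 j -> R}) : {poly K} := dehom (w J).

Lemma coord_linear j (J : incr 2 j) : linear (coord J).
Proof. by move=> c u v; rewrite /coord !ffunE linearP. Qed.
HB.instance Definition _ j J := GRing.isLinear.Build K {ffun incr 2 j -> R} {poly K} *:%R
  (coord J) (coord_linear J).

Lemma coker0_forms q n : qdim (deg_le (q * d)) (section g q) n -> has_dim_coker f d 0 q n.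
Proof.
move=> h; apply: (qdim_has (pullback_subspace 0 q)).
apply: (qdim_comap (f := coord (incr0 2)) (homog_form_subspace 2 0 (q * d)) (section_subspace g q) _ _ _ h).
- by move=> w hw; have := dehom_form_deg (incr0 2) (leq0n _) hw; rewrite subn0.
- move=> p hp; have [|w hw ew] := @form_ex 0 (q * d) (fun=> p) (leq0n _); first by rewrite subn0.
  by exists w => //; rewrite /= /coord ew subrr; apply: subspace0 (section_subspace g q).
move=> w hw; split=> [[v hv e]|[G hG e]].
  exists (v (incr0 3)); first by move/homog_formP: hv => /(_ (incr0 3)); rewrite /shom /= subn0.
  move/(pullbackE hw hv): e => /(_ (incr0 2)); rewrite sum_incr0 det_mx00 rmorph1 mulr1.
  exact.
exists [ffun=> G]; first by apply/homog_formP => I; rewrite ffunE /shom /= subn0.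
apply/(pullbackE hw) => [|J]; first by apply/homog_formP => I; rewrite ffunE /shom /= subn0.
by rewrite sum_incr0 det_mx00 rmorph1 mulr1 ffunE (incr0P J).
Qed.

Definition coord1 (w : {ffun incr 2 1 -> R}) : {poly K} * {poly K} :=
  (coord (incr1 0) w, coord (incr1 1) w).

Lemma coord1_linear : linear coord1.
Proof. by move=> c u v; rewrite /coord1 !linearP. Qed.
HB.instance Definition _ := GRing.isLinear.Build K {ffun incr 2 1 -> R} ({poly K} * {poly K})%type *:%R
  coord1 coord1_linear.

Lemma ord2P (Q : 'I_2 -> Prop) : Q 0 -> Q 1 -> forall i, Q i.
Proof.
move=> Q0 Q1 -[[|[|//]] hi].
  by rewrite (_ : Ordinal hi = 0) //; apply: val_inj.
by rewrite (_ : Ordinal hi = 1) //; apply: val_inj.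
Qed.

Lemma coker1_forms q n : (0 < q)%N -> qdim (one_forms d q) (one_image d g q) n ->
  has_dim_coker f d 1 q n.
Proof.
move=> q0 h; have qd : (1 <= q * d)%N by rewrite muln_gt0 q0; lia.
apply: (qdim_has (pullback_subspace 1 q)).
apply: (qdim_comap (f := coord1) (homog_form_subspace 2 1 (q * d)) (one_image_subspace d g q) _ _ _ h).
- by move=> w hw; split; apply: dehom_form_deg.
- move=> [p p'] [hp hp'].
  have [|w hw ew] := @form_ex 1 (q * d) (fun J => pair2 p p' (tnth (val J) ord0)) qd.
    by move=> J; rewrite /pair2; case: ifP.
  exists w => //; rewrite /= /coord1 /coord !ew /pair2 /= subrr.
  exact: subspace0 (one_image_subspace d g q).
have minor0 i : dehom (minor (incr1 i) (incr1 0)) = (g i)^`() by rewrite det_mx11 mxE /= dehom_d0.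
have minor1 i : dehom (minor (incr1 i) (incr1 1)) = d%:R *: g i - 'X * (g i)^`().
  by rewrite det_mx11 mxE /= (dehom_d1 (f_homog _)).
move=> w hw; split=> [[v hv e]|[a ha e]].
  exists (fun i => v (incr1 i)); first by move/homog_formP: hv => hv i; apply: hv.
  have {}e := (pullbackE hw hv).1 e; rewrite /= /coord1 /coord /pull1.
  congr (_, _); [rewrite (e (incr1 0)) | rewrite (e (incr1 1))]; rewrite sum_incr1.
    by apply: eq_bigr => i _; rewrite minor0.
  by apply: eq_bigr => i _; rewrite minor1.
pose v : form 3 1 := [ffun I : incr 3 1 => a (tnth (val I) ord0)].
have hv : homog_form q v by apply/homog_formP => I; rewrite ffunE.
exists v => //; apply/(pullbackE hw hv) => J; rewrite sum_incr1.
have [j ->] := incr1P J; case: e; rewrite /coord; move: j; apply: ord2P => [-> _|_ ->].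
  by apply: eq_bigr => i _; rewrite minor0 ffunE.
by apply: eq_bigr => i _; rewrite minor1 ffunE.
Qed.

Lemma coker2_forms q n : (0 < q)%N -> qdim (deg_le (q * d - 2)) (jac_image g q) n ->
  has_dim_coker f d 2 q n.
Proof.
move=> q0 h; have qd : (2 <= q * d)%N by nia.
apply: (qdim_has (pullback_subspace 2 q)).
apply: (qdim_comap (f := coord incr2) (homog_form_subspace 2 2 (q * d)) (jac_image_subspace g q) _ _ _ h).
- by move=> w hw; apply: dehom_form_deg.
- move=> p hp; have [|w hw ew] := @form_ex 2 (q * d) (fun=> p) qd; first by [].
  by exists w => //; rewrite /= /coord ew subrr; apply: subspace0 (jac_image_subspace g q).
(* The second partial derivative is d f - X f', so each minor of the Jacobian is d times one of (f',
   f), which is opposite to (f, f'). The middle sign differs because the increasing pair (0, 2)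
   reverses the cyclic order of [cross]. *)
pose s : 'I_3 -> K := triple (- d%:R) d%:R (- d%:R).
have s0 i : s i != 0.
  have d0 : d%:R != 0 :> K by rewrite pnatr_eq0; lia.
  by move: i; apply: ord3P; rewrite /s !tripleE ?oppr_eq0.
have minorE i : dehom (minor (coincr i) incr2) = s i *: jac g i.
  rewrite det_mx22 !mxE rmorphB !rmorphM /=.
  have e0 (t : R) : dehom t^`M(ord0) = (dehom t)^`() by apply: dehom_d0.
  have e1 b : dehom (tnth f b)^`M(ord_max) = d%:R *: g b - 'X * (g b)^`().
    by rewrite -(dehom_d1 (f_homog _)); congr (dehom _^`M(_)); apply: val_inj.
  have t0 (a b : 'I_3) : tnth [tuple a; b] ord0 = a by [].
  have t1 (a b : 'I_3) : tnth [tuple a; b] ord_max = b by [].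
  rewrite !e0 !e1 -!mul_polyC; move: i; apply: ord3P;
    by rewrite /s /jac /cross !tripleE /= ?polyCN !t0 !t1 /affine_param; ring.
move=> w hw; split=> [[v hv e]|[a ha e]].
  exists (fun i => s i *: v (coincr i)).
    by move=> i; move/homog_formP: hv => hv; apply: (subspaceZ (shom_subspace K 3 2 q)).
  have {}e := (pullbackE hw hv).1 e; rewrite /= /coord (e incr2) sum_coincr.
  by apply: eq_bigr => i _; rewrite minorE evZ -scalerAl -scalerAr.
have [v vE] : exists v : form 3 2, forall i, v (coincr i) = (s i)^-1 *: a i.
  have inj : injective coincr by apply: ord3P; apply: ord3P.
  exists [ffun I => \sum_(i | coincr i == I) (s i)^-1 *: a i] => i.
  by rewrite ffunE (bigD1 i) //= big1 ?addr0 // => j /andP[/eqP/inj -> /eqP].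
have hv : homog_form q v.
  apply/homog_formP => I; have [i ->] := coincrP I; rewrite vE.
  exact: (subspaceZ (shom_subspace K 3 2 q)).
exists v => //; apply/(pullbackE hw hv) => J; rewrite (incr2P J) sum_coincr; rewrite /= /coord in e.
rewrite e; apply: eq_bigr => i _.
by rewrite minorE vE evZ -scalerAl -scalerAr scalerA mulVf ?scale1r.
Qed.

End Forms.

Theorem theorem4p1 (R : realType) (d : nat) (f : 3.-tuple {mpoly R[i][2]})
    (F : {mpoly R[i][3]})
    (d_ge3 : (3 <= d)%N)
    (f_homog : forall i, tnth f i \is d.-homog)
    (f_gcd : gcd_one f)
    (f_generic : generically_one_to_one f)
    (F_homog : F \is d.-homog)
    (F_def : defining_equation f F) :
  exists delta tau : nat,
    [/\ has_delta F delta,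
        has_tjurina F tau,
        delta = (((d - 1) * (d - 2)) %/ 2)%N /\
        (forall q, (0 < q)%N -> (d - 2 <= q)%N -> has_dim_coker f d 0 q delta),
        (forall q, (0 < q)%N -> (d <= q)%N -> has_dim_coker f d 1 q tau) /\
        (forall d1 d2, free_curve F d1 d2 ->
           forall q, (0 < q)%N -> (d - 2 <= q)%N -> has_dim_coker f d 1 q tau)
      & (* iii) *)
        (delta <= tau)%N /\
        [/\ forall q, (0 < q)%N -> (d <= q)%N ->
              has_dim_coker f d 2 q (tau - delta),
            forall d1 d2, free_curve F d1 d2 ->
              forall q, (0 < q)%N -> (d - d1 - 1 <= q)%N ->
                has_dim_coker f d 2 q (tau - delta)
          & forall d1 d2, nearly_free_curve F d1 d2 ->
              forall q, (0 < q)%N -> (d + 1 <= q + d1)%N ->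
                has_dim_coker f d 2 q (tau - delta)]].
Proof.
have rc := affine_rational_curve d_ge3 f_homog f_gcd f_generic F_homog F_def.
have [n hn] := coker2 rc.
have c1 q : (0 < q)%N -> (d - 2 <= q)%N ->
    qdim (deg_le (q * d - 2)) (jac_image (affine_param f) q) n ->
    has_dim_coker f d 1 q (delta d + n).
  move=> q0 dq h; apply: (coker1_forms d_ge3 f_homog q0); apply: (coker1 rc q0) h.
  by apply: (qdim_coker0 rc); lia.
exists (delta d), (delta d + n)%N; rewrite addKn; split; last (split; [exact: leq_addr | split]).
- exact: delta_curve rc.
- exists (2 * d - 3)%N => k hk.
  (* The degree k of the Jacobian ideal corresponds to q = k + 3 - d, which is at least d once k >=
     2d - 3. *)
  have -> : k = ((k + 3 - d) + d - 3)%N by lia.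
  apply: (qdim_has (jacobian_ideal_subspace F _)).
  by apply: (tjurina rc); [lia | apply: hn; lia].
- split=> // q q0 dq; apply: (coker0_forms d_ge3 f_homog).
  by apply: (qdim_coker0 rc); lia.
- split=> [q q0 dq|d1 d2 fr q q0 dq]; first by apply: c1 => //; [lia | apply: hn].
  have [d10 e] := free_exponents rc hn fr.
  (* As d1 >= 1, the bound d2 = d - 1 - d1 <= d - 2 <= q holds. *)
  by apply: c1 => //; apply: (free_coker2 rc hn fr) => //; lia.
- by move=> q q0 dq; apply: (coker2_forms d_ge3 f_homog q0); apply: hn.
- move=> d1 d2 fr q q0 dq; have [d10 e] := free_exponents rc hn fr.
  by apply: (coker2_forms d_ge3 f_homog q0); apply: (free_coker2 rc hn fr) => //; lia.
- move=> d1 d2 nf q q0 dq; have e := nearly_free_exponents rc hn nf.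
  by apply: (coker2_forms d_ge3 f_homog q0); apply: (nearly_free_coker2 rc hn nf); lia.
Qed.
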